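(* Let $m\ge1$ be an integer and $N>0$ a real number. The non-homogeneous (affine) fast extended triangle map $\tilde G^A$ on $$X=\Big\{(t_1,\dots,t_m)\times[u_1,\dots,u_m]:1>t_1>\cdots>t_m>0,\ u_i>0,\ N-\sum_{i=1}^mt_iu_i>u_m\Big\}$$ is the natural extension of the fast triangle map $G$ on the simplex $\triangle_m^A=\{(t_1,\dots,t_m)\in\mathbb R^m:1>t_1>\cdots>t_m>0\}$, with factor map $\psi((t_1,\dots,t_m)\times[u_1,\dots,u_m])=(t_1,\dots,t_m)$.
   Context: For $(t_1,\dots,t_m)\times[u_1,\dots,u_m]$ put $u_0=N-\sum_{i=1}^mt_iu_i$. For an integer $n\ge0$, $\tilde G_n^A$ has domain the set of points of $X$ with $1-t_1-nt_m>0>1-t_1-(n+1)t_m$ (and $u_0>u_m$), and is given for $m>1$ by $$\tilde G_n^A\big((t_1,\dots,t_m)\times[u_1,\dots,u_m]\big)=\Big(\tfrac{t_2}{t_1},\dots,\tfrac{t_m}{t_1},\tfrac{1-t_1-nt_m}{t_1}\Big)\times\big[t_1u_2,\dots,t_1u_{m-1},t_1(nu_0+u_m),t_1u_0\big],$$ and for $m=1$ by $\tilde G_n^A((t)\times[u])=\big(\tfrac{1-(n+1)t}{t}\big)\times[t(N-tu)]$. The map $\tilde G^A$ equals $\tilde G_n^A$ on the domain of $\tilde G_n^A$, $n\ge0$. The fast triangle map on $\triangle_m^A$ is $$G(t_1,\dots,t_m)=\Big(\tfrac{t_2}{t_1},\dots,\tfrac{t_m}{t_1},\tfrac{1-t_1-nt_m}{t_1}\Big)\quad\text{if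 }1-t_1-nt_m\ge0>1-t_1-(n+1)t_m .$$ Points for which some forward iterate leaves the open domains above (a null set) are removed from both spaces. Measures: $X$ carries Lebesgue measure $\mu=dt_1\cdots dt_m\,du_1\cdots du_m$ and $\triangle_m^A$ carries $\nu=\psi_*\mu$, a constant multiple of $dt_1\cdots dt_m/(t_1\cdots t_{m-1}(1+t_m))$. Natural extension: given a measure preserving map $S:Y\to Y$ on $(Y,\mathcal G,\nu)$, a measure preserving map $R:X\to X$ on $(X,\mathcal F,\mu)$ is the natural extension of $S$, with factor map $\psi:X\to Y$, if (up to null sets): (1) $R$ is one-to-one; (2) $\psi$ is onto (with $\psi_*\mu=\nu$), and $\mathcal F$ is the $\sigma$-algebra generated by all $R^k\psi^{-1}(\mathcal G)$, $k\ge0$; (3) $\psi\circ R=S\circ\psi$; (4) every other such covering factors through $X$: if $R':X'\to X'$ is one-to-one and measure preserving and $\psi':X'\to Y$ is an onto measure preserving map with $\psi'\circ R'=S\circ\psi'$, then there is a measure preserving $\varphi:X'\to X$ with $\varphi\circ R'=R\circ\varphi$ and $\psi\circ\varphi=\psi'$.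
   Formalization: In (4), ''one-to-one'' for R' also requires that images of measurable sets be measurable up to null sets (automatic on standard Borel or Lebesgue spaces); for arbitrary measure spaces (4) fails with bare injectivity. The same stronger property is proved for R in (1). *)

(* Defs.v *)
From HB Require Import structures.
From mathcomp Require Import all_boot all_order all_algebra.
From mathcomp Require Import all_classical all_reals all_analysis.
From mathcomp Require Import measurable_realfun lebesgue_integral.
Set Implicit Arguments.
Unset Strict Implicit.
Unset Printing Implicit Defensive.
Import Order.TTheory GRing.Theory Num.Theory.
Import numFieldNormedType.Exports.
Local Open Scope classical_set_scope.
Local Open Scope ring_scope.

(* A measure space is given by an ambient measurable type T, a measure mu on  *)
(* T and a carrier X : set T on which mu is concentrated.  Maps are total     *)
(* functions between the ambient types; their values off the carrier are      *)
(* irrelevant.  All conditions are up to null sets.                           *)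

Section mod_null.
Context {R : realType}.

Definition carried_by d (T : measurableType d) (mu : set T -> \bar R)
  (X : set T) := measurable X /\ mu (~` X) = 0%E.

Definition measure_preserving d d' (T : measurableType d)
    (T' : measurableType d') (X : set T) (mu : set T -> \bar R)
    (nu : set T' -> \bar R) (f : T -> T') :=
  measurable_fun X f /\
  forall B, measurable B -> mu (X `&` f @^-1` B) = nu B.

Definition null_eq d (T : measurableType d) (mu : set T -> \bar R)
  (A B : set T) := mu.-negligible ((A `\` B) `|` (B `\` A)).

Definition measurable_mod_null d (T : measurableType d)
  (mu : set T -> \bar R) (A : set T) := exists2 B, measurable B & null_eq mu A B.

(* For injective measurable maps between standard Borel spaces, and for       *)
(* injective measure preserving maps of Lebesgue spaces, the usual setting of *)
(* natural extensions, images of measurable sets are measurable mod null      *)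
(* sets.  On arbitrary measurable spaces this has to be part of the notion of *)
(* a one-to-one map: on Y * Z with the sigma-algebra of the sets B * Z, B     *)
(* measurable in Y, every (y, z) |-> (S y, c (y, z)) is as measurable as S,   *)
(* and for Z large enough some c makes it injective.                          *)
Definition one_to_one_mod_null d (T : measurableType d) (X : set T)
    (mu : set T -> \bar R) (f : T -> T) :=
  exists D, [/\ measurable D, D `<=` X, mu (X `\` D) = 0%E,
    {in D &, injective f} &
    forall A, measurable A -> A `<=` D -> measurable_mod_null mu (f @` A)].

Definition onto_mod_null d d' (T : measurableType d) (T' : measurableType d')
    (X : set T) (Y : set T') (nu : set T' -> \bar R) (f : T -> T') :=
  nu.-negligible (Y `\` f @` X).

Record invertible_covering d d' (TX : measurableType d)
    (TY : measurableType d') (X : set TX) (mu : {measure set TX -> \bar R})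
    (f : TX -> TX) (Y : set TY) (nu : {measure set TY -> \bar R})
    (g : TY -> TY) (psi : TX -> TY) : Prop := InvertibleCovering {
  covering_carried : carried_by mu X ;
  covering_preserving : measure_preserving X mu mu f ;
  covering_one_to_one : one_to_one_mod_null X mu f ;
  covering_factor_preserving : measure_preserving X mu nu psi ;
  covering_factor_onto : onto_mod_null X Y nu psi ;
  covering_factor_equivariant : {ae mu, forall x, psi (f x) = g (psi x)}
}.

Definition forward_images d d' (TX : measurableType d)
    (TY : measurableType d') (X : set TX) (f : TX -> TX) (psi : TX -> TY)
    : set (set TX) :=
  [set A | exists k B, measurable B /\ A = iter k f @` (X `&` psi @^-1` B)].

Record natural_extension d d' (TX : measurableType d) (TY : measurableType d')
    (X : set TX) (mu : {measure set TX -> \bar R}) (f : TX -> TX)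
    (Y : set TY) (nu : {measure set TY -> \bar R}) (g : TY -> TY)
    (psi : TX -> TY) : Prop := NaturalExtension {
  natural_base_carried : carried_by nu Y ;
  natural_base_preserving : measure_preserving Y nu nu g ;
  natural_covering : invertible_covering X mu f Y nu g psi ;
  (* the completion of the sigma-algebra of X is that of the generated one *)
  natural_generated : forall A, A `<=` X ->
    measurable_mod_null mu A <->
    exists2 E, <<s X, forward_images X f psi >> E & null_eq mu A E ;
  natural_universal : forall (d'' : measure_display)
      (TX' : measurableType d'') (X' : set TX')
      (mu' : {measure set TX' -> \bar R}) (f' : TX' -> TX') (psi' : TX' -> TY),
    invertible_covering X' mu' f' Y nu g psi' ->
    exists phi : TX' -> TX, [/\ measure_preserving X' mu' mu phi,
      {ae mu', forall x, phi (f' x) = f (phi x)} &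
      {ae mu', forall x, psi (phi x) = psi' x}]
}.

End mod_null.

Section lebesgue_tuple.
Context {R : realType}.

Definition tuple_cons n (p : R * n.-tuple R) : n.+1.-tuple R :=
  [tuple of p.1 :: p.2].

Lemma measurable_tuple_cons n : measurable_fun setT (@tuple_cons n).
Proof. exact: measurable_cons. Qed.

Section step.
Variables (n : nat) (nu : {sigma_finite_measure set (n.-tuple R) -> \bar R}).

Definition lebesgue_cons : set (n.+1.-tuple R) -> \bar R :=
  pushforward (lebesgue_measure \x nu)%E (@tuple_cons n).

Let cons0 : lebesgue_cons set0 = 0%E.
Proof. by rewrite /lebesgue_cons /pushforward preimage_set0 measure0. Qed.

Let cons_ge0 A : (0 <= lebesgue_cons A)%E.
Proof. by rewrite /lebesgue_cons /pushforward; exact: measure_ge0. Qed.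

Let cons_sigma_additive : semi_sigma_additive lebesgue_cons.
Proof.
move=> F mF tF mUF; rewrite /lebesgue_cons /pushforward preimage_bigcup.
apply: measure_semi_sigma_additive.
- by move=> i; rewrite -[X in measurable X]setTI; exact: measurable_tuple_cons.
- apply/trivIsetP => /= i j _ _ ij; rewrite -preimage_setI.
  by move/trivIsetP : tF => /(_ _ _ _ _ ij) ->//; rewrite preimage_set0.
- rewrite -preimage_bigcup -[X in measurable X]setTI.
  exact: measurable_tuple_cons.
Qed.

HB.instance Definition _ := isMeasure.Build _ _ _ lebesgue_cons
  cons0 cons_ge0 cons_sigma_additive.

Let cons_sigma_finite : sigma_finite setT lebesgue_cons.
Proof.
have /sigma_finiteP[F [TF ndF Foo]] := sigma_finiteT (@lebesgue_measure R).
have /sigma_finiteP[G [TG ndG Goo]] := sigma_finiteT nu.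
pose uncons (t : n.+1.-tuple R) : R * n.-tuple R := (thead t, [tuple of behead t]).
have muncons : measurable_fun setT uncons.
  apply/measurable_fun_pairP; split; last exact: measurable_behead.
  exact: measurable_tnth.
have consK : cancel (@tuple_cons n) uncons.
  by move=> [x t]; congr pair; apply: val_inj.
exists (fun i => uncons @^-1` (F i `*` G i)).
  apply/seteqP; split => // t _; set p := uncons t.
  have [i _ Fi] : (\bigcup_i F i) p.1 by rewrite -TF.
  have [j _ Gj] : (\bigcup_i G i) p.2 by rewrite -TG.
  exists (maxn i j) => //; split.
    by move: Fi; exact/subsetPset/ndF/leq_maxl.
  by move: Gj; exact/subsetPset/ndG/leq_maxr.
move=> i; have [mF Fi] := Foo i; have [mG Gi] := Goo i.
have mFG : measurable (F i `*` G i) by exact: measurableX.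
split; first by rewrite -[X in measurable X]setTI; exact: muncons.
rewrite /lebesgue_cons /pushforward -comp_preimage.
rewrite (_ : uncons \o _ = id); last by apply/funext => p; exact: consK.
by rewrite preimage_id product_measure1E// lte_mul_pinfty// ge0_fin_numE.
Qed.

HB.instance Definition _ := @Measure_isSigmaFinite.Build _ _ _ lebesgue_cons
  cons_sigma_finite.
End step.

(* Lebesgue measure on Borel sets of R^n; a unit mass on the point R^0. *)
Fixpoint lebesgue_tuple n : {sigma_finite_measure set (n.-tuple R) -> \bar R} :=
  match n with
  | 0 => \d_([tuple])
  | n'.+1 => lebesgue_cons (lebesgue_tuple n')
  end.

End lebesgue_tuple.

Section triangle.
Context {R : realType} (m : nat).
Implicit Types (t u : m.-tuple R) (x : m.-tuple R * m.-tuple R) (n i : nat).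

(* Coordinates are numbered from 1; a point t * [u] is the pair (t, u). *)
Definition crd t i : R := nth 0 t i.-1.

Definition simplex : set (m.-tuple R) :=
  [set t | [/\ 1 > crd t 1,
    (forall i, (1 <= i < m)%N -> crd t i > crd t i.+1) & crd t m > 0]].

Definition triangle_branch n t : m.-tuple R :=
  [tuple if i.+1 == m then (1 - crd t 1 - n%:R * crd t m) / crd t 1
         else crd t i.+2 / crd t 1 | i < m].

(* At most one n satisfies the condition, and one does on the simplex. *)
Definition triangle_digit t : nat :=
  xget 0 [set n | 1 - crd t 1 - n%:R * crd t m >= 0 /\
                  0 > 1 - crd t 1 - n.+1%:R * crd t m].

Definition triangle_map t : m.-tuple R := triangle_branch (triangle_digit t) t.

Definition triangle_open_domain n : set (m.-tuple R) :=
  simplex `&` [set t | 1 - crd t 1 - n%:R * crd t m > 0 /\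
                       0 > 1 - crd t 1 - n.+1%:R * crd t m].

(* The points all of whose forward iterates stay in the open domains. *)
Definition triangle_space : set (m.-tuple R) :=
  [set t | forall k, exists n, triangle_open_domain n (iter k triangle_map t)].

Variable N : R.

Definition u0 x : R := N - \sum_(1 <= i < m.+1) crd x.1 i * crd x.2 i.

Definition extended_full_space : set (m.-tuple R * m.-tuple R) :=
  [set x | [/\ simplex x.1, (forall i, (1 <= i <= m)%N -> crd x.2 i > 0) &
               u0 x > crd x.2 m]].

(* For m = 1 only the first case of the second component occurs. *)
Definition extended_branch n x : m.-tuple R * m.-tuple R :=
  let t1 := crd x.1 1 in
  (triangle_branch n x.1,
   [tuple if i.+1 == m then t1 * u0 x
          else if i.+2 == m then t1 * (n%:R * u0 x + crd x.2 m)
          else t1 * crd x.2 i.+2 | i < m]).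

Definition extended_domain n : set (m.-tuple R * m.-tuple R) :=
  extended_full_space `&`
  [set x | 1 - crd x.1 1 - n%:R * crd x.1 m > 0 /\
           0 > 1 - crd x.1 1 - n.+1%:R * crd x.1 m].

(* The domains are pairwise disjoint; off their union the value is junk. *)
Definition extended_map x : m.-tuple R * m.-tuple R :=
  extended_branch (xget 0 [set n | extended_domain n x]) x.

Definition extended_space : set (m.-tuple R * m.-tuple R) :=
  [set x | forall k, exists n, extended_domain n (iter k extended_map x)].

Lemma measurable_lt_set d (T : measurableType d) (f g : T -> R) :
  measurable_fun setT f -> measurable_fun setT g ->
  measurable [set y | f y < g y].
Proof.
move=> mf mg; have := measurable_fun_ltr mf mg measurableT (Y := [set true]) I.
by rewrite setTI; congr measurable; apply/seteqP; split => y.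
Qed.

Lemma measurable_crd i : measurable_fun setT (crd ^~ i).
Proof.
have [im|mi] := ltnP i.-1 m; last first.
  rewrite (_ : crd ^~ i = cst 0); first exact: measurable_cst.
  by apply/funext => t; rewrite /crd nth_default ?size_tuple.
rewrite (_ : crd ^~ i = @tnth _ R ^~ (Ordinal im)); first exact: measurable_tnth.
by apply/funext => t; rewrite /crd (tnth_nth 0).
Qed.

Lemma measurable_simplex : measurable simplex.
Proof.
rewrite (_ : simplex = [set t | crd t 1 < 1] `&`
    (\bigcap_(i in [set i | (1 <= i < m)%N]) [set t | crd t i.+1 < crd t i]) `&`
    [set t | 0 < crd t m]); last first.
  by apply/seteqP; split => [t [? ? ?]|t [[? ?] ?]]; split => //; split.
apply: measurableI; first apply: measurableI.
- apply: measurable_lt_set; [exact: measurable_crd|exact: measurable_cst].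
- apply: bigcap_measurableType => i _.
  by apply: measurable_lt_set; exact: measurable_crd.
- apply: measurable_lt_set; [exact: measurable_cst|exact: measurable_crd].
Qed.

Lemma measurable_u0 : measurable_fun setT u0.
Proof.
apply: measurable_funB => //; apply: measurable_sum => i.
apply: measurable_funM.
- exact: (measurableT_comp (measurable_crd i) measurable_fst).
- exact: (measurableT_comp (measurable_crd i) measurable_snd).
Qed.

Lemma measurable_extended_full_space : measurable extended_full_space.
Proof.
have m2 i : measurable_fun setT (fun x => crd x.2 i).
  exact: (measurableT_comp (measurable_crd i) measurable_snd).
rewrite (_ : extended_full_space = (fst @^-1` simplex) `&`
    (\bigcap_(i in [set i | (1 <= i <= m)%N]) [set x | 0 < crd x.2 i]) `&`
    [set x | crd x.2 m < u0 x]); last first.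
  by apply/seteqP; split => [x [? ? ?]|x [[? ?] ?]]; split => //; split.
apply: measurableI; first apply: measurableI.
- rewrite -[X in measurable X]setTI.
  by apply: measurable_fst => //; exact: measurable_simplex.
- apply: bigcap_measurableType => i _.
  by apply: measurable_lt_set => //; exact: measurable_cst.
- by apply: measurable_lt_set => //; exact: measurable_u0.
Qed.

Definition extended_measure : {measure set (m.-tuple R * m.-tuple R) -> \bar R} :=
  mrestr (lebesgue_tuple m \x lebesgue_tuple m)%E measurable_extended_full_space.

Definition triangle_measure : {measure set (m.-tuple R) -> \bar R}.
Proof.
by refine (pushforward extended_measure fst); exact: measurable_fst.
Defined.

End triangle.

Arguments triangle_map {R} m t.
Arguments triangle_space R m _ : clear implicits.
Arguments triangle_measure {R} m N.
Arguments extended_map {R} m N x.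
Arguments extended_space {R} m N _.
Arguments extended_measure {R} m N.

(* Main.v *)
Require Import Defs.
From HB Require Import structures.
From mathcomp Require Import all_boot all_order all_algebra.
From mathcomp Require Import all_classical all_reals all_analysis.
From mathcomp Require Import measurable_realfun ring lra zify.
Import Order.TTheory GRing.Theory Num.Theory.
Import numFieldNormedType.Exports.
Set Implicit Arguments.
Unset Strict Implicit.
Unset Printing Implicit Defensive.
Local Open Scope classical_set_scope.
Local Open Scope ring_scope.

(** Write F for the extended map, G for the triangle map, and u_0, ..., u_m
    for the coordinates of a point of X over t.

    F preserves mu.  Each branch is a composition of shears that preserve
    Lebesgue measure (preserving_total_branch), and the digit can be read off
    the image of a point (branch_digit), so the branches have disjoint images.
    The whole space has finite volume (volume_box), and the domains fill it up
    to countably many hyperplanes.  The images have the same volumes as the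
    domains, so they fill it up to a null set as well, and F is a measure
    preserving bijection modulo null sets (extended_map_preserving).

    The past determines the point.  In the coordinates u_0, ..., u_m a branch
    acts on the fibres by a nonnegative matrix that depends on t only, and the
    product of 2m successive matrices is positive (dual_orbit_mixing).  Two
    points of one fibre, whose coordinates are tied by u_0 + t_1 u_1 + ... +
    t_m u_m = N, are therefore brought closer in 2m steps, by a factor
    1 - e(t) with e > 0 (fiber_contraction).  As G preserves a finite measure,
    the products of 1 - e along orbits tend to 0: their limit P satisfies
    P = (1 - e) P o G^2m, and integration gives P = 0 (survival_vanishes).
    By stationarity the same is true along orbits in negative time
    (chain_survival).  So if y_j is the projection of F^-j x, then x is the
    limit of F^j (s (y_j)), where s is any section of the projection
    (reconstruct_self).

    Generation and universality.  The sets y_j^-1 B are the images under F^j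
    of the sets of points over B, and x is a limit of functions of the y_j;
    hence these images generate all measurable sets modulo null sets
    (measurable_generated).  In an arbitrary invertible covering with map f
    and projection psi, the functions y_j = psi o f^-j still exist, are
    measurable because f maps measurable sets to measurable sets modulo null
    sets (push_forward_real), and have the law of t.  The limit phi of
    F^j (s (y_j)) exists for the same reason as in X.  The law of
    F^j (s (y_j)) is the same in every covering, so phi has the law that
    the limit has in X itself, which is mu (limit_law); and phi commutes with
    the maps since F is continuous on fibres (universal). *)

(** * Measure preserving maps and product measures *)

Definition shuffle (T1 T2 T3 T4 : Type) (p : (T1 * T2) * (T3 * T4)) :=
  ((p.1.1, p.2.1), (p.1.2, p.2.2)).

Section mp.
Context {R : realType}.

Lemma preservingT d d' (T : measurableType d) (T' : measurableType d')
  (mu : set T -> \bar R) (nu : set T' -> \bar R) (f : T -> T') :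
  measurable_fun setT f -> (forall B, measurable B -> mu (f @^-1` B) = nu B) ->
  measure_preserving setT mu nu f.
Proof. by move=> mf fE; split => // B mB; rewrite setTI fE. Qed.

Lemma preserving_preimage d d' (T : measurableType d) (T' : measurableType d')
  (mu : set T -> \bar R) (nu : set T' -> \bar R) (f : T -> T') B :
  measure_preserving setT mu nu f -> measurable B -> mu (f @^-1` B) = nu B.
Proof. by move=> [_ fE] mB; rewrite -fE// setTI. Qed.

Lemma measurable_preimage d d' (T : measurableType d) (T' : measurableType d')
  (f : T -> T') B : measurable_fun setT f -> measurable B ->
  measurable (f @^-1` B).
Proof. by move=> mf mB; rewrite -[X in measurable X]setTI; exact: mf. Qed.

Lemma preserving_id d (T : measurableType d) (mu : set T -> \bar R) :
  measure_preserving setT mu mu id.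
Proof. by apply: preservingT. Qed.

Lemma preserving_comp d d' d'' (T : measurableType d) (T' : measurableType d')
  (T'' : measurableType d'')
  (mu : set T -> \bar R) (nu : set T' -> \bar R) (ka : set T'' -> \bar R)
  (f : T -> T') (g : T' -> T'') :
  measure_preserving setT nu ka g -> measure_preserving setT mu nu f ->
  measure_preserving setT mu ka (g \o f).
Proof.
move=> hg hf; apply: preservingT; first exact: measurableT_comp hg.1 hf.1.
move=> B mB; rewrite comp_preimage (preserving_preimage hf) ?(preserving_preimage hg)//.
exact: measurable_preimage hg.1 mB.
Qed.

Lemma preserving_can d d' (T : measurableType d) (T' : measurableType d')
  (mu : set T -> \bar R) (nu : set T' -> \bar R) (f : T -> T') (g : T' -> T) :
  cancel f g -> measurable_fun setT g ->
  measure_preserving setT mu nu f -> measure_preserving setT nu mu g.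
Proof.
move=> fK mg hf; apply: preservingT => // B mB.
rewrite -(preserving_preimage hf); last exact: measurable_preimage.
by congr (mu _); apply/seteqP; split => x /=; rewrite fK.
Qed.

(** Fubini: the section at x of the preimage of a set is the preimage under f x
    of its section at x. *)
Lemma preserving_skew d1 d2 d3 (T1 : measurableType d1) (T2 : measurableType d2)
  (T3 : measurableType d3) (mu : {measure set T1 -> \bar R})
  (nu : {sigma_finite_measure set T2 -> \bar R})
  (ka : {sigma_finite_measure set T3 -> \bar R}) (f : T1 -> T2 -> T3) :
  measurable_fun setT (fun p => f p.1 p.2) ->
  (forall x, measure_preserving setT nu ka (f x)) ->
  measure_preserving setT (mu \x nu)%E (mu \x ka)%E
    (fun p => (p.1, f p.1 p.2)).
Proof.
move=> mf fE; apply: preservingT.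
  by apply/measurable_fun_pairP; split => //; exact: measurable_fst.
move=> B mB; apply: eq_integral => x _ /=.
rewrite -(preserving_preimage (fE x)); last exact: measurable_xsection.
by congr (nu _); apply/seteqP; split => y; rewrite /xsection/= !inE.
Qed.

(** Uniqueness of the product measure reduces the claim to rectangles. *)
Lemma preserving_rectangles d d1 d2 (T : measurableType d) (T1 : measurableType d1)
  (T2 : measurableType d2) (mu : {sigma_finite_measure set T1 -> \bar R})
  (nu : {sigma_finite_measure set T2 -> \bar R}) (m : {measure set T -> \bar R})
  (f : T -> T1 * T2) : measurable_fun setT f ->
  (forall A B, measurable A -> measurable B ->
    m (f @^-1` (A `*` B)) = (mu A * nu B)%E) ->
  measure_preserving setT m (mu \x nu)%E f.
Proof.
move=> mf fE; apply: preservingT => // B mB.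
have @m' : {measure set (T1 * T2) -> \bar R}.
  by refine (pushforward m f); exact: mf.
by rewrite (@product_measure_unique _ _ _ _ _ mu nu m').
Qed.

Section prod.
Context d1 d2 d3 (T1 : measurableType d1) (T2 : measurableType d2)
  (T3 : measurableType d3).
Variables (mu : {sigma_finite_measure set T1 -> \bar R})
  (nu : {sigma_finite_measure set T2 -> \bar R})
  (ka : {sigma_finite_measure set T3 -> \bar R}).

Lemma preserving_swap : measure_preserving setT (mu \x nu)%E (nu \x mu)%E
  (fun p => (p.2, p.1)).
Proof.
have ms : measurable_fun setT (fun p : T1 * T2 => (p.2, p.1)).
  exact: measurable_swap.
apply: preserving_rectangles => // A C mA mC.
transitivity ((mu \x nu)%E (C `*` A)); last by rewrite product_measure1E// muleC.
by congr (product_measure1 _ _ _); apply/seteqP; split => [x|x] [? ?].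
Qed.

Definition assocr (p : (T1 * T2) * T3) := (p.1.1, (p.1.2, p.2)).
Definition assocl (p : T1 * (T2 * T3)) := ((p.1, p.2.1), p.2.2).

Lemma measurable_assocr : measurable_fun setT assocr.
Proof.
have m1 : measurable_fun setT (fun p : (T1 * T2) * T3 => p.1.1).
  exact: (measurableT_comp measurable_fst measurable_fst).
have m2 : measurable_fun setT (fun p : (T1 * T2) * T3 => p.1.2).
  exact: (measurableT_comp measurable_snd measurable_fst).
apply/measurable_fun_pairP; split => //; apply/measurable_fun_pairP; split => //.
exact: measurable_snd.
Qed.

Lemma measurable_assocl : measurable_fun setT assocl.
Proof.
have m1 : measurable_fun setT (fun p : T1 * (T2 * T3) => p.2.1).
  exact: (measurableT_comp measurable_fst measurable_snd).
have m2 : measurable_fun setT (fun p : T1 * (T2 * T3) => p.2.2).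
  exact: (measurableT_comp measurable_snd measurable_snd).
apply/measurable_fun_pairP; split => //; apply/measurable_fun_pairP; split => //.
exact: measurable_fst.
Qed.

Lemma preserving_assocr : measure_preserving setT ((mu \x nu) \x ka)%E
  (mu \x (nu \x ka))%E assocr.
Proof.
apply: preservingT => [|B mB]; first exact: measurable_assocr.
have mB' := measurable_preimage measurable_assocr mB.
rewrite {1}/product_measure1 fubini_tonelli1//; last first.
  exact: measurable_fun_xsection.
apply: eq_integral => x _; apply: eq_integral => y _ /=.
by congr (ka _); apply/seteqP; split => z; rewrite /xsection/= !inE /= inE.
Qed.

Lemma preserving_assocl : measure_preserving setT (mu \x (nu \x ka))%E
  ((mu \x nu) \x ka)%E assocl.
Proof.
apply: preserving_can preserving_assocr; last exact: measurable_assocl.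
by move=> [[]].
Qed.
End prod.

Section prod4.
Context d1 d2 d3 d4 (T1 : measurableType d1) (T2 : measurableType d2)
  (T3 : measurableType d3) (T4 : measurableType d4).
Variables (m1 : {sigma_finite_measure set T1 -> \bar R})
  (m2 : {sigma_finite_measure set T2 -> \bar R})
  (m3 : {sigma_finite_measure set T3 -> \bar R})
  (m4 : {sigma_finite_measure set T4 -> \bar R}).

Lemma preserving_prod (f : T1 -> T3) (g : T2 -> T4) :
  measure_preserving setT m1 m3 f -> measure_preserving setT m2 m4 g ->
  measure_preserving setT (m1 \x m2)%E (m3 \x m4)%E (fun p => (f p.1, g p.2)).
Proof.
move=> hf hg.
(* One factor is moved at a time; the first one is brought to second place by
   the swap. *)
have h1 : measure_preserving setT (m1 \x m2)%E (m1 \x m4)%E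
    (fun p => (p.1, g p.2)).
  by apply: (@preserving_skew _ _ _ _ _ _ m1 m2 m4 (fun=> g)) => //;
    exact: (measurableT_comp hg.1 measurable_snd).
have h2 : measure_preserving setT (m4 \x m1)%E (m4 \x m3)%E
    (fun p => (p.1, f p.2)).
  by apply: (@preserving_skew _ _ _ _ _ _ m4 m1 m3 (fun=> f)) => //;
    exact: (measurableT_comp hf.1 measurable_snd).
have := preserving_comp (preserving_swap m4 m3) (preserving_comp h2
  (preserving_comp (preserving_swap m1 m4) h1)).
by [].
Qed.

End prod4.

End mp.

Section mps.
Context {R : realType}.
Section prodm.
Context d1 d2 (T1 : measurableType d1) (T2 : measurableType d2).
Variables (m1 : {sigma_finite_measure set T1 -> \bar R})
  (m2 : {sigma_finite_measure set T2 -> \bar R}).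
(** The product under a name of its own, to which the sigma-finiteness needed by
    products of products is attached. *)
Definition prodm : set (T1 * T2) -> \bar R := (m1 \x m2)%E.

HB.instance Definition _ := Measure.on prodm.

Let prodm_sigma_finite : sigma_finite setT prodm.
Proof.
have /sigma_finiteP[F [TF ndF Foo]] := sigma_finiteT m1.
have /sigma_finiteP[G [TG ndG Goo]] := sigma_finiteT m2.
exists (fun n => F n `*` G n).
  apply/seteqP; split => // -[x y] _.
  have [i _ Fi] : (\bigcup_i F i) x by rewrite -TF.
  have [j _ Gj] : (\bigcup_i G i) y by rewrite -TG.
  exists (maxn i j) => //; split => /=.
    by move: Fi; exact/subsetPset/ndF/leq_maxl.
  by move: Gj; exact/subsetPset/ndG/leq_maxr.
move=> k; have [mF Fk] := Foo k; have [mG Gk] := Goo k.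
split; first exact: measurableX.
by rewrite /prodm product_measure1E// lte_mul_pinfty// ge0_fin_numE.
Qed.

HB.instance Definition _ := Measure_isSigmaFinite.Build _ _ _ prodm
  prodm_sigma_finite.
End prodm.

Section shuffle.
Context d1 d2 d3 d4 (T1 : measurableType d1) (T2 : measurableType d2)
  (T3 : measurableType d3) (T4 : measurableType d4).
Variables (m1 : {sigma_finite_measure set T1 -> \bar R})
  (m2 : {sigma_finite_measure set T2 -> \bar R})
  (m3 : {sigma_finite_measure set T3 -> \bar R})
  (m4 : {sigma_finite_measure set T4 -> \bar R}).

Let inner : measure_preserving setT (m2 \x (m3 \x m4))%E
    (m3 \x (m2 \x m4))%E (fun p => (p.2.1, (p.1, p.2.2))).
Proof.
have sw := preserving_prod (m1 := prodm m2 m3) (m3 := prodm m3 m2)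
      (preserving_swap m2 m3) (preserving_id m4).
have := preserving_comp (preserving_assocr m3 m2 m4) (preserving_comp sw
  (preserving_assocl m2 m3 m4)).
by [].
Qed.

Lemma preserving_shuffle :
  measure_preserving setT ((m1 \x m2) \x (m3 \x m4))%E
   ((m1 \x m3) \x (m2 \x m4))%E (@shuffle T1 T2 T3 T4).
Proof.
have a1 := preserving_assocr m1 m2 (prodm m3 m4).
have a2 := preserving_assocl m1 m3 (prodm m2 m4).
have a3 := preserving_prod (m2 := prodm m2 (prodm m3 m4))
   (m4 := prodm m3 (prodm m2 m4)) (preserving_id m1) inner.
have := preserving_comp a2 (preserving_comp a3 a1).
by [].
Qed.
End shuffle.
End mps.

(** * Inversion in the plane *)

Section one_dim.
Context {R : realType}.
Notation mu := (@lebesgue_measure R).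

Lemma lebesgue_affine (c d : R) (B : set R) : c != 0 -> measurable B ->
  (`|c|%:E * mu ((fun x => (c * x + d)%R) @^-1` B) = mu B)%E.
Proof.
move=> c0 mB.
have mf : measurable_fun setT (fun x : R => c * x + d).
  by apply: measurable_funD => //; exact: measurable_funM.
have @p : {measure set (measurableTypeR R) -> \bar R}.
  by refine (pushforward mu ((fun x : R => c * x + d)%R : R -> measurableTypeR R)); exact: mf.
have @m' : {measure set (measurableTypeR R) -> \bar R}.
  by refine (mscale (NngNum (normr_ge0 c)) p).
(* Half-open intervals determine Lebesgue measure; for c < 0 their preimages
   are open on the other side. *)
transitivity (m' B) => //; apply/esym/(@lebesgue_measure_unique _ m') => // X [[a b] _ <-] /=.
rewrite /m' /p /= /mscale /= /pushforward.
have [ba|ab] := leP b a.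
  by rewrite set_itv_ge ?bnd_simp -?leNgt// preimage_set0 !measure0 mule0.
rewrite lebesgue_measure_itv/= lte_fin ab.
have [cp|cn] := ltP 0 c.
  rewrite (_ : _ @^-1` _ = `](a - d) / c, (b - d) / c]%classic); last first.
    apply/seteqP; split => x; rewrite /= !in_itv/= ltr_pdivrMr// ler_pdivlMr//;
      rewrite ltrBlDr lerBrDr (mulrC x) => /andP[-> ->]//.
  rewrite lebesgue_measure_itv/= lte_fin ltr_pM2r ?invr_gt0// ltrD2r ab.
  rewrite -!EFinD -EFinM; congr EFin.
  rewrite gtr0_norm//; field; exact: lt0r_neq0.
have {}cn : c < 0 by rewrite lt_neqAle c0.
rewrite (_ : _ @^-1` _ = `[(b - d) / c, (a - d) / c[%classic); last first.
  apply/seteqP; split => x; rewrite /= !in_itv/= ltr_ndivlMr// ler_ndivrMr//;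
    rewrite ltrBlDr lerBrDr (mulrC x) andbC => /andP[-> ->]//.
rewrite lebesgue_measure_itv/= lte_fin ltr_nM2r ?invr_lt0// ltrD2r ab.
rewrite -!EFinD -EFinM; congr EFin.
rewrite ltr0_norm//; field; exact: c0.
Qed.

(** Inversion, prolonged by the identity to the nonpositive half-line: the
    branches become maps of the whole space, which may be composed and which
    preserve measure without any restriction of the domain. The weight
    half_inv_jac is the absolute value of the derivative. *)
Definition half_inv (a : R) : R := if 0 < a then a^-1 else a.
Definition half_inv_jac (a : R) : R := if 0 < a then a^-1 ^+ 2 else 1.

Lemma measurable_gt0 : measurable_fun setT (fun a : R => (0 < a)%R).
Proof. exact: measurable_fun_ltr. Qed.

Lemma measurable_inv_pos : measurable_fun [set a : R | 0 < a] (fun a => a^-1).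
Proof.
apply: open_continuous_measurable_fun.
  exact: (@open_gt R 0).
by move=> x; rewrite inE/= => x0; apply: inv_continuous; rewrite gt_eqF.
Qed.

Lemma measurable_half_inv : measurable_fun setT half_inv.
Proof.
apply: measurable_fun_if => //; first exact: measurable_gt0.
rewrite setTI (_ : _ @^-1` _ = [set a : R | 0 < a]).
  exact: measurable_inv_pos.
by apply/seteqP; split => x.
Qed.

Lemma measurable_invr : measurable_fun setT (@GRing.inv R).
Proof.
rewrite (_ : GRing.inv = fun x : R => if 0 < x then half_inv x else
    if x < 0 then - half_inv (- x) else 0); last first.
  apply/funext => x; rewrite /half_inv oppr_gt0.
  by case: ltgtP => [//|x0|<-]; rewrite ?invr0// invrN opprK.
have m0 : measurable_fun setT (fun x : R => - half_inv (- x)).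
  by apply: measurable_funN; exact: (measurableT_comp measurable_half_inv).
apply: measurable_fun_ifT; [exact: measurable_gt0|exact: measurable_half_inv|].
by apply: measurable_fun_ifT => //; exact: measurable_fun_ltr.
Qed.

Lemma measurable_half_inv_jac : measurable_fun setT half_inv_jac.
Proof.
apply: measurable_fun_if => //; first exact: measurable_gt0.
rewrite setTI (_ : _ @^-1` _ = [set a : R | 0 < a]).
  by apply: measurable_funX; exact: measurable_inv_pos.
by apply/seteqP; split => x.
Qed.

Lemma half_inv_jac_gt0 a : 0 < half_inv_jac a.
Proof. by rewrite /half_inv_jac; case: ifPn => // a0; rewrite exprn_gt0// invr_gt0. Qed.

(** This is the integral of a^-2 from 1/y to infinity. *)
Lemma integral_half_inv_pos (y : R) : 0 < y ->
  (\int[mu]_a ((half_inv_jac a * \1_(`]0, y]%classic : set R) (half_inv a))%R%:E) = y%:E)%E.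
Proof.
move=> y0.
transitivity (\int[mu]_(a in `[y^-1%R, +oo[) (a^-1 ^+ 2)%R%:E)%E.
  rewrite [RHS]integral_mkcond; apply: eq_integral => a _; rewrite patchE/=.
  rewrite mem_setE in_itv/= andbT indicE mem_setE in_itv/= /half_inv /half_inv_jac.
  case: ltP => a0.
    rewrite invr_gt0 a0/= -[X in (_ <= X)%R]invrK lef_pV2 ?posrE ?invr_gt0//.
    by case: ifPn; rewrite ?mulr1 ?mulr0.
  rewrite ltNge a0/= mulr0 ifF//.
  by apply/negbTE; rewrite -ltNge (le_lt_trans a0)// invr_gt0.
have yV0 : 0 < y^-1 by rewrite invr_gt0.
rewrite (@ge0_continuous_FTC2y _ _ (fun a => - a^-1) y^-1 0).
- by rewrite invrK EFinN oppeK add0e.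
- by move=> x _; exact: sqr_ge0.
- apply: continuous_in_subspaceT => x; rewrite inE/= in_itv/= andbT => yx.
  have x0 : x != 0 by rewrite gt_eqF// (lt_le_trans yV0).
  rewrite (_ : (fun _ => _) = (fun a : R => a^-1 * a^-1)); last first.
    by apply/funext => a; rewrite expr2.
  by apply: cvgM; exact: inv_continuous.
- rewrite -oppr0; apply: cvgN.
  apply/cvgrVy.
    by near=> x; rewrite invr_gt0; near: x; exact: nbhs_pinfty_gt.
  rewrite [X in X @ _](_ : _ = id); first exact: cvg_id.
  by apply/funext => x; rewrite /= invrK.
- move=> x x0; apply: derivableN; apply: derivableV => //.
  by rewrite gt_eqF// (lt_trans yV0).
- apply: cvg_at_right_filter.
  by apply: cvgN; apply: cvgV => //; rewrite gt_eqF.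
- move=> x; rewrite in_itv/= andbT => x0.
  have xn0 : x != 0 by rewrite gt_eqF// (lt_trans yV0).
  rewrite derive1E deriveN; last exact: derivableV.
  rewrite deriveV// derive_id.
  by rewrite scaleNr opprK exprVn scaler1.
Unshelve. all: by end_near. Qed.
End one_dim.

Section inversion.
Context {R : realType}.
Notation mu := (@lebesgue_measure R).

(* The region under the graph of the weight. Projecting the area of W, instead
   of integrating the weight, gives a set function that is known to be a
   measure. *)
Let W : set (R * R) := [set p | 0 < p.2 < half_inv_jac p.1].

Let mW : measurable W.
Proof.
rewrite (_ : W = [set p | 0 < p.2] `&` [set p | p.2 < half_inv_jac p.1]).
  apply: measurableI; apply: measurable_lt_set => //.
  exact: (measurableT_comp measurable_half_inv_jac measurable_fst).
by apply/seteqP; split => p; [move=> /andP|move=> [? ?]; apply/andP].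
Qed.

Let inv_measure : {measure set (measurableTypeR R) -> \bar R}.
Proof.
refine (pushforward (mrestr (mu \x mu)%E mW)
  ((fun p => half_inv p.1) : R * R -> measurableTypeR R)).
exact: (measurableT_comp measurable_half_inv measurable_fst).
Defined.

Let inv_measureE (A : set R) : measurable A ->
  inv_measure A = (\int[mu]_a ((half_inv_jac a * \1_A (half_inv a))%R%:E))%E.
Proof.
move=> mA; rewrite /inv_measure /= /pushforward /mrestr /product_measure1.
apply: eq_integral => a _ /=.
rewrite indicE; case: (boolP (half_inv a \in A)) => aA.
  rewrite mulr1 (_ : xsection _ _ = `]0, half_inv_jac a[%classic).
    by rewrite lebesgue_measure_itv/= lte_fin half_inv_jac_gt0 sube0.
  apply/seteqP; split => y; rewrite /xsection/= inE/= /W in_itv/=.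
    by move=> [].
  by move=> ?; split => //; rewrite inE in aA.
rewrite mulr0 (_ : xsection _ _ = set0) ?measure0//.
apply/seteqP; split => // y; rewrite /xsection/= inE/= => -[aA' _].
by move: aA; rewrite notin_setE.
Qed.

Let inv_measure_neg (A : set R) : measurable A -> A `<=` [set a | a <= 0] ->
  inv_measure A = mu A.
Proof.
move=> mA A0; rewrite inv_measureE// -[in RHS](setIT A) -integral_indic//.
apply: eq_integral => a _; congr EFin; rewrite /half_inv_jac /half_inv.
case: ltP => // a0; last by rewrite mul1r.
rewrite !indicE !memNset ?mulr0// => /A0 /=.
  by rewrite leNgt a0.
by rewrite leNgt invr_gt0 a0.
Qed.

Let inv_measure_pos (y : R) : 0 <= y -> inv_measure `]0, y]%classic = y%:E.
Proof.
rewrite le_eqVlt => /predU1P[<-|y0].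
  by rewrite set_itv_ge ?bnd_simp ?ltxx// measure0.
by rewrite inv_measureE//; exact: integral_half_inv_pos.
Qed.

(** Both sides are measures of A, and it is enough to compare them on half-open
    intervals; one that contains 0 is cut there. *)
Lemma integral_half_inv (A : set R) : measurable A ->
  (\int[mu]_a ((half_inv_jac a * \1_A (half_inv a))%R%:E) = mu A)%E.
Proof.
move=> mA; rewrite -inv_measureE//.
apply/esym/(@lebesgue_measure_unique _ inv_measure) => // X [[a b] _ <-].
rewrite [(a, b).1]/= [(a, b).2]/=.
have [ba|ab] := leP b a.
  by rewrite set_itv_ge ?bnd_simp -?leNgt// !measure0.
have [b0|b0] := leP b 0.
  rewrite inv_measure_neg// => x /=; rewrite in_itv/= => /andP[_ xb].
  exact: le_trans b0.
rewrite lebesgue_measure_itv/= lte_fin ab.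
have split x y z : x <= y -> y <= z ->
    inv_measure `]x, z]%classic =
    (inv_measure `]x, y]%classic + inv_measure `]y, z]%classic)%E.
  move=> xy yz; rewrite -measureU//.
    by rewrite -itv_bndbnd_setU.
  apply/seteqP; split => // t [] /=; rewrite !in_itv/= => /andP[_ ty] /andP[].
  by rewrite ltNge ty.
have [a0|a0] := leP 0 a.
  have := inv_measure_pos (ltW b0).
  rewrite (split _ a)// ?(ltW ab)// inv_measure_pos// => <-.
  by rewrite addeAC subee// add0e.
rewrite (split _ 0)// ?(ltW a0) ?(ltW b0)// inv_measure_pos ?(ltW b0)//.
rewrite inv_measure_neg//; last by move=> x /=; rewrite in_itv/= => /andP[].
by rewrite lebesgue_measure_itv/= lte_fin a0 -!EFinD; congr EFin; lra.
Qed.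

(** For a > 0 the second coordinate is stretched by a^2, which cancels the
    weight a^-2 of the inversion. The translation by c is arbitrary, since it
    acts on each vertical line separately. *)
Lemma preserving_half_inv (c : R) : measure_preserving setT (mu \x mu)%E (mu \x mu)%E
  (fun p => (half_inv p.1,
             if (0 < p.1)%R then (p.1 * (c - p.1 * p.2))%R else p.2)).
Proof.
set f := (fun p => _).
have mf : measurable_fun setT f.
  apply/measurable_fun_pairP; split.
    exact: (measurableT_comp measurable_half_inv measurable_fst).
  apply: measurable_fun_ifT => //=.
    exact: (measurableT_comp measurable_gt0 measurable_fst).
  apply: measurable_funM => //; apply: measurable_funB => //.
  exact: measurable_funM.
apply: preserving_rectangles => // A C mA mC.
rewrite -[X in (X * _)%E](integral_half_inv mA) [LHS]/= /product_measure1.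
rewrite -ge0_integralZr//; last 2 first.
- apply/measurable_EFinP; apply: measurable_funM.
    exact: measurable_half_inv_jac.
  exact: (measurableT_comp (measurable_indic mA) measurable_half_inv).
- by move=> x _; rewrite lee_fin mulr_ge0// ltW// half_inv_jac_gt0.
apply: eq_integral => a _ /=.
rewrite indicE; case: (boolP (half_inv a \in A)) => aA; last first.
  rewrite mulr0 mul0e (_ : xsection _ _ = set0) ?measure0//.
  apply/seteqP; split => // y; rewrite /xsection/= inE/= => -[aA' _].
  by move: aA; rewrite notin_setE.
rewrite inE in aA; rewrite mulr1.
rewrite (_ : xsection _ _ = [set b | C (if 0 < a then a * (c - a * b) else b)]);
  last first.
  by apply/seteqP; split => y; rewrite /xsection/= inE/=; tauto.
rewrite /half_inv_jac; case: ltP => a0; last by rewrite mul1e.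
have aa0 : - (a ^+ 2) != 0 by rewrite oppr_eq0 sqrf_eq0 gt_eqF.
transitivity ((a^-1 ^+ 2)%:E * (`|- (a ^+ 2)|%:E *
    mu ((fun x => (- (a ^+ 2) * x + c * a)%R) @^-1` C)))%E; last first.
  by rewrite lebesgue_affine.
rewrite muleA -EFinM normrN ger0_norm ?sqr_ge0//.
rewrite -exprMn mulVf ?gt_eqF// expr1n mul1e; congr (lebesgue_measure _).
by apply/seteqP; split => b /=; rewrite (_ : a * _ = - a ^+ 2 * b + c * a)//; ring.
Qed.
End inversion.

(** * Elementary volume preserving maps of pairs of tuples *)

Section tuples.
Context {R : realType}.
Notation mu := (@lebesgue_measure R).
Notation L := (@lebesgue_tuple R).

Definition tuple_uncons n (t : n.+1.-tuple R) : R * n.-tuple R :=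
  (thead t, [tuple of behead t]).

Lemma tuple_consK n : cancel (@tuple_cons R n) (@tuple_uncons n).
Proof. by move=> [x t]; congr pair; apply: val_inj. Qed.

Lemma measurable_tuple_uncons n : measurable_fun setT (@tuple_uncons n).
Proof.
apply/measurable_fun_pairP; split; last exact: measurable_behead.
exact: measurable_tnth.
Qed.

Lemma preserving_cons n : measure_preserving setT (mu \x L n)%E (L n.+1) (@tuple_cons R n).
Proof. by apply: preservingT => //; exact: measurable_tuple_cons. Qed.

Lemma preserving_uncons n :
  measure_preserving setT (L n.+1) (mu \x L n)%E (@tuple_uncons n).
Proof.
apply: (preserving_can _ _ (preserving_cons n)); first exact: tuple_consK.
exact: measurable_tuple_uncons.
Qed.

Definition tuple_rcons n (p : n.-tuple R * R) : n.+1.-tuple R :=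
  [tuple of rcons p.1 p.2].

Lemma preserving_rcons n : measure_preserving setT (L n \x mu)%E (L n.+1) (@tuple_rcons n).
Proof.
elim: n => [|n IH].
  have := preserving_comp (preserving_cons 0) (preserving_swap (L 0) mu).
  congr measure_preserving; apply/funext => -[t r]; apply: val_inj => /=.
  by rewrite (tuple0 t).
(* A tuple followed by a number: the head is set aside, the number is appended
   to the tail, the head is put back. *)
have h1 := preserving_prod (m3 := prodm mu (L n)) (preserving_uncons n)
  (preserving_id mu).
have h2 := preserving_comp (preserving_assocr mu (L n) mu) h1.
have h3 := preserving_prod (m2 := prodm (L n) mu) (preserving_id mu) IH.
have := preserving_comp (preserving_cons n.+1) (preserving_comp h3 h2).
congr measure_preserving; apply/funext => -[t r]; apply: val_inj => /=.
by case/tupleP : t.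
Qed.

Lemma preserving_scale1 (a : R) : a != 0 ->
  measure_preserving setT (mu \x mu)%E (mu \x mu)%E
    (fun p => (p.1 / a, a * p.2)%R).
Proof.
move=> a0; apply: preserving_rectangles => [|A B mA mB].
  apply/measurable_fun_pairP; split.
    exact: (measurable_funM measurable_fst (measurable_cst _)).
  exact: (measurable_funM (measurable_cst _) measurable_snd).
transitivity ((mu \x mu)%E (((fun x => a^-1 * x + 0) @^-1` A) `*`
    ((fun x => a * x + 0) @^-1` B))).
  by congr (product_measure1 _ _ _); apply/seteqP; split => -[x y] /=;
    rewrite !addr0 (mulrC x).
have mf (c : R) : measurable_fun setT (fun x : R => c * x + 0).
  by apply: measurable_funD => //; exact: measurable_funM.
have mpre (c : R) (C : set R) : measurable C ->
    measurable ((fun x : R => c * x + 0) @^-1` C).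
  exact: measurable_preimage.
rewrite product_measure1E; [|exact: mpre..].
have E1 := lebesgue_affine 0 (invr_neq0 a0) mA.
have E2 := lebesgue_affine 0 a0 mB.
transitivity (`|a^-1|%:E * mu ((fun x => (a^-1 * x + 0)%R) @^-1` A) *
  (`|a|%:E * mu ((fun x => (a * x + 0)%R) @^-1` B)))%E; last by rewrite E1 E2.
by rewrite muleACA -EFinM -normrM mulVf// normr1 mul1e.
Qed.

Definition tuple_scale n (a : R) (p : n.-tuple R * n.-tuple R) :=
  ([tuple of map (fun x => x / a) p.1], [tuple of map (fun x => a * x) p.2]).

(** Each pair formed of a coordinate of the first tuple and the same coordinate
    of the second is mapped by a matrix of determinant one. *)
Lemma preserving_tuple_scale n (a : R) : a != 0 ->
  measure_preserving setT (L n \x L n)%E (L n \x L n)%E (@tuple_scale n a).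
Proof.
move=> a0; elim: n => [|n IH].
  have := preserving_id (L 0 \x L 0)%E.
  by congr measure_preserving; apply/funext => -[t u]; congr pair;
    rewrite tuple0 [RHS]tuple0.
have h1 := preserving_prod (m3 := prodm mu (L n)) (m4 := prodm mu (L n))
  (preserving_uncons n) (preserving_uncons n).
have h2 := preserving_comp (preserving_shuffle mu (L n) mu (L n)) h1.
have h3 := preserving_comp
  (preserving_prod (m1 := prodm mu mu) (m2 := prodm (L n) (L n))
  (m3 := prodm mu mu) (m4 := prodm (L n) (L n)) (preserving_scale1 a0) IH) h2.
have h4 := preserving_comp (preserving_shuffle mu mu (L n) (L n)) h3.
have := preserving_comp (preserving_prod (m1 := prodm mu (L n)) (m2 := prodm mu (L n))
   (preserving_cons n) (preserving_cons n)) h4.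
congr measure_preserving; apply/funext => -[t u].
by case/tupleP : t => x t; case/tupleP : u => y u; congr pair; apply: val_inj.
Qed.

Definition add_last n (c : R) (t : n.-tuple R) : n.-tuple R :=
  [tuple if i.+1 == n then tnth t i + c else tnth t i | i < n].

Lemma add_last_cons n c (x : R) (t : n.-tuple R) :
  add_last c [tuple of x :: t] =
  if n == 0%N then [tuple of x + c :: t] else [tuple of x :: add_last c t].
Proof.
apply: eq_from_tnth => i; rewrite tnth_mktuple.
case: (unliftP ord0 i) => [j|] ->.
  rewrite lift0 eqSS tnthS [n == 0%N]gtn_eqF ?(leq_ltn_trans (leq0n j))//.
  by rewrite tnthS tnth_mktuple.
by rewrite tnth0 /= eqSS eq_sym; case: ifPn; rewrite tnth0.
Qed.

Lemma preserving_add_last n c :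
  measure_preserving setT (L n) (L n) (@add_last n c).
Proof.
elim: n => [|n IH].
  have := preserving_id (L 0).
  by congr measure_preserving; apply/funext => t; rewrite tuple0 [RHS]tuple0.
have [n0|n0] := eqVneq n 0%N.
  have sh : measure_preserving setT mu mu (fun x => x + c).
    apply: preservingT => [|B mB]; first exact: measurable_funD.
    rewrite -(lebesgue_affine c (oner_neq0 _) mB) normr1 mul1e.
    by congr (mu _); apply/seteqP; split => x /=; rewrite mul1r.
  have := preserving_comp (preserving_cons n) (preserving_comp
    (preserving_prod sh (preserving_id (L n))) (preserving_uncons n)).
  congr measure_preserving; apply/funext => t; case/tupleP : t => x t /=.
  rewrite add_last_cons ifT; last exact/eqP.
  exact: val_inj.
have := preserving_comp (preserving_cons n) (preserving_comp (preserving_prod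
  (preserving_id mu) IH) (preserving_uncons n)).
congr measure_preserving; apply/funext => t; case/tupleP : t => x t /=.
rewrite add_last_cons (negbTE n0) theadE; apply: val_inj.
by congr (_ :: tval (add_last c _)); apply: val_inj.
Qed.

End tuples.

Section tuple_measurability.
Context {R : realType} d (T : measurableType d).

Lemma measurable_tnth_comp n (f : T -> n.-tuple R) i :
  measurable_fun setT f -> measurable_fun setT (fun x => tnth (f x) i).
Proof. exact: (measurableT_comp (measurable_tnth i)). Qed.

Lemma measurable_mktuple n (F : T -> 'I_n -> R) :
  (forall i, measurable_fun setT (F ^~ i)) ->
  measurable_fun setT (fun x => [tuple F x i | i < n]).
Proof.
move=> mF; apply/measurable_fun_tnthP => i.
by apply: eq_measurable_fun (mF i) => x _ /=; rewrite tnth_mktuple.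
Qed.

Lemma measurable_funV (f : T -> R) :
  measurable_fun setT f -> measurable_fun setT (fun x => (f x)^-1).
Proof. exact: (measurableT_comp measurable_invr). Qed.

End tuple_measurability.

Lemma measurable_last {R : realType} n (x0 : R) :
  measurable_fun setT (fun t : n.-tuple R => last x0 t).
Proof.
case: n => [|n].
  by apply: (eq_measurable_fun (cst x0)) => // t _; rewrite (tuple0 t).
apply: (eq_measurable_fun (fun t : n.+1.-tuple R => tnth t ord_max)).
  by move=> t _; rewrite (last_nth x0) size_tuple (tnth_nth x0)/=; case/tupleP: t.
exact: measurable_tnth.
Qed.

(** * The branches as compositions of volume preserving maps *)

Section branch.
Context {R : realType} (k : nat).
Notation mu := (@lebesgue_measure R).
Notation L := (@lebesgue_tuple R).
Notation Lk := (@lebesgue_tuple R k).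
Variables (N : R) (n : nat).

Definition pairing (t u : k.-tuple R) : R := \sum_(i < k) tnth t i * tnth u i.

(** A branch with digit n is a composition of three shears, each of which
    changes some of the coordinates by a volume preserving map that depends on
    the others. Put a = t_1, b = u_1 and let t', u' be the remaining
    coordinates. First t' is divided by a and u' multiplied by a; call the
    results s and w. Then (a, b) becomes (1/a - 1 - n s_k, a (N - <s, w> - a
    b)), where s_k is the last entry of s: this is the last coordinate of the
    image of t together with t_1 u_0, because <s, w> = <t', u'>. Finally n times
    this t_1 u_0 is added to the last entry of w. If m = 1 then s is empty and
    s_k stands for t_m / t_1 = 1, whence the default value 1 of last. *)
Definition scale_step (p : (R * R) * (k.-tuple R * k.-tuple R)) :=
  if 0 < p.1.1 then tuple_scale p.1.1 p.2 else p.2.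

Definition inv_step (p : (k.-tuple R * k.-tuple R) * (R * R)) :=
  (half_inv p.2.1 - (1 + n%:R * last 1 p.1.1),
   if 0 < p.2.1 then p.2.1 * (N - pairing p.1.1 p.1.2 - p.2.1 * p.2.2)
   else p.2.2).

Definition add_step (p : (R * R) * (k.-tuple R * k.-tuple R)) :=
  (p.2.1, add_last (n%:R * p.1.2) p.2.2).

Let Lkk := prodm Lk Lk.
Let mumu := prodm mu mu.

Lemma preserving_scale_step : measure_preserving setT (mumu \x Lkk)%E (mumu \x Lkk)%E
  (fun p => (p.1, scale_step p)).
Proof.
pose f (q : R * R) (p : k.-tuple R * k.-tuple R) := scale_step (q, p).
apply: (@preserving_skew _ _ _ _ _ _ _ mumu Lkk Lkk f).
  have m11 : measurable_fun setT
      (fun q : (R * R) * (k.-tuple R * k.-tuple R) => q.1.1).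
    exact: (measurableT_comp measurable_fst measurable_fst).
  apply: measurable_fun_ifT; last exact: measurable_snd.
    exact: measurable_fun_ltr.
  apply/measurable_fun_pairP; split; apply/measurable_fun_tnthP => i.
    apply: (eq_measurable_fun (fun q : (R * R) * (k.-tuple R * k.-tuple R) =>
      tnth q.2.1 i / q.1.1)) => [q _ /=|]; first by rewrite tnth_map.
    apply: measurable_funM; last exact: measurable_funV.
    by apply: measurable_tnth_comp; exact: (measurableT_comp measurable_fst).
  apply: (eq_measurable_fun (fun q : (R * R) * (k.-tuple R * k.-tuple R) =>
    q.1.1 * tnth q.2.2 i)) => [q _ /=|]; first by rewrite tnth_map.
  apply: measurable_funM => //.
  by apply: measurable_tnth_comp; exact: (measurableT_comp measurable_snd).
move=> [a b]; rewrite /f /scale_step /=; case: ltP => a0; last exact: preserving_id.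
by apply: preserving_tuple_scale; rewrite gt_eqF.
Qed.

Lemma preserving_inv_step : measure_preserving setT (Lkk \x mumu)%E (Lkk \x mumu)%E
  (fun p => (p.1, inv_step p)).
Proof.
pose f (q : k.-tuple R * k.-tuple R) (p : R * R) := inv_step (q, p).
apply: (@preserving_skew _ _ _ _ _ _ _ Lkk mumu mumu f).
  have m21 : measurable_fun setT
      (fun q : (k.-tuple R * k.-tuple R) * (R * R) => q.2.1).
    exact: (measurableT_comp measurable_fst measurable_snd).
  have m22 : measurable_fun setT
      (fun q : (k.-tuple R * k.-tuple R) * (R * R) => q.2.2).
    exact: (measurableT_comp measurable_snd measurable_snd).
  have m11 : measurable_fun setT
      (fun q : (k.-tuple R * k.-tuple R) * (R * R) => q.1.1).
    exact: (measurableT_comp measurable_fst measurable_fst).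
  have m12 : measurable_fun setT
      (fun q : (k.-tuple R * k.-tuple R) * (R * R) => q.1.2).
    exact: (measurableT_comp measurable_snd measurable_fst).
  apply/measurable_fun_pairP; split.
    apply: measurable_funB.
      exact: (measurableT_comp measurable_half_inv m21).
    apply: measurable_funD => //; apply: measurable_funM => //.
    exact: (measurableT_comp (@measurable_last _ k 1) m11).
  apply: measurable_fun_ifT => //; first exact: measurable_fun_ltr.
  apply: measurable_funM => //; apply: measurable_funB => //; last first.
    exact: measurable_funM.
  apply: measurable_funB => //; apply: measurable_sum => i.
  by apply: measurable_funM; exact: measurable_tnth_comp.
move=> [s w]; rewrite /f /inv_step /=.
have sh c : measure_preserving setT mu mu (fun x => x - c).
  apply: preservingT => [|B mB]; first exact: measurable_funB.
  have := lebesgue_affine (- c) (oner_neq0 _) mB; rewrite normr1 mul1e => <-.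
  by congr (mu _); apply/seteqP; split => x /=; rewrite mul1r.
exact: (preserving_comp (preserving_prod (sh (1 + n%:R * last 1 s)) (preserving_id mu))
  (preserving_half_inv (N - pairing s w))).
Qed.

Lemma preserving_add_step : measure_preserving setT (mumu \x Lkk)%E (mumu \x Lkk)%E
  (fun p => (p.1, add_step p)).
Proof.
pose f (q : R * R) (p : k.-tuple R * k.-tuple R) := add_step (q, p).
apply: (@preserving_skew _ _ _ _ _ _ _ mumu Lkk Lkk f).
  apply/measurable_fun_pairP; split.
    exact: (measurableT_comp measurable_fst measurable_snd).
  have m22 : measurable_fun setT
      (fun q : (R * R) * (k.-tuple R * k.-tuple R) => q.2.2).
    exact: (measurableT_comp measurable_snd measurable_snd).
  have m12 : measurable_fun setT
      (fun q : (R * R) * (k.-tuple R * k.-tuple R) => q.1.2).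
    exact: (measurableT_comp measurable_snd measurable_fst).
  apply: measurable_mktuple => i; case: (i.+1 == k); last first.
    exact: measurable_tnth_comp.
  apply: measurable_funD; first exact: measurable_tnth_comp.
  exact: measurable_funM.
move=> [r v]; rewrite /f /add_step /=.
exact: (preserving_prod (preserving_id Lk) (preserving_add_last k (n%:R * v))).
Qed.

Definition total_branch (x : k.+1.-tuple R * k.+1.-tuple R) :=
  let ab := (thead x.1, thead x.2) in
  let sw := scale_step (ab, ([tuple of behead x.1], [tuple of behead x.2])) in
  let rv := inv_step (sw, ab) in
  let sw' := add_step (rv, sw) in
  (tuple_rcons (sw'.1, rv.1), tuple_rcons (sw'.2, rv.2)).

Lemma preserving_total_branch : measure_preserving setT (L k.+1 \x L k.+1)%E
  (L k.+1 \x L k.+1)%E total_branch.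
Proof.
have h0 := preserving_comp (preserving_shuffle mu Lk mu Lk)
  (preserving_prod (m3 := prodm mu Lk) (m4 := prodm mu Lk)
    (preserving_uncons k) (preserving_uncons k)).
have h1 := preserving_comp (preserving_swap mumu Lkk)
  (preserving_comp preserving_scale_step h0).
have h2 := preserving_comp (preserving_swap Lkk mumu)
  (preserving_comp preserving_inv_step h1).
have h3 := preserving_comp (preserving_swap mumu Lkk)
  (preserving_comp preserving_add_step h2).
have h4 := preserving_comp (preserving_shuffle Lk Lk mu mu) h3.
have := preserving_comp (preserving_prod (m1 := prodm Lk mu) (m2 := prodm Lk mu)
  (preserving_rcons k) (preserving_rcons k)) h4.
by [].
Qed.

End branch.

(** * Linearity on the fibres, and the inverse branches *)

Section algebra.
Context {R : realType} (k : nat) (N : R).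
Notation m := k.+1.
Notation point := (m.-tuple R * m.-tuple R)%type.
Implicit Types (t u : m.-tuple R) (x y : point) (n i : nat) (h : nat -> R).

(** The branches act on the fibres by affine maps of u_1, ..., u_m; with u_0 as
    a further coordinate they become linear. *)
Definition hcrd x i : R := if i == 0%N then u0 N x else crd x.2 i.

(** Up to the factor t_1, a branch acts on u_0, ..., u_m by this matrix with
    nonnegative entries, which depends on the digit only. The rows of u_0 + u_1
    and of n u_0 + u_m are the same one when m = 1, and their additional
    multiples of u_0 then add up. *)
Definition dual_step n h i : R :=
  if i == m then h 0%N
  else h i.+1 + ((i == 0%N)%:R + (i.+1 == m)%:R * n%:R) * h 0%N.

Lemma crd_mktuple (F : nat -> R) i : (1 <= i <= m)%N ->
  crd [tuple F j | j < m] i = F i.-1.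
Proof.
case: i => // i /= im; rewrite /crd /=.
by have := nth_mktuple (fun j : 'I_m => F j) 0 (Ordinal im); apply.
Qed.

Lemma crd_branch n t i : (1 <= i < m)%N ->
  crd (triangle_branch n t) i = crd t i.+1 / crd t 1.
Proof.
case: i => // i /andP[_ im].
rewrite (crd_mktuple (fun i => if i.+1 == m
  then (1 - crd t 1 - n%:R * crd t m) / crd t 1 else crd t i.+2 / crd t 1));
  last by rewrite /= ltnW.
by rewrite /= ltn_eqF.
Qed.

Lemma crd_branch_last n t :
  crd (triangle_branch n t) m = (1 - crd t 1 - n%:R * crd t m) / crd t 1.
Proof.
rewrite (crd_mktuple (fun i => if i.+1 == m
  then (1 - crd t 1 - n%:R * crd t m) / crd t 1 else crd t i.+2 / crd t 1))//=.
by rewrite eqxx.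
Qed.

Lemma crd_extended_branch n x i : (1 <= i <= m)%N ->
  crd (extended_branch N n x).2 i = crd x.1 1 * dual_step n (hcrd x) i.
Proof.
case: i => // i im.
rewrite (crd_mktuple (fun i => if i.+1 == m then crd x.1 1 * u0 N x
   else if i.+2 == m then crd x.1 1 * (n%:R * u0 N x + crd x.2 m)
   else crd x.1 1 * crd x.2 i.+2))//= /dual_step.
case: ifPn => // im'; rewrite /hcrd /= add0r.
by case: eqP => [->|_]; rewrite ?mul1r ?mul0r ?addr0// addrC.
Qed.

(** The coordinate u_0, defined by N = u_0 + t_1 u_1 + ... + t_m u_m, obeys the
    same linear rule as the others: t_1 times the transposed matrix takes (1,
    t_1, ..., t_m) of the image back to that of t, which keeps this pairing
    constant. *)
Lemma u0_extended_branch n x : crd x.1 1 != 0 ->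
  u0 N (extended_branch N n x) = crd x.1 1 * dual_step n (hcrd x) 0.
Proof.
move=> t0; rewrite {1}/u0 big_nat_recr//= crd_branch_last crd_extended_branch//;
  last by rewrite ltnSn.
rewrite {2}/dual_step eqxx.
rewrite (eq_big_nat _ _ (F2 := fun i => crd x.1 i.+1 * crd x.2 i.+1 +
   (i.+1 == m)%:R * (n%:R * crd x.1 m * u0 N x))); last first.
  move=> i /andP[i1 im].
  rewrite crd_branch ?i1// crd_extended_branch ?i1 ?(ltnW im)//.
  rewrite /dual_step (ltn_eqF im) (gtn_eqF i1) /hcrd /= add0r.
  rewrite mulrA divfK// mulrDr; congr (_ + _).
  by case: eqP => [->|_]; rewrite ?mul1r ?mul0r ?mulr0//; ring.
rewrite big_split/= -big_distrl/=.
have -> : \sum_(1 <= i < m) (i.+1 == m)%:R = (k != 0%N)%:R :> R.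
  case: (k) => [|j]; first by rewrite big_geq.
  rewrite big_nat_recr//= eqxx big_nat big1 ?add0r// => i /andP[_ ij].
  by rewrite eqSS ltn_eqF.
have : u0 N x = N - (crd x.1 1 * crd x.2 1 +
    \sum_(1 <= i < m) crd x.1 i.+1 * crd x.2 i.+1) by rewrite /u0 big_nat_recl.
rewrite /dual_step/= /hcrd/=; set S := \sum_(1 <= i < m) _.
move: (u0 N x) => U /eqP; rewrite eq_sym subr_eq => /eqP ->.
rewrite eqxx (eqSS 0%N k) (eq_sym 0%N); case: eqP => [k0|_] /=; last by field.
have -> : crd x.1 m = crd x.1 1 by congr crd; rewrite k0.
by field.
Qed.

Lemma hcrd_branch n x i : crd x.1 1 != 0 -> (i <= m)%N ->
  hcrd (extended_branch N n x) i = crd x.1 1 * dual_step n (hcrd x) i.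
Proof.
move=> t0; case: i => [_|i im]; first exact: u0_extended_branch.
by rewrite -crd_extended_branch.
Qed.

End algebra.

Section spaces.
Context {R : realType} (k : nat) (N : R).
Notation m := k.+1.
Notation point := (m.-tuple R * m.-tuple R)%type.
Implicit Types (t u : m.-tuple R) (x y : point) (n i : nat) (h : nat -> R).
Notation G := (@triangle_map R m).
Notation F := (@extended_map R m N).

Lemma simplex_crd t i : simplex t -> (1 <= i <= m)%N ->
  crd t m <= crd t i < 1.
Proof.
move=> [t1 dec tm].
have lo j : (1 <= m - j)%N -> crd t m <= crd t (m - j).
  elim: j => [|j IH] jm; first by rewrite subn0.
  have jm' : (1 <= m - j)%N by lia.
  apply: (le_trans (IH jm')); apply: ltW.
  have := dec (m - j.+1)%N; rewrite (_ : (m - j.+1).+1 = (m - j)%N); last by lia.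
  by apply; lia.
have hi j : (j < m)%N -> crd t j.+1 < 1.
  elim: j => // j IH jm; apply: lt_trans (IH (ltnW jm)).
  by apply: dec; lia.
case: i => // i im; rewrite hi// andbT.
have := lo (m - i.+1)%N; rewrite subKn//; apply; lia.
Qed.

Lemma simplex_crd_gt0 t i : simplex t -> (1 <= i <= m)%N -> 0 < crd t i.
Proof.
move=> st im; have /andP[+ _] := simplex_crd st im; apply: lt_le_trans.
by case: st.
Qed.

Lemma full_hcrd x i : extended_full_space N x -> (i <= m)%N -> 0 < hcrd N x i.
Proof.
move=> [sx ux u0x]; case: i => [_|i im]; last exact: ux.
by apply: lt_trans u0x; apply: ux; rewrite leqnn.
Qed.

Lemma dual_step_ge n h i : (forall j, (j <= m)%N -> 0 <= h j) -> (i < m)%N ->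
  h i.+1 <= dual_step k n h i.
Proof.
move=> h0 im; rewrite /dual_step ltn_eqF// lerDl.
by rewrite mulr_ge0 ?h0// addr_ge0// mulr_ge0.
Qed.

Lemma dual_step_ge0 n h : (forall j, (j <= m)%N -> 0 <= h j) ->
  forall i, (i <= m)%N -> 0 <= dual_step k n h i.
Proof.
move=> h0 i; rewrite leq_eqVlt => /predU1P[->|im].
  by rewrite /dual_step eqxx h0.
by apply: le_trans (dual_step_ge n h0 im); exact: h0.
Qed.

Lemma extended_domainE n x : extended_domain N n x <->
  extended_full_space N x /\ triangle_open_domain n x.1.
Proof.
rewrite /extended_domain /triangle_open_domain; split.
  by move=> [fx [? ?]]; split => //; split => //; case: fx.
by move=> [fx [_ [? ?]]].
Qed.

Lemma digit_unique t n n' : 0 <= 1 - crd t 1 - n%:R * crd t m ->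
  1 - crd t 1 - n.+1%:R * crd t m < 0 ->
  0 <= 1 - crd t 1 - n'%:R * crd t m ->
  1 - crd t 1 - n'.+1%:R * crd t m < 0 -> n = n'.
Proof.
move: (crd t 1) (crd t m) => a b h1 h2 h3 h4.
have b0 : 0 < b by move: h1 h2; rewrite -natr1; nra.
have lt n1 n2 : 0 <= 1 - a - n1%:R * b -> 1 - a - n2.+1%:R * b < 0 ->
    (n1 <= n2)%N.
  move=> e1 e2; have : n1%:R * b < n2.+1%:R * b by lra.
  by rewrite ltr_pM2r// ltr_nat ltnS.
by apply/eqP; rewrite eqn_leq !lt.
Qed.

Lemma triangle_digitE n t : 0 <= 1 - crd t 1 - n%:R * crd t m ->
  1 - crd t 1 - n.+1%:R * crd t m < 0 -> triangle_digit t = n.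
Proof.
move=> h1 h2; rewrite /triangle_digit.
have [h3 h4] := @xgetPex _ 0%N [set n | 1 - crd t 1 - n%:R * crd t m >= 0 /\
  0 > 1 - crd t 1 - n.+1%:R * crd t m] (ex_intro _ n (conj h1 h2)).
exact: (digit_unique h3 h4 h1 h2).
Qed.

Lemma triangle_mapE n t : triangle_open_domain n t -> G t = triangle_branch n t.
Proof.
move=> [_ [h1 h2]]; congr triangle_branch; apply: triangle_digitE => //.
exact: ltW.
Qed.

Lemma extended_mapE n x : extended_domain N n x -> F x = extended_branch N n x.
Proof.
move=> xn; congr extended_branch.
have [_ [h3 h4]] := @xgetPex _ 0%N [set n | extended_domain N n x]
  (ex_intro _ n xn).
case: (xn) => _ [h1 h2]; apply: (digit_unique (t := x.1)) => //; exact: ltW.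
Qed.

(** In the image the difference of u_0 and u_m is t_1 times a sum of u_1 > 0 and
    a nonnegative multiple of u_0, so the inequality between them persists. *)
Lemma branch_full n x : extended_domain N n x ->
  extended_full_space N (extended_branch N n x).
Proof.
move=> [fx [h1 h2]]; have [sx _ _] := fx.
have t0 : 0 < crd x.1 1 by apply: simplex_crd_gt0.
have tm0 : 0 < crd x.1 m by apply: simplex_crd_gt0; rewrite ?leqnn.
have hb i : (i <= m)%N -> 0 < hcrd N (extended_branch N n x) i.
  move=> im; rewrite hcrd_branch ?gt_eqF// mulr_gt0//.
  have [->|im'] := eqVneq i m.
    by rewrite /dual_step eqxx; exact: full_hcrd.
  have im2 : (i < m)%N by rewrite ltn_neqAle im'.
  apply: lt_le_trans (dual_step_ge n _ im2); first exact: full_hcrd.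
  by move=> j jm; apply/ltW/full_hcrd.
have [s1 dec sm] := sx.
have e1 : (extended_branch N n x).1 = triangle_branch n x.1 by [].
split; first (rewrite e1; split).
- have [k0|k0] := posnP k.
    have -> : crd (triangle_branch n x.1) 1 = crd (triangle_branch n x.1) m.
      by congr crd; rewrite k0.
    rewrite crd_branch_last ltr_pdivrMr// mul1r.
    have e : crd x.1 m = crd x.1 1 by congr crd; rewrite k0.
    by move: h2; rewrite -natr1 mulrDl mul1r e; lra.
  by rewrite crd_branch ?ltr_pdivrMr ?mul1r ?dec.
- move=> i /andP[i1 im]; rewrite [ltRHS]crd_branch ?i1//.
  move: im; rewrite leq_eqVlt => /predU1P[im|im].
    have -> : i.+1 = m by rewrite im.
    rewrite crd_branch_last ltr_pM2r ?invr_gt0//.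
    by move: h2; rewrite -natr1 mulrDl mul1r; lra.
  by rewrite crd_branch// ltr_pM2r ?invr_gt0// dec.
- by rewrite crd_branch_last divr_gt0.
- by move=> i im; have := hb i; rewrite /hcrd; case: i im => //= i im; apply.
- have := @hcrd_branch _ _ N n x 0 (lt0r_neq0 t0) (leq0n _).
  rewrite {1}/hcrd/= => ->; rewrite crd_extended_branch ?ltnSn//.
  rewrite ltr_pM2l// /dual_step eqxx/= addrC mulrDl mul1r -addrA ltrDl.
  rewrite ltr_pwDr ?full_hcrd// mulr_ge0 ?mulr_ge0//.
  by apply/ltW/full_hcrd.
Qed.

Lemma extended_map_full x : extended_full_space N x ->
  (exists n, triangle_open_domain n x.1) ->
  extended_full_space N (F x) /\ (F x).1 = G x.1.
Proof.
move=> fx [n xn]; have dn : extended_domain N n x by apply/extended_domainE.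
rewrite (extended_mapE dn) (triangle_mapE xn); split => //.
exact: branch_full.
Qed.

(** Branches map into the full space, so an orbit can leave the domains only
    through its projection. *)
Lemma extended_spaceE :
  extended_space m N = extended_full_space N `&` fst @^-1` triangle_space R m.
Proof.
apply/seteqP; split => [x xX|x [fx xY]].
  have key j : extended_full_space N (iter j F x) /\
      (iter j F x).1 = iter j G x.1.
    elim: j => [|j [fj ej]].
      by have [n /extended_domainE[]] := xX 0%N.
    have [n /extended_domainE[_ dn]] := xX j.
    have [h1 h2] := extended_map_full fj (ex_intro _ n dn).
    by rewrite !iterS; split => //; rewrite h2 ej.
  split; first by have [] := key 0%N.
  move=> j; have [n /extended_domainE[_ dn]] := xX j.
  by exists n; have [_ <-] := key j.
have key j : extended_full_space N (iter j F x) /\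
    (iter j F x).1 = iter j G x.1.
  elim: j => [//|j [fj ej]].
  have [n dn] := xY j; rewrite -ej in dn.
  have [h1 h2] := extended_map_full fj (ex_intro _ n dn).
  by rewrite !iterS; split => //; rewrite h2 ej.
move=> j; have [n dn] := xY j; exists n; apply/extended_domainE.
by have [h1 h2] := key j; rewrite h2.
Qed.

Lemma triangle_spaceS t : triangle_space R m t -> triangle_space R m (G t).
Proof. by move=> tY j; rewrite -iterSr; exact: tY. Qed.

Lemma triangle_space_simplex t : triangle_space R m t -> simplex t.
Proof. by move=> /(_ 0%N)[n []]. Qed.

Lemma extended_map_space x : extended_space m N x ->
  extended_space m N (F x) /\ (F x).1 = G x.1.
Proof.
rewrite extended_spaceE => -[fx xY].
have [h1 h2] := extended_map_full fx (xY 0%N).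
split => //; split => //; have := triangle_spaceS xY; rewrite -h2.
exact: id.
Qed.

(** The last coordinate of the image of t is 1/t_1 - 1 - n t_m/t_1, and t_m/t_1
    is the coordinate before it (or 1 when m = 1); this recovers 1/t_1 from the
    image. *)
Definition inv_radius n y : R :=
  crd y.1 m + 1 + n%:R * (if k == 0%N then 1 else crd y.1 k).

Lemma inv_radius_branch n x : crd x.1 1 != 0 ->
  inv_radius n (extended_branch N n x) = (crd x.1 1)^-1.
Proof.
move=> t0; rewrite /inv_radius crd_branch_last.
case: eqP => [k0|/eqP k0].
  have -> : crd x.1 m = crd x.1 1 by congr crd; rewrite k0.
  by field.
by rewrite crd_branch ?lt0n ?k0 ?ltnSn//; field.
Qed.

Definition inv_branch n y : point :=
  let r := inv_radius n y in
  ([tuple if val i == 0%N then r^-1 else crd y.1 i / r | i < m],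
   [tuple r * hcrd N y i - ((val i == 0%N)%:R + (i.+1 == m)%:R * n%:R) *
       (hcrd N y m * r) | i < m]).

Lemma inv_branchK n x : crd x.1 1 != 0 ->
  inv_branch n (extended_branch N n x) = x.
Proof.
move=> t0; rewrite /inv_branch; set r := inv_radius _ _.
have rE : r = (crd x.1 1)^-1 by exact: inv_radius_branch.
rewrite [RHS]surjective_pairing; congr pair; apply: eq_from_tnth => i.
  rewrite tnth_mktuple; case: eqP => [i0|/eqP i0].
    by rewrite rE invrK (tnth_nth 0) /crd/= i0.
  rewrite crd_branch ?lt0n ?i0 ?ltn_ord// rE.
  by rewrite invrK divfK// (tnth_nth 0).
rewrite tnth_mktuple !hcrd_branch// 1?ltnW// rE.
rewrite /dual_step eqxx (ltn_eqF (ltn_ord i)).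
have -> : tnth x.2 i = hcrd N x i.+1 by rewrite (tnth_nth 0).
by field.
Qed.

(** In the image, u_(m-1) = (n + c) u_m with c = u_m/u_0 taken before the step,
    so that 0 < c < 1 and the digit is an integral part. If m = 1 the factor is
    1 + n + c. The inequality u_0 > u_m in the definition of the space is what
    makes the images of the branches disjoint. *)
Lemma branch_digit n n' x x' : extended_domain N n x -> extended_domain N n' x' ->
  extended_branch N n x = extended_branch N n' x' -> n = n'.
Proof.
have key l (z : point) : extended_domain N l z ->
    exists2 c, 0 < c < 1 & hcrd N (extended_branch N l z) k =
      ((k == 0%N)%:R + l%:R + c) * hcrd N (extended_branch N l z) m.
  move=> [fz _]; have [sz uz0 u0z] := fz.
  have t0 : 0 < crd z.1 1 by apply: simplex_crd_gt0.
  have u0p : 0 < u0 N z by apply: lt_trans u0z; apply: uz0; rewrite leqnn.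
  exists (crd z.2 m / u0 N z).
    by rewrite divr_gt0 ?uz0 ?leqnn//= ltr_pdivrMr// mul1r.
  have t0' := lt0r_neq0 t0; rewrite !hcrd_branch ?leqnSn//.
  rewrite /dual_step eqxx (ltn_eqF (ltnSn k)) /hcrd/= mul1r.
  by field; rewrite gt_eqF.
move=> /[dup] xn /key[c c01 e] /key[c' c01' e'] exx'.
have h0 : 0 < hcrd N (extended_branch N n x) m.
  by apply: full_hcrd => //; exact: branch_full.
move: e'; rewrite -exx' e => /(mulIf (lt0r_neq0 h0)) e'.
have {}e' : n%:R + c = n'%:R + c' by lra.
have h a b (d d' : R) : a%:R + d = b%:R + d' -> 0 < d < 1 -> 0 < d' < 1 ->
    (a <= b)%N.
  move=> ab d01 d01'; rewrite -ltnS -(ltr_nat R) -natr1; lra.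
by apply/eqP; rewrite eqn_leq (h _ _ _ _ e')// (h _ _ _ _ (esym e')).
Qed.

End spaces.

(** * Measurability, and the images of the branches *)

Lemma measurable_glue d d' (T : measurableType d) (T' : measurableType d')
    (D : nat -> set T) (f : T -> T') (f_ : nat -> T -> T') (g : T -> T') :
  (forall n, measurable (D n)) -> (forall n, measurable_fun setT (f_ n)) ->
  measurable_fun setT g -> (forall n x, D n x -> f x = f_ n x) ->
  (forall x, (forall n, ~ D n x) -> f x = g x) -> measurable_fun setT f.
Proof.
move=> mD mf mg fD fg _ B mB; rewrite setTI.
rewrite (_ : _ @^-1` _ = (\bigcup_n (D n `&` f_ n @^-1` B)) `|`
    ((~` \bigcup_n D n) `&` g @^-1` B)).
  apply: measurableU.
    by apply: bigcup_measurable => n _; apply: measurableI => //; exact: measurable_preimage.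
  apply: measurableI; last exact: measurable_preimage.
  by apply: measurableC; exact: bigcup_measurable.
apply/seteqP; split => x /=.
  move=> Bx; have [[n _ Dn]|nD] := pselect ((\bigcup_n D n) x).
    by left; exists n => //; split => //=; rewrite -(fD n).
  by right; split => //; rewrite -fg// => n Dn; apply: nD; exists n.
move=> [[n _ [Dn]]|[nD]] /=; first by rewrite -fD.
by rewrite -fg// => n Dn; apply: nD; exists n.
Qed.

Section preservation.
Context {R : realType} (k : nat) (N : R).
Notation m := k.+1.
Notation point := (m.-tuple R * m.-tuple R)%type.
Implicit Types (t u : m.-tuple R) (x y : point) (n i : nat).
Notation G := (@triangle_map R m).
Notation F := (@extended_map R m N).
Notation full := (@extended_full_space R m N).
Notation dom := (@extended_domain R m N).
Notation branch := (@extended_branch R m N).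

Lemma measurable_crd1 i : measurable_fun setT (fun x => crd x.1 i).
Proof. exact: (measurableT_comp (measurable_crd i) measurable_fst). Qed.

Lemma measurable_crd2 i : measurable_fun setT (fun x => crd x.2 i).
Proof. exact: (measurableT_comp (measurable_crd i) measurable_snd). Qed.

Lemma measurable_triangle_branch n :
  measurable_fun setT (@triangle_branch R m n).
Proof.
apply: measurable_mktuple => i; case: (i.+1 == m); apply: measurable_funM.
- apply: measurable_funB; last first.
    by apply: measurable_funM => //; exact: measurable_crd.
  by apply: measurable_funB => //; exact: measurable_crd.
- by apply: measurable_funV; exact: measurable_crd.
- exact: measurable_crd.
- by apply: measurable_funV; exact: measurable_crd.
Qed.

Lemma measurable_extended_branch n : measurable_fun setT (branch n).
Proof.
apply/measurable_fun_pairP; split.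
  exact: (measurableT_comp (measurable_triangle_branch n) measurable_fst).
apply: measurable_mktuple => i.
have mu0 := @measurable_u0 R m N.
have m1 := measurable_crd1 1.
case: (i.+1 == m); first exact: measurable_funM.
case: (i.+2 == m); apply: measurable_funM => //; last exact: measurable_crd2.
by apply: measurable_funD; [exact: measurable_funM|exact: measurable_crd2].
Qed.

Lemma measurable_hcrd i : measurable_fun setT (fun x => hcrd N x i).
Proof.
case: i => [|i]; [exact: measurable_u0|exact: measurable_crd2].
Qed.

Lemma measurable_inv_branch n : measurable_fun setT (@inv_branch R k N n).
Proof.
have mr : measurable_fun setT (@inv_radius R k n).
  rewrite /inv_radius; apply: measurable_funD.
    by apply: measurable_funD => //; exact: measurable_crd1.
  by apply: measurable_funM => //; case: (k == 0%N) => //; exact: measurable_crd1.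
apply/measurable_fun_pairP; split; apply: measurable_mktuple => i.
  case: (val i == 0%N); first exact: measurable_funV.
  by apply: measurable_funM; [exact: measurable_crd1|exact: measurable_funV].
apply: measurable_funB.
  by apply: measurable_funM => //; exact: measurable_hcrd.
by do 2 apply: measurable_funM => //; exact: measurable_hcrd.
Qed.

Lemma measurable_remainder n :
  measurable_fun setT (fun t => 1 - crd t 1 - n%:R * crd t m).
Proof.
apply: measurable_funB; last first.
  by apply: measurable_funM => //; exact: measurable_crd.
by apply: measurable_funB => //; exact: measurable_crd.
Qed.

Lemma measurable_open_domain n : measurable (@triangle_open_domain R m n).
Proof.
apply: measurableI; first exact: measurable_simplex.
have mc := measurable_remainder.
rewrite (_ : [set t | _] = [set t | 0 < 1 - crd t 1 - n%:R * crd t m] `&`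
  [set t | 1 - crd t 1 - n.+1%:R * crd t m < 0])//.
by apply: measurableI; apply: measurable_lt_set.
Qed.

Lemma measurable_extended_domain n : measurable (dom n).
Proof.
rewrite (_ : dom n = full `&` fst @^-1` (@triangle_open_domain R m n)).
  apply: measurableI; first exact: measurable_extended_full_space.
  by apply: measurable_preimage => //; exact: measurable_open_domain.
by apply/seteqP; split => x; rewrite extended_domainE.
Qed.

Lemma measurable_extended_map : measurable_fun setT F.
Proof.
apply: (@measurable_glue _ _ _ _ dom _ branch (branch 0)).
- exact: measurable_extended_domain.
- exact: measurable_extended_branch.
- exact: measurable_extended_branch.
- by move=> n x; exact: extended_mapE.
- move=> x nD; rewrite /extended_map; congr extended_branch.
  by case: xgetP => // n _ /nD.
Qed.

Lemma measurable_triangle_map : measurable_fun setT G.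
Proof.
pose D n := [set t : m.-tuple R | 0 <= 1 - crd t 1 - n%:R * crd t m] `&`
  [set t | 1 - crd t 1 - n.+1%:R * crd t m < 0].
have mc := measurable_remainder.
apply: (@measurable_glue _ _ _ _ D _ (@triangle_branch R m) (triangle_branch 0)).
- move=> n; apply: measurableI; last exact: measurable_lt_set.
  rewrite (_ : [set t | _] = ~` [set t | 1 - crd t 1 - n%:R * crd t m < 0]).
    by apply: measurableC; exact: measurable_lt_set.
  by apply/seteqP; split => t /=; rewrite leNgt => /negP.
- exact: measurable_triangle_branch.
- exact: measurable_triangle_branch.
- by move=> n t [h1 h2]; congr triangle_branch; exact: triangle_digitE.
- move=> t nD; rewrite /triangle_map; congr triangle_branch.
  by rewrite /triangle_digit; case: xgetP => // n _ /nD.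
Qed.

Lemma measurable_eq_tuple2 (f g : point -> point) :
  measurable_fun setT f -> measurable_fun setT g ->
  measurable [set x | f x = g x].
Proof.
move=> mf mg.
rewrite (_ : [set x | _] = \bigcap_i
    ([set x | crd (f x).1 i = crd (g x).1 i] `&`
     [set x | crd (f x).2 i = crd (g x).2 i])).
  have meq (a b : point -> R) : measurable_fun setT a ->
      measurable_fun setT b -> measurable [set x | a x = b x].
    move=> ma mb; have := measurable_fun_eqr ma mb measurableT (Y := [set true]) I.
    by rewrite setTI; congr measurable; apply/seteqP; split => x /= /eqP.
  apply: bigcap_measurableType => i _; apply: measurableI; apply: meq.
  - exact: (measurableT_comp (measurable_crd1 i) mf).
  - exact: (measurableT_comp (measurable_crd1 i) mg).
  - exact: (measurableT_comp (measurable_crd2 i) mf).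
  - exact: (measurableT_comp (measurable_crd2 i) mg).
apply/seteqP; split => [x /= e i _|x h]; first by split => /=; rewrite e.
rewrite /= (surjective_pairing (f x)) (surjective_pairing (g x)).
by congr pair; apply: eq_from_tnth => i; rewrite !(tnth_nth 0);
  have [] := h i.+1 I.
Qed.

(** The image of the n-th branch, written through the inverse branch so that it
    is visibly measurable. *)
Definition branch_range n : set point :=
  [set y | dom n (inv_branch N n y)] `&` [set y | branch n (inv_branch N n y) = y].

Lemma measurable_branch_range n : measurable (branch_range n).
Proof.
apply: measurableI.
  by apply: (measurable_preimage (measurable_inv_branch n));
    exact: measurable_extended_domain.
apply: measurable_eq_tuple2 => //.
exact: measurableT_comp (measurable_extended_branch n) (measurable_inv_branch n).
Qed.

Lemma dom_crd_gt0 n x : dom n x -> 0 < crd x.1 1.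
Proof. by move=> [[sx _ _] _]; exact: simplex_crd_gt0. Qed.

Lemma branch_rangeP n y : branch_range n y <-> exists2 x, dom n x & y = branch n x.
Proof.
split=> [[h1 h2]|[x xn ->]]; first by exists (inv_branch N n y).
rewrite /branch_range /= /setI /= inv_branchK//.
by rewrite gt_eqF// (dom_crd_gt0 xn).
Qed.

Lemma trivIset_branch_range : trivIset setT branch_range.
Proof.
move=> n n' _ _ [y [/branch_rangeP[x xn ->] /branch_rangeP[x' xn' e]]].
exact: branch_digit xn xn' e.
Qed.

Lemma branch_range_full n : branch_range n `<=` full.
Proof. by move=> y /branch_rangeP[x xn ->]; exact: branch_full. Qed.

Lemma theadE_crd t : thead t = crd t 1.
Proof. by rewrite /thead (tnth_nth 0). Qed.

Lemma crd_rcons (s : k.-tuple R) r i : (1 <= i <= m)%N ->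
  crd (tuple_rcons (s, r)) i = if i == m then r else nth 0 s i.-1.
Proof.
case: i => // i im; rewrite /crd/= nth_rcons size_tuple eqSS.
move: im; rewrite /= ltnS leq_eqVlt => /predU1P[->|ik]; first by rewrite ltnn eqxx.
by rewrite ik (ltn_eqF ik).
Qed.

(** The total branch does not change the sign of t_1, and this value records it. *)
Lemma inv_radius_total n x :
  inv_radius n (total_branch N n x) = half_inv (crd x.1 1).
Proof.
rewrite /inv_radius /total_branch/= theadE_crd; set s := _.1.
have e : (if k == 0%N then 1 else crd (tuple_rcons (s, 0)) k) = last 1 s.
  case: eqP => [k0|/eqP k0].
    by rewrite (_ : s = [::] :> seq R)//; apply: size0nil; rewrite size_tuple.
  rewrite crd_rcons ?lt0n ?k0 ?leqnSn// ltn_eqF//.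
  rewrite (last_nth 0) size_tuple.
  by case: (k) s k0 => // k' s _.
have -> : (if k == 0%N then 1 else crd (tuple_rcons (s,
    half_inv (crd x.1 1) - (1 + n%:R * last 1 s))) k) = last 1 s.
  rewrite -e; case: eqP => // /eqP k0.
  by rewrite !crd_rcons ?lt0n ?k0 ?leqnSn// ltn_eqF.
by rewrite crd_rcons ?leqnn// eqxx; ring.
Qed.

Lemma nth_add_last c (w : k.-tuple R) i : (i < k)%N ->
  nth 0 (add_last c w) i = if i.+1 == k then nth 0 w i + c else nth 0 w i.
Proof.
move=> ik.
have -> : nth 0 (add_last c w) i = tnth (add_last c w) (Ordinal ik).
  by rewrite (tnth_nth 0).
by rewrite tnth_mktuple (tnth_nth 0).
Qed.

Lemma total_branchE n x : 0 < crd x.1 1 -> total_branch N n x = branch n x.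
Proof.
move=> a0; have an0 := lt0r_neq0 a0.
rewrite /total_branch/= /scale_step/= /half_inv /inv_step /add_step /=.
rewrite !theadE_crd a0/=.
have nb t i : nth 0 (behead t) i = crd t i.+2 by rewrite nth_behead.
have sz t : size (behead t) = k by rewrite size_behead size_tuple.
have nth_s i : (i < k)%N ->
    nth 0 [seq z / crd x.1 1 | z <- behead x.1] i = crd x.1 i.+2 / crd x.1 1.
  by move=> ik; rewrite (nth_map 0) ?sz// nb.
have nth_w i : (i < k)%N ->
    nth 0 [seq crd x.1 1 * z | z <- behead x.2] i = crd x.1 1 * crd x.2 i.+2.
  by move=> ik; rewrite (nth_map 0) ?sz// nb.
have last_s : last 1 [seq z / crd x.1 1 | z <- behead x.1] =
    crd x.1 m / crd x.1 1.
  rewrite -[X in last X _](divff an0) (last_map (fun z => z / crd x.1 1)).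
  rewrite (last_nth 0) sz (_ : _ :: _ = x.1 :> seq R)//.
  by case/tupleP : (x.1).
have vE : N - pairing [tuple of [seq z / crd x.1 1 | z <- behead x.1]]
     [tuple of [seq crd x.1 1 * z | z <- behead x.2]] -
    crd x.1 1 * crd x.2 1 = u0 N x.
  rewrite /u0 big_nat_recl// big_add1/= big_mkord opprD addrA [RHS]addrAC.
  congr (_ - _ - _); apply: eq_bigr => i _.
  rewrite !(tnth_nth 0)/= nth_s// nth_w//.
  by rewrite mulrA divfK.
rewrite last_s vE [RHS]surjective_pairing.
have crdE t (i : 'I_m) : tnth t i = crd t i.+1 by rewrite (tnth_nth 0).
congr pair; apply: eq_from_tnth => i; rewrite !crdE crd_rcons ?ltn_ord//.
  have [ik|ik] := eqVneq i.+1 m.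
    by rewrite ik crd_branch_last; field.
  have {}ik : (i < k)%N by rewrite ltn_neqAle -eqSS ik -ltnS ltn_ord.
  by rewrite crd_branch// nth_s.
rewrite crd_extended_branch ?ltn_ord//.
have [ik|ik] := eqVneq i.+1 m; first by rewrite ik /dual_step eqxx.
have {}ik : (i < k)%N by rewrite ltn_neqAle -eqSS ik -ltnS ltn_ord.
rewrite /dual_step eqSS (ltn_eqF ik) add0r /hcrd/=.
rewrite nth_add_last//= nth_w// ?eqSS.
by case: (i.+1 == k); rewrite ?mulr1n ?mulr0n; ring.
Qed.

(** Points with t_1 <= 0 stay out of the range of the branch, by the value of
    inv_radius at their images; elsewhere the total branch is the branch, which
    is injective. *)
Lemma preimage_branch_range n : total_branch N n @^-1` (branch_range n) = dom n.
Proof.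
apply/seteqP; split => x /=; last first.
  move=> xn; have t0 := dom_crd_gt0 xn.
  by rewrite total_branchE//; apply/branch_rangeP; exists x.
move=> h; have [z zn e] := (branch_rangeP n _).1 h.
have z0 := dom_crd_gt0 zn.
have x0 : 0 < crd x.1 1.
  have := inv_radius_total n x; rewrite e inv_radius_branch ?gt_eqF//.
  rewrite /half_inv; case: ifPn => // + e'; rewrite -e'.
  by rewrite invr_gt0 z0.
move: h; rewrite total_branchE// => -[+ _]; rewrite /= inv_branchK//.
by rewrite gt_eqF.
Qed.

End preservation.

(** * Finiteness of the volume *)

Section finite_volume.
Context {R : realType} (N : R).
Hypothesis N0 : 0 < N.
Notation mu := (@lebesgue_measure R).
Notation L := (@lebesgue_tuple R).

(** A region that contains the full space when a = 1 and whose volume can be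
    computed by integrating over one pair (t_i, u_i) after the other. *)
Definition box j (a : R) : set (j.-tuple R * j.-tuple R) :=
  [set x | forall i, (1 <= i <= j)%N ->
    [/\ 0 < crd x.1 i, crd x.1 i < (if i == 1%N then a else crd x.1 i.-1),
        0 < crd x.2 i & crd x.2 i * (if i == j then 1 else crd x.1 i) < N]].

Lemma measurable_box j a : measurable (@box j a).
Proof.
have m1 i : measurable_fun setT (fun x : j.-tuple R * j.-tuple R => crd x.1 i).
  exact: (measurableT_comp (measurable_crd i) measurable_fst).
have m2 i : measurable_fun setT (fun x : j.-tuple R * j.-tuple R => crd x.2 i).
  exact: (measurableT_comp (measurable_crd i) measurable_snd).
rewrite (_ : @box j a = \bigcap_(i in [set i | (1 <= i <= j)%N])
  ([set x | 0 < crd x.1 i] `&`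
   [set x | crd x.1 i < (if i == 1%N then a else crd x.1 i.-1)] `&`
   [set x | 0 < crd x.2 i] `&`
   [set x | crd x.2 i * (if i == j then 1 else crd x.1 i) < N])); last first.
  apply/seteqP; split => [x h i /h[? ? ? ?] //|x h i /h[[[? ?] ?] ?]].
  by split.
apply: bigcap_measurableType => i _.
apply: measurableI; [apply: measurableI; [apply: measurableI|]|].
- exact: measurable_lt_set.
- by apply: measurable_lt_set => //; case: (i == 1%N).
- exact: measurable_lt_set.
- apply: measurable_lt_set => //; apply: measurable_funM => //.
  by case: (i == j).
Qed.

Definition box_bound j (a : R) : R := if j == 0%N then 1 else a * N ^+ j.

Lemma integral_itv0 (b c : R) : 0 < c ->
  (\int[mu]_u (b%:E * (\1_(`]0%R, c[%classic : set R) u)%:E) = (b * c)%:E)%E.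
Proof.
move=> c0; rewrite integralZl//; last exact: integrable_indic_itv.
transitivity (b%:E * mu `]0%R, c[%classic)%E.
  by rewrite integral_indic// setIT.
by rewrite lebesgue_measure_itv/= lte_fin c0 sube0 -EFinM.
Qed.

Lemma preserving_cons2 j : measure_preserving setT
  ((mu \x mu) \x (L j \x L j))%E (L j.+1 \x L j.+1)%E
  (fun p => (tuple_cons (p.1.1, p.2.1), tuple_cons (p.1.2, p.2.2))).
Proof.
have := preserving_comp (preserving_prod (m1 := prodm mu (L j)) (m2 := prodm mu (L j))
  (preserving_cons j) (preserving_cons j)) (preserving_shuffle mu mu (L j) (L j)).
by [].
Qed.

(** For a fixed first pair (t, u) the remaining pairs, if any, range over a box
    of the same kind with a = t, of volume at most t N^j, while u ranges over an
    interval of length N / t, so that the factors t cancel. The last pair has u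
    < N instead. *)
Lemma volume_box j a : 0 < a ->
  ((L j \x L j) (@box j a) <= (box_bound j a)%:E)%E.
Proof.
elim: j a => [|j IH] a a0.
  rewrite /box_bound eqxx.
  apply: (@le_trans _ _ ((L 0 \x L 0)%E (setT `*` setT))).
    apply: le_measure; rewrite ?inE; [exact: measurable_box|by rewrite setXTT|].
    by move=> ? _.
  by rewrite product_measure1E//= !diracT mule1.
have mb := measurable_preimage (preserving_cons2 j).1 (@measurable_box j.+1 a).
rewrite -(preserving_preimage (preserving_cons2 j)); last exact: measurable_box.
pose len t := if j == 0%N then N else N / t.
pose W : set (R * R) := [set p | 0 < p.1] `&` [set p | p.1 < a] `&`
  [set p | 0 < p.2] `&` [set p | p.2 < len p.1].
have mlen : measurable_fun setT (fun p : R * R => len p.1).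
  rewrite /len; case: (j == 0%N) => //; apply: measurable_funM => //.
  exact: measurable_funV.
have mbd : measurable_fun setT (fun p : R * R => box_bound j p.1).
  rewrite /box_bound; case: (j == 0%N) => //; exact: measurable_funM.
have mW : measurable W.
  apply: measurableI; [apply: measurableI; [apply: measurableI|]|];
    exact: measurable_lt_set.
have int_ge0 p : 0 <= box_bound j p.1 * \1_W p.
  rewrite indicE; case: (boolP (p \in W)) => pW.
    move: pW; rewrite inE => -[[[p0 _] _] _]; rewrite mulr1.
    by rewrite /box_bound; case: ifP => // _; rewrite mulr_ge0 ?exprn_ge0// ltW.
  by rewrite mulr0.
apply: (@le_trans _ _ (\int[(mu \x mu)%E]_p
    ((box_bound j p.1) * \1_W p)%R%:E)%E).
  apply: ge0_le_integral => //.
  - exact: (measurable_fun_xsection (prodm (L j) (L j)) mb).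
  - apply/measurable_EFinP; apply: measurable_funM => //.
  move=> [t u] _; rewrite /= indicE; case: (boolP ((t, u) \in W)) => pW.
    move: pW; rewrite inE mulr1 => -[[[/= t0 ta] u1] ut].
    apply: (le_trans _ (IH t t0)); apply: le_measure; rewrite ?inE.
    - exact: measurable_xsection.
    - exact: measurable_box.
    move=> [t' u']; rewrite /xsection/= inE/= => h [//|i] ij.
    have [h1 h2 h3 h4] := h i.+2 ij; split => //.
      by move: h2; case: i {ij h1 h3 h4}.
  rewrite mulr0 (_ : xsection _ _ = set0) ?measure0//.
  apply/seteqP; split => // -[t' u'] /=; rewrite /xsection/= inE/= => h.
  move: pW; rewrite notin_setE; apply.
  have [h1 h2 h3 h4] := h 1%N isT; split => //=.
  rewrite /len; move: h4 => /=; rewrite eqSS eq_sym.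
  by case: (j == 0%N) => /=; rewrite ?mulr1// -ltr_pdivlMr.
rewrite fubini_tonelli1; last 2 first.
- apply/measurable_EFinP; apply: measurable_funM => //.
- by move=> p; rewrite lee_fin.
apply: (@le_trans _ _ (\int[mu]_t
    (N ^+ j.+1 * \1_(`]0, a[%classic : set R) t)%R%:E)%E).
  rewrite le_eqVlt; apply/orP; left; apply/eqP.
  apply: eq_integral => t _; rewrite /fubini_F indicE mem_setE in_itv/=.
  case: (boolP (0 < t < a)) => [/andP[t0 ta]|nt]; last first.
    rewrite mulr0; apply: integral0_eq => u _.
    rewrite indicE memNset ?mulr0//= => -[[[/= ? ?] _] _].
    by move/negP : nt; apply; apply/andP.
  have len0 : 0 < len t by rewrite /len; case: (j == 0%N) => //; rewrite divr_gt0.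
  rewrite mulr1; transitivity (\int[mu]_u ((box_bound j t)%:E *
      (\1_(`]0%R, len t[%classic : set R) u)%:E))%E.
    apply: eq_integral => u _; rewrite EFinM; congr (_ * EFin _)%E.
    rewrite !indicE mem_setE in_itv/=.
    congr (nat_of_bool _)%:R; apply/idP/idP; rewrite inE.
      by move=> -[[_ /= ->] /= ->].
    by move=> /andP[u0 ul]; split => //; split.
  rewrite integral_itv0//.
  congr EFin; rewrite /box_bound /len; case: (eqVneq j 0%N) => [->|j0].
    by rewrite mul1r expr1.
  by rewrite exprSr; field; rewrite gt_eqF.
rewrite (integral_itv0 (N ^+ j.+1) a0).
by rewrite lee_fin /box_bound/= mulrC.
Qed.

End finite_volume.

(** * Invariance of the measure *)

Section preserving.
Context {R : realType} (k : nat) (N : R).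
Hypothesis N0 : 0 < N.
Notation m := k.+1.
Notation point := (m.-tuple R * m.-tuple R)%type.
Implicit Types (t u : m.-tuple R) (x y : point) (n i : nat).
Notation F := (@extended_map R m N).
Notation full := (@extended_full_space R m N).
Notation dom := (@extended_domain R m N).
Notation branch := (@extended_branch R m N).
Notation range := (@branch_range R k N).
Notation lam := (@lebesgue_measure R).
Notation L := (@lebesgue_tuple R).
Notation LL := (prodm (L m) (L m)).
Notation mu := (@extended_measure R m N).

Lemma full_box : full `<=` @box R N m 1.
Proof.
move=> x fx i im; have [sx ux u0x] := fx.
have t0 j : (1 <= j <= m)%N -> 0 < crd x.1 j by exact: simplex_crd_gt0.
have [s1 dec sm] := sx.
split; [exact: t0| |exact: ux|].
  case: eqP => [->//|/eqP i1].
  have := dec i.-1; rewrite prednK; last by lia.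
  by apply; lia.
have um0 : 0 < crd x.2 m by apply: ux; rewrite leqnn.
have sum_ge0 (P : pred nat) : 0 <= \sum_(1 <= j < m.+1 | P j) crd x.1 j * crd x.2 j.
  rewrite big_seq_cond; apply: sumr_ge0 => j /andP[]; rewrite mem_index_iota => jm _.
  by rewrite ltW// mulr_gt0 ?t0 ?ux.
case: eqP => [->|_].
  rewrite mulr1 (lt_le_trans u0x)// /u0 gerBl.
  exact: (sum_ge0 predT).
have : 0 < u0 N x by exact: lt_trans u0x.
rewrite /u0 subr_gt0 mulrC; apply: le_lt_trans.
rewrite (bigD1_seq i) ?mem_index_iota ?iota_uniq//= lerDl.
exact: sum_ge0.
Qed.

Lemma extended_measureE (A : set point) : mu A = LL (A `&` full).
Proof. by []. Qed.

Lemma LL_full_fin : (LL full < +oo)%E.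
Proof.
apply: (@le_lt_trans _ _ (LL (@box R N m 1))).
  apply: le_measure; rewrite ?inE; [exact: measurable_extended_full_space|
    exact: measurable_box|exact: full_box].
by apply: le_lt_trans (volume_box N0 m ltr01) _; rewrite ltry.
Qed.

Lemma extended_measure_fin : (mu setT < +oo)%E.
Proof. by rewrite extended_measureE setTI; exact: LL_full_fin. Qed.

Let H n := [set t : m.-tuple R | 1 - crd t 1 - n%:R * crd t m = 0].

Let measurable_H n : measurable (H n).
Proof.
rewrite (_ : H n = (fun t => 1 - crd t 1 - n%:R * crd t m) @^-1` [set 0])//.
exact: measurable_preimage (measurable_remainder n) _.
Qed.

Let null_H n : L m (H n) = 0%E.
Proof.
have mc := preserving_comp (preserving_cons k) (preserving_swap (L k) lam).
rewrite -(preserving_preimage mc (measurable_H n)).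
transitivity (\int[L k]_t' (0 : \bar R))%E; last exact: integral0.
apply: eq_integral => t' _ /=.
(* A line parallel to the axis of t_1 meets the hyperplane in one point. *)
pose c := if k == 0%N then (1 + n%:R)^-1 : R else 1 - n%:R * last 1 t'.
rewrite (_ : xsection _ _ = [set c]); first exact: lebesgue_measure_set1.
have e a : crd (tuple_cons (a, t')) m = if k == 0%N then a else last 1 t'.
  rewrite /crd/=; case: eqP => [k0|/eqP k0].
    have -> : nth 0 (a :: t') k = nth 0 (a :: t') 0 by congr nth.
    by [].
  rewrite (last_nth 0) size_tuple {c}.
  by case: (k) t' k0.
have n1 : 1 + n%:R != 0 :> R by rewrite nat1r pnatr_eq0.
apply/seteqP; split => a /=; rewrite /xsection/= inE /H/= e /crd/= /c;
  case: (k == 0%N) => h.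
- have : a * (1 + n%:R) = 1 by lra.
  by move=> e1; rewrite -[LHS](mulfK n1) e1 mul1r.
- by lra.
- by rewrite h; field.
- by rewrite h; ring.
Qed.

(** A point lies in a domain unless (1 - t_1) / t_m is an integer n, which puts
    it on one of countably many hyperplanes. *)
Lemma null_off_domains : LL (full `\` \bigcup_n dom n) = 0%E.
Proof.
have mHT n : measurable (H n `*` [set: m.-tuple R]).
  exact: measurableX.
have mU : measurable (\bigcup_n (H n `*` [set: m.-tuple R])).
  exact: bigcup_measurable.
have : LL (\bigcup_n (H n `*` [set: m.-tuple R])) = 0%E.
  apply/negligibleP => //; apply: negligible_bigcup => n.
  apply/negligibleP => //.
  transitivity (L m (H n) * L m setT)%E; first exact: product_measure1E.
  by rewrite null_H mul0e.
move=> U0; apply/eqP; rewrite -measure_le0 -U0.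
apply: le_measure; rewrite ?inE//.
  apply: measurableD; first exact: measurable_extended_full_space.
  by apply: bigcup_measurable => n _; exact: measurable_extended_domain.
move=> x [fx nd]; have [sx ux u0x] := fx.
have t0 j : (1 <= j <= m)%N -> 0 < crd x.1 j by exact: simplex_crd_gt0.
have tm := t0 m (leqnn m); have [t1 _ _] := sx.
pose n := Num.truncn ((1 - crd x.1 1) / crd x.1 m).
have q0 : 0 <= (1 - crd x.1 1) / crd x.1 m by apply: divr_ge0; apply: ltW; rewrite ?subr_gt0.
have := truncn_itv q0; rewrite -/n => /andP[].
rewrite ler_pdivlMr// ltr_pdivrMr// => h1 h2.
exists n => //; split => //=; apply/eqP; case: eqP => // /eqP h3.
exfalso; apply: nd; exists n => //; split => //; split; last by rewrite subr_lt0.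
by rewrite lt_neqAle eq_sym h3 subr_ge0.
Qed.

Lemma measure_branch n (B : set point) : measurable B ->
  LL (dom n `&` branch n @^-1` B) = LL (range n `&` B).
Proof.
move=> mB; have mRB : measurable (range n `&` B).
  by apply: measurableI => //; exact: measurable_branch_range.
transitivity (LL (total_branch N n @^-1` (range n `&` B))); last first.
  exact: preserving_preimage (preserving_total_branch k N n) mRB.
congr prodm; rewrite preimage_setI preimage_branch_range.
apply/seteqP; split => x [xn xB]; split => //.
  by rewrite /preimage/= total_branchE// (dom_crd_gt0 xn).
by move: xB; rewrite /preimage/= total_branchE// (dom_crd_gt0 xn).
Qed.

Lemma trivIset_domain : trivIset setT dom.
Proof.
move=> n n' _ _ [x [[_ [h1 h2]] [_ [h3 h4]]]].
by apply: (@digit_unique _ k x.1) => //; exact: ltW.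
Qed.

Let preimage_measure (B : set point) : measurable B ->
  mu (F @^-1` B) = LL ((\bigcup_n range n) `&` B).
Proof.
move=> mB; rewrite extended_measureE.
have mZ : measurable (F @^-1` B `&` (full `\` \bigcup_n dom n)).
  apply: measurableI; first exact: measurable_preimage (@measurable_extended_map R k N) mB.
  apply: measurableD; first exact: measurable_extended_full_space.
  by apply: bigcup_measurable => n _; exact: measurable_extended_domain.
have mDB n : measurable (dom n `&` branch n @^-1` B).
  apply: measurableI; first exact: measurable_extended_domain.
  exact: measurable_preimage (measurable_extended_branch N n) mB.
rewrite (_ : F @^-1` B `&` full = (\bigcup_n (dom n `&` branch n @^-1` B)) `|`
    (F @^-1` B `&` (full `\` \bigcup_n dom n))); last first.
  apply/seteqP; split => [x [xB fx]|x].
    have [[n _ xn]|nx] := pselect ((\bigcup_n dom n) x); last by right.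
    by left; exists n => //; split => //; move: xB; rewrite /preimage/= (extended_mapE xn).
  move=> [[n _ [xn xB]]|[xB [fx _]]] //; split; last by case: xn.
  by rewrite /preimage/= (extended_mapE xn).
have Z0 : LL (F @^-1` B `&` (full `\` \bigcup_n dom n)) = 0%E.
  apply/eqP; rewrite -measure_le0 -[leRHS]null_off_domains.
  apply: le_measure; [rewrite inE|rewrite inE|exact: subIsetr]; first exact: mZ.
  apply: measurableD; first exact: measurable_extended_full_space.
  by apply: bigcup_measurable => n _; exact: measurable_extended_domain.
have mUD : measurable (\bigcup_n (dom n `&` branch n @^-1` B)).
  by apply: bigcup_measurable => n _; exact: mDB.
rewrite (measureU0 mUD mZ Z0) setI_bigcupl.
rewrite measure_bigcup; [|by move=> n _; exact: mDB|]; last first.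
  by apply: trivIset_setIr; exact: trivIset_domain.
rewrite measure_bigcup; last 2 first.
- by move=> n _; apply: measurableI => //; exact: measurable_branch_range.
- by apply: trivIset_setIr; exact: trivIset_branch_range.
by apply: eq_eseriesr => n _; exact: measure_branch.
Qed.

Let measurable_ranges : measurable (\bigcup_n range n).
Proof. by apply: bigcup_measurable => n _; exact: measurable_branch_range. Qed.

(* The ranges are disjoint subsets of the full space, and their total volume is
   that of the domains, hence that of the full space. As this is finite, they
   cover it up to a null set. *)
Let null_off_ranges : LL (full `\` \bigcup_n range n) = 0%E.
Proof.
have mf := @measurable_extended_full_space R m N.
rewrite measureD; [|exact: mf|exact: measurable_ranges|exact: LL_full_fin].
rewrite (_ : full `&` _ = \bigcup_n range n); last first.
  by apply/setIidPr => x [n _]; exact: branch_range_full.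
have e : LL full = LL (\bigcup_n range n).
  by have := preimage_measure measurableT; rewrite setIT preimage_setT
    extended_measureE setTI.
transitivity (LL full - LL full)%E; first by rewrite {2}e.
apply: subee; rewrite ge0_fin_numE; first exact: LL_full_fin.
exact: measure_ge0.
Qed.

Lemma extended_map_preserving : measure_preserving setT mu mu F.
Proof.
apply: preservingT; first exact: measurable_extended_map.
move=> B mB; rewrite (preimage_measure mB) extended_measureE.
have mf := @measurable_extended_full_space R m N.
rewrite (_ : B `&` full = ((\bigcup_n range n) `&` B) `|`
    (B `&` (full `\` \bigcup_n range n))).
  have Z0 : LL (B `&` (full `\` \bigcup_n range n)) = 0%E.
    apply/eqP; rewrite -measure_le0 -[leRHS]null_off_ranges.
    apply: le_measure; [rewrite inE|rewrite inE|exact: subIsetr].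
      by apply: measurableI => //; exact: measurableD.
    exact: measurableD.
  rewrite measureU0; [by []|exact: measurableI| |exact: Z0].
  by apply: measurableI => //; exact: measurableD.
apply/seteqP; split => [x [xB fx]|x [[[n _ xn] xB]|[xB [fx _]]]] //.
  by have [h|h] := pselect ((\bigcup_n range n) x); [left|right].
by split => //; exact: branch_range_full xn.
Qed.

End preserving.

(** * The covering of the triangle map by the extended map *)

Section generic.
Context {R : realType} d (T : measurableType d).

Lemma measurable_iter (f : T -> T) j :
  measurable_fun setT f -> measurable_fun setT (iter j f).
Proof.
move=> mf; elim: j => [|j IH]; first exact: measurable_id.
exact: (measurableT_comp mf IH).
Qed.

Lemma preserving_iter (mu : set T -> \bar R) (f : T -> T) j :
  measure_preserving setT mu mu f -> measure_preserving setT mu mu (iter j f).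
Proof.
move=> hf; elim: j => [|j IH]; first exact: preserving_id.
exact: (preserving_comp hf IH).
Qed.

Lemma measure_concentrated (mu : {measure set T -> \bar R}) (X A B : set T) :
  measurable X -> mu (~` X) = 0%E -> measurable A -> measurable B ->
  (forall x, X x -> A x <-> B x) -> mu A = mu B.
Proof.
move=> mX X0 mA mB AB.
suff h (C : set T) : measurable C -> mu C = mu (C `&` X).
  rewrite (h A mA) (h B mB); congr (mu _).
  by apply/seteqP; split => x [? Xx]; split => //; apply/(AB x Xx).
move=> mC; rewrite (measureDI mu mC mX) [X in (X + _)%E](_ : _ = 0%E) ?add0e//.
apply/eqP; rewrite -measure_le0 -[leRHS]X0; apply: le_measure.
- by rewrite inE; exact: measurableD.
- by rewrite inE; exact: measurableC.
- by move=> x [].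
Qed.

Lemma null_eq_refl (mu : {measure set T -> \bar R}) A : null_eq mu A A.
Proof. by rewrite /null_eq setDv setU0; exact: negligible_set0. Qed.

Lemma measurable_mod_nullW (mu : {measure set T -> \bar R}) A :
  measurable A -> measurable_mod_null mu A.
Proof. by move=> mA; exists A => //; exact: null_eq_refl. Qed.

End generic.

Section base.
Context {R : realType} (k : nat) (N : R).
Hypothesis N0 : 0 < N.
Notation m := k.+1.
Notation point := (m.-tuple R * m.-tuple R)%type.
Implicit Types (t u : m.-tuple R) (x y : point) (n i : nat).
Notation G := (@triangle_map R m).
Notation F := (@extended_map R m N).
Notation full := (@extended_full_space R m N).
Notation dom := (@extended_domain R m N).
Notation branch := (@extended_branch R m N).
Notation mu := (@extended_measure R m N).
Notation nu := (@triangle_measure R m N).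
Notation X := (@extended_space R m N).
Notation Y := (@triangle_space R m).

Lemma measurable_triangle_space : measurable Y.
Proof.
rewrite (_ : Y = \bigcap_j iter j G @^-1` (\bigcup_n @triangle_open_domain R m n)).
  apply: bigcap_measurableType => j _.
  apply: measurable_preimage; first exact: measurable_iter (@measurable_triangle_map R k).
  by apply: bigcup_measurable => n _; exact: measurable_open_domain.
apply/seteqP; split => t h j => [_|].
  by have [n dn] := h j; exists n.
by have [n _ dn] := h j I; exists n.
Qed.

Lemma extended_space_bigcap : X = \bigcap_j iter j F @^-1` (\bigcup_n dom n).
Proof.
apply/seteqP; split => t h j => [_|].
  by have [n dn] := h j; exists n.
by have [n _ dn] := h j I; exists n.
Qed.

Let measurable_domains : measurable (\bigcup_n dom n).
Proof. by apply: bigcup_measurable => n _; exact: measurable_extended_domain. Qed.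

Lemma measurable_extended_space : measurable X.
Proof.
rewrite extended_space_bigcap; apply: bigcap_measurableType => j _.
by apply: measurable_preimage => //; exact: measurable_iter (@measurable_extended_map R k N).
Qed.

Lemma extended_space_conull : mu (~` X) = 0%E.
Proof.
apply/negligibleP; first by apply: measurableC; exact: measurable_extended_space.
rewrite extended_space_bigcap setC_bigcap.
apply: (@negligibleS _ _ _ _ (\bigcup_j (iter j F @^-1` (~` \bigcup_n dom n)))).
  by move=> x [j _ h]; exists j.
have mj j : measurable (iter j F @^-1` (~` \bigcup_n dom n)).
  apply: measurable_preimage; last exact: measurableC.
  exact: measurable_iter (@measurable_extended_map R k N).
apply: negligible_bigcup => j; apply/negligibleP; first exact: mj.
transitivity (mu (~` \bigcup_n dom n)).
  apply: preserving_preimage; last exact: measurableC.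
  by apply: preserving_iter; exact: extended_map_preserving.
rewrite extended_measureE setIC -setDE.
exact: null_off_domains.
Qed.

Lemma triangle_measure_fin : (nu setT < +oo)%E.
Proof. exact: extended_measure_fin. Qed.

Lemma triangle_map_preserving : measure_preserving setT nu nu G.
Proof.
apply: preservingT; first exact: measurable_triangle_map.
move=> B mB; change (mu (fst @^-1` (G @^-1` B)) = mu (fst @^-1` B)).
have mB1 : measurable (fst @^-1` B : set point).
  by apply: measurable_preimage => //; exact: measurable_fst.
have mB2 : measurable (fst @^-1` (G @^-1` B) : set point).
  apply: measurable_preimage; first exact: measurable_fst.
  by apply: measurable_preimage => //; exact: measurable_triangle_map.
transitivity (mu (F @^-1` (fst @^-1` B)));
  last exact: preserving_preimage (extended_map_preserving k N0) mB1.
apply: (measure_concentrated measurable_extended_space extended_space_conull) => //.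
  exact: measurable_preimage (@measurable_extended_map R k N) mB1.
move=> x /extended_map_space[_ e].
by change (B (G x.1) <-> B (F x).1); rewrite e.
Qed.

Lemma triangle_space_conull : nu (~` Y) = 0%E.
Proof.
change (mu (fst @^-1` (~` Y)) = 0%E); apply/eqP; rewrite -measure_le0.
rewrite -[leRHS]extended_space_conull; apply: le_measure.
- rewrite inE; apply: measurable_preimage; first exact: measurable_fst.
  by apply: measurableC; exact: measurable_triangle_space.
- by rewrite inE; apply: measurableC; exact: measurable_extended_space.
- by rewrite extended_spaceE => x nY [_ xY]; exact: nY.
Qed.

Lemma extended_map_inj : {in X &, injective F}.
Proof.
move=> x x'; rewrite !inE => /(_ 0%N)[n /= xn] /(_ 0%N)[n' /= xn'].
rewrite (extended_mapE xn) (extended_mapE xn') => e.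
have nn' := branch_digit xn xn' e; rewrite -{}nn' in xn' e.
rewrite -(@inv_branchK _ _ N n x) ?e ?inv_branchK//.
  by rewrite gt_eqF// (dom_crd_gt0 xn').
by rewrite gt_eqF// (dom_crd_gt0 xn).
Qed.

(** On X the map is injective with measurable inverse branches, so an image is a
    union of preimages. *)
Lemma measurable_image (A : set point) : measurable A -> A `<=` X ->
  measurable (F @` A).
Proof.
move=> mA AX.
rewrite (_ : F @` A = \bigcup_n (inv_branch N n @^-1` (A `&` dom n) `&`
   [set y | branch n (inv_branch N n y) = y])).
  apply: bigcup_measurable => n _; apply: measurableI.
    apply: measurable_preimage; first exact: measurable_inv_branch.
    by apply: measurableI => //; exact: measurable_extended_domain.
  apply: measurable_eq_tuple2 => //.
  exact: measurableT_comp (measurable_extended_branch N n) (measurable_inv_branch N n).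
apply/seteqP; split => [_ [x Ax <-]|y [n _ [[Ay yn] e]]].
  have [n /= xn] := AX x Ax 0%N; exists n => //.
  have t0 : crd x.1 1 != 0 by rewrite gt_eqF// (dom_crd_gt0 xn).
  by rewrite (extended_mapE xn); split => /=; rewrite inv_branchK.
by exists (inv_branch N n y) => //; rewrite (extended_mapE yn).
Qed.

(** Over t take the point with all u_i equal to this number c; it is chosen such
    that u_0 = 2 c > u_m. *)
Definition section_level t : R := N / (2 + \sum_(1 <= i < m.+1) crd t i).

Definition fiber_section t : point := (t, [tuple section_level t | i < m]).

Lemma measurable_fiber_section : measurable_fun setT fiber_section.
Proof.
apply/measurable_fun_pairP; split; first exact: measurable_id.
apply: measurable_mktuple => i; apply: measurable_funM => //.
apply: measurable_funV; apply: measurable_funD => //.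
by apply: measurable_sum => j; exact: measurable_crd.
Qed.

Lemma fiber_section_full t : simplex t -> full (fiber_section t).
Proof.
move=> st.
have S0 : 0 <= \sum_(1 <= i < m.+1) crd t i.
  rewrite big_seq; apply: sumr_ge0 => i; rewrite mem_index_iota => im.
  by apply/ltW/simplex_crd_gt0.
have S2 : 0 < 2 + \sum_(1 <= i < m.+1) crd t i by rewrite ltr_wpDr.
have c0 : 0 < section_level t by rewrite divr_gt0.
have cE i : (1 <= i <= m)%N -> crd (fiber_section t).2 i = section_level t.
  exact: (crd_mktuple (fun=> section_level t)).
split => //; first by move=> i im; rewrite cE.
rewrite cE ?leqnn// /u0 (eq_big_nat _ _ (F2 := fun i => crd t i * section_level t)).
  rewrite -big_distrl/=.
  have : section_level t * (2 + \sum_(1 <= i < m.+1) crd t i) = N.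
    by rewrite divfK// gt_eqF.
  by move: (\sum_(1 <= i < m.+1) _) => S; lra.
by move=> i im; rewrite cE.
Qed.

Lemma extended_space_fst : fst @` X = Y.
Proof.
rewrite extended_spaceE; apply/seteqP; split => [_ [x [_ xY] <-] //|t tY].
exists (fiber_section t) => //; split => //.
exact/fiber_section_full/triangle_space_simplex.
Qed.

Lemma extended_covering : invertible_covering X mu F Y nu G fst.
Proof.
have mX := measurable_extended_space; have X0 := extended_space_conull.
have onX A : measurable A -> mu (X `&` A) = mu A.
  move=> mA; apply: (measure_concentrated mX X0) => //; first exact: measurableI.
  by move=> x Xx; split => [[]|].
split.
- exact: (conj mX X0).
- split; first exact: measurable_funTS (@measurable_extended_map R k N).
  move=> B mB; rewrite onX; first exact: preserving_preimage (extended_map_preserving k N0) mB.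
  exact: measurable_preimage (@measurable_extended_map R k N) mB.
- exists X; split.
  + exact: mX.
  + exact: subset_refl.
  + by rewrite setDv; exact: measure0.
  + exact: extended_map_inj.
  + by move=> A mA AX; apply: measurable_mod_nullW; exact: measurable_image.
- split; first exact: measurable_funTS measurable_fst.
  move=> B mB; rewrite onX; first by [].
  by apply: measurable_preimage => //; exact: measurable_fst.
- by rewrite /onto_mod_null extended_space_fst setDv; exact: negligible_set0.
- exists (~` X); split; [exact: measurableC|exact: X0|].
  by move=> x /= nE Xx; apply: nE; have [] := extended_map_space Xx.
Qed.

End base.

(** * Pasts in an invertible covering *)

Section transport.
Context {R : realType} d (T : measurableType d).
Variables (mu : {measure set T -> \bar R}) (X : set T) (f : T -> T).
Hypothesis cX : carried_by mu X.
Hypothesis pf : measure_preserving X mu mu f.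

Let mX : measurable X := cX.1.
Let X0 : mu (~` X) = 0%E := cX.2.

Lemma ae_carrier : {ae mu, forall x, X x}.
Proof. by exists (~` X); split; [exact: measurableC|exact: X0|]. Qed.

Lemma ae_push (P : set T) : {ae mu, forall x, P x} -> {ae mu, forall x, P (f x)}.
Proof.
move=> [A [mA A0 PA]].
have mfA : measurable (X `&` f @^-1` A) by exact: pf.1.
exists (~` X `|` (X `&` f @^-1` A)); split.
- by apply: measurableU => //; exact: measurableC.
- rewrite measureU0; [exact: X0|exact: measurableC|exact: mfA|].
  by rewrite pf.2.
- move=> x /= nP; have [Xx|] := pselect (X x); last by left.
  by right; split => //; exact: PA.
Qed.

(** An almost sure property may be checked at f x, because f preserves the
    measure. *)
Lemma ae_pull (P : set T) : measurable P -> {ae mu, forall x, P (f x)} ->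
  {ae mu, forall x, P x}.
Proof.
move=> mP [A [mA A0 PA]].
exists (~` P); split => //; first exact: measurableC.
rewrite -pf.2; last exact: measurableC.
apply/eqP; rewrite -measure_le0 -[leRHS]A0; apply: le_measure; rewrite ?inE//.
  by apply: pf.1 => //; exact: measurableC.
by move=> x [_ nP]; exact: PA.
Qed.

Lemma measure_ae_eq (A B : set T) : measurable A -> measurable B ->
  {ae mu, forall x, A x <-> B x} -> mu A = mu B.
Proof.
move=> mA mB [Z [mZ Z0 hZ]].
apply: (measure_concentrated (measurableC mZ)) => //; first by rewrite setCK.
by move=> x nZ; have [//|/hZ] := pselect (A x <-> B x).
Qed.

Hypothesis one_one : one_to_one_mod_null X mu f.

(** The function h o f^-1, made measurable on the whole space. The images under
    f of the sets {h < q}, q rational, are measurable up to null sets; outside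
    the union Z of the countably many exceptional null sets these images
    determine h o f^-1, which is replaced by 0 on Z and outside the range of f. *)
Lemma push_forward_real (h : T -> R) : measurable_fun setT h ->
  exists2 h' : T -> R, measurable_fun setT h' & {ae mu, forall x, h' (f x) = h x}.
Proof.
move=> mh; have [D [mD DX XD injf imD]] := one_one.
have mA q : measurable (D `&` [set z | h z < q]).
  by apply: measurableI => //; exact: measurable_lt_set.
have im (A : set T) : measurable A -> A `<=` D ->
    exists CN : set T * set T, [/\ measurable CN.1, measurable CN.2, mu CN.2 = 0%E &
      forall x, ~ CN.2 x -> CN.1 x <-> (f @` A) x].
  move=> mA' AD; have [C mC [Z [mZ Z0 CZ]]] := imD A mA' AD.
  exists (C, Z); split => // x nZ; split => h'; apply: contrapT => nh.
    by apply: nZ; apply: CZ; right.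
  by apply: nZ; apply: CZ; left.
have [CD [mCD mND ND0 CDE]] := im D mD (@subset_refl _ D).
pose q_ j : rat := odflt 0 (unpickle j).
have q_surj q : exists j, q_ j = q.
  by exists (pickle q); rewrite /q_ pickleK.
have [C CE] := choice (fun j => im _ (mA (ratr (q_ j))) (@subIsetl _ _ _)).
pose Z := CD.2 `|` \bigcup_j (C j).2.
have mC j : measurable (C j).1 by have [] := CE j.
have mU : measurable (\bigcup_j (C j).2).
  by apply: bigcup_measurable => j _; have [] := CE j.
have mZ : measurable Z by exact: measurableU.
have negZ : mu.-negligible Z.
  apply: negligibleU; first by apply/negligibleP.
  by apply: negligible_bigcup => j; have [_ m2 j0 _] := CE j; apply/negligibleP.
have aeZ : {ae mu, forall x, ~ Z x}.
  by apply: negligibleS negZ => x /= /contrapT.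
pose h' x : R := if x \in Z then 0 else xget 0 [set r | exists z, [/\ D z, f z = x & h z = r]].
have h'E z : D z -> ~ Z (f z) -> h' (f z) = h z.
  move=> Dz nZ; rewrite /h' memNset//; case: xgetP => [r -> [z' [Dz' e <-]]|nr].
    by congr h; apply: injf; rewrite ?inE.
  by exfalso; apply: (nr (h z)); exists z.
have h'0 x : ~ (f @` D) x -> h' x = 0.
  move=> nD; rewrite /h'; case: ifP => // _; case: xgetP => // r -> [z [Dz e _]].
  by exfalso; apply: nD; exists z.
have aeD : {ae mu, forall x, D x}.
  exists (~` X `|` (X `\` D)); split.
  - by apply: measurableU; [exact: measurableC|exact: measurableD].
  - rewrite measureU0; [exact: X0|exact: measurableC|exact: measurableD|exact: XD].
  - by move=> x /= nD; have [Xx|] := pselect (X x); [right|left].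
exists h'; last first.
  by apply: filterS2 aeD (ae_push aeZ) => x Dx nZx; exact: h'E.
apply: (measurability _ (RGenInftyO.measurableE R)) => //= _ [_ [r ->] <-].
rewrite setTI.
pose J := [set j | ratr (q_ j) < r].
rewrite (_ : _ @^-1` _ = (\bigcup_(j in J) ((C j).1 `\` Z)) `|`
    (if 0 < r then Z `|` (~` CD.1 `\` Z) else set0)).
  apply: measurableU.
    by apply: bigcup_measurable => j _; exact: measurableD.
  case: ifP => _ //; apply: measurableU => //.
  by apply: measurableD => //; exact: measurableC.
have Cin j x : ~ Z x -> (C j).1 x <-> (f @` (D `&` [set z | h z < ratr (q_ j)])) x.
  move=> nZx; have [_ _ _ CEj] := CE j; apply: CEj => h2.
  by apply: nZx; right; exists j.
have CDin x : ~ Z x -> CD.1 x <-> (f @` D) x.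
  by move=> nZx; apply: CDE => h2; apply: nZx; left.
apply/seteqP; split => x /=; rewrite in_itv/=.
  move=> hx; have [Zx|nZx] := pselect (Z x).
    by right; move: hx; rewrite /h' mem_set// => ->; left.
  have [[z Dz zx]|nD] := pselect ((f @` D) x); last first.
    by right; move: hx; rewrite h'0// => ->; right; split => // /(CDin _ nZx).
  left; move: hx; rewrite -zx h'E ?zx// => hz.
  have [q] := rat_in_itvoo hz; rewrite in_itv/= => /andP[hq qr].
  have [j jq] := q_surj q; exists j; first by rewrite /J/= jq.
  by split => //; apply/Cin => //; exists z => //; split => //=; rewrite jq.
move=> [[j Jj [Cj nZx]]|].
  have /Cin := Cj => /(_ nZx) [z [Dz /= hz] zx].
  by rewrite -zx h'E ?zx//; exact: lt_trans Jj.
case: ifP => // r0 [Zx|[nCD nZx]]; first by rewrite /h' mem_set.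
by rewrite h'0// => fD; apply: nCD; apply/(CDin _ nZx).
Qed.

Lemma push_forward_tuple n (h : T -> n.-tuple R) : measurable_fun setT h ->
  exists2 h' : T -> n.-tuple R, measurable_fun setT h' &
    {ae mu, forall x, h' (f x) = h x}.
Proof.
move=> mh.
have ex j : exists h' : T -> R, measurable_fun setT h' /\
    {ae mu, forall x, h' (f x) = crd (h x) j.+1}.
  have [h' mh' e] := push_forward_real
    (measurableT_comp (@measurable_crd R n j.+1) mh).
  by exists h'; split.
have [H HE] := choice ex.
exists (fun x => [tuple H i x | i < n]).
  by apply: measurable_mktuple => i; have [] := HE i.
have : {ae mu, forall x j, H j (f x) = crd (h x) j.+1}.
  by apply: ae_foralln => j; have [] := HE j.
apply: filterS => x e; apply: eq_from_tnth => i.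
by rewrite tnth_mktuple e (tnth_nth 0).
Qed.

(** The function y j is psi o f^-j, defined almost everywhere. *)
Lemma past_chain n (psi : T -> n.-tuple R) : measurable_fun X psi ->
  exists y : nat -> T -> n.-tuple R, [/\ forall j, measurable_fun setT (y j),
    forall x, X x -> y 0%N x = psi x &
    forall j, {ae mu, forall x, y j.+1 (f x) = y j x}].
Proof.
move=> mpsi.
pose c : n.-tuple R := [tuple 0 | i < n].
pose y0 x := if x \in X then psi x else c.
have my0 : measurable_fun setT y0.
  move=> _ B mB; rewrite setTI.
  rewrite (_ : _ @^-1` _ = (X `&` psi @^-1` B) `|`
    (if c \in B then ~` X else set0)).
    apply: measurableU; first exact: mpsi.
    by case: ifP => _ //; exact: measurableC.
  apply/seteqP; split => x /=; rewrite /y0.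
    case: ifPn => [xX|nX] Bx; first by left; split => //; rewrite inE in xX.
    by right; rewrite mem_set//; move: nX; rewrite notin_setE.
  case=> [[Xx Bx]|]; first by rewrite mem_set.
  case: (boolP (c \in B)) => [cB nX|//]; rewrite memNset//.
  by move: cB; rewrite inE.
have step (h : {h : T -> n.-tuple R | measurable_fun setT h}) :
    {h' : {h : T -> n.-tuple R | measurable_fun setT h} |
      {ae mu, forall x, sval h' (f x) = sval h x}}.
  apply: cid; have [h' mh' e] := push_forward_tuple (svalP h).
  by exists (exist _ h' mh').
pose Y := fix Y j := if j is j'.+1 then sval (step (Y j')) else exist _ y0 my0.
exists (fun j => sval (Y j)); split.
- by move=> j; exact: svalP.
- by move=> x Xx /=; rewrite /y0 mem_set.
- by move=> j; exact: (svalP (step (Y j))).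
Qed.

Section past.
Context n (psi : T -> n.-tuple R) (g : n.-tuple R -> n.-tuple R)
  (nu : set (n.-tuple R) -> \bar R) (y : nat -> T -> n.-tuple R).
Hypothesis ppsi : measure_preserving X mu nu psi.
Hypothesis mg : measurable_fun setT g.
Hypothesis equi : {ae mu, forall x, psi (f x) = g (psi x)}.
Hypothesis my : forall j, measurable_fun setT (y j).
Hypothesis y0 : forall x, X x -> y 0%N x = psi x.
Hypothesis yS : forall j, {ae mu, forall x, y j.+1 (f x) = y j x}.

Let onX A : measurable A -> mu (X `&` A) = mu A.
Proof.
move=> mA; apply: (measure_concentrated mX X0) => //; first exact: measurableI.
by move=> x Xx; split => [[]|].
Qed.

Lemma measurable_eq_tuple (a b : T -> n.-tuple R) :
  measurable_fun setT a -> measurable_fun setT b -> measurable [set x | a x = b x].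
Proof.
move=> ma mb.
rewrite (_ : [set x | _] = \bigcap_i [set x | crd (a x) i = crd (b x) i]).
  apply: bigcap_measurableType => i _.
  have := measurable_fun_eqr (measurableT_comp (measurable_crd i) ma)
    (measurableT_comp (measurable_crd i) mb) measurableT (Y := [set true]) I.
  by rewrite setTI; congr measurable; apply/seteqP; split => x /= /eqP.
apply/seteqP; split => [x /= e i _|x h] /=; first by rewrite e.
by apply: eq_from_tnth => i; rewrite !(tnth_nth 0); exact: h i.+1 I.
Qed.

Lemma past_law j B : measurable B -> mu (y j @^-1` B) = nu B.
Proof.
move=> mB; elim: j => [|j IH].
  rewrite -ppsi.2// -onX; last exact: measurable_preimage.
  congr (mu _); apply/seteqP; split => x [Xx]; rewrite /preimage/=.
    by rewrite y0.
  by move=> Bx; split => //=; rewrite y0.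
have myB i : measurable (y i @^-1` B) by exact: measurable_preimage (my i) mB.
rewrite -IH -pf.2//; apply: measure_ae_eq => //; first exact: pf.1.
apply: filterS2 ae_carrier (yS j) => x Xx e; rewrite /preimage/= e.
by split => [[]|].
Qed.

(** By induction on j: at f x the equation is the one at x for the preceding
    index. *)
Lemma past_step j : {ae mu, forall x, g (y j.+1 x) = y j x}.
Proof.
have mE i : measurable [set x | g (y i.+1 x) = y i x].
  apply: measurable_eq_tuple; last exact: my.
  exact: measurableT_comp mg (my i.+1).
elim: j => [|j IH].
  apply: (ae_pull (mE 0%N)).
  have h : {ae mu, forall x, X x /\ X (f x)}.
    by apply: filterS2 ae_carrier (ae_push ae_carrier) => x; split.
  apply: filterS3 h equi (yS 0%N) => x [Xx Xfx] e1 e2 /=.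
  by rewrite e2 !y0.
apply: (ae_pull (mE j.+1)).
by apply: filterS3 IH (yS j.+1) (yS j) => x e1 e2 e3 /=; rewrite e2 e3.
Qed.

Lemma ae_push_iter j (P : set T) : {ae mu, forall x, P x} ->
  {ae mu, forall x, P (iter j f x)}.
Proof.
elim: j P => [//|j IH] P h.
by have := IH (P \o f) (ae_push h).
Qed.

Lemma past_iter j : {ae mu, forall x, y j (iter j f x) = psi x}.
Proof.
elim: j => [|j IH]; first by apply: filterS ae_carrier => x; exact: y0.
apply: filterS2 IH (ae_push_iter j (yS j)) => x e1 e2.
by rewrite iterS e2.
Qed.

End past.

End transport.

(** * Recurrence *)

Lemma law_integral {R : realType} d1 d2 d3 (T1 : measurableType d1)
    (T2 : measurableType d2) (S : measurableType d3)
    (m1 : {measure set T1 -> \bar R}) (m2 : {measure set T2 -> \bar R})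
    (p : T1 -> S) (q : T2 -> S) (f : S -> \bar R) :
  measurable_fun setT p -> measurable_fun setT q ->
  (forall B, measurable B -> m1 (p @^-1` B) = m2 (q @^-1` B)) ->
  measurable_fun setT f -> (forall x, 0 <= f x)%E ->
  (\int[m1]_x f (p x) = \int[m2]_x f (q x))%E.
Proof.
move=> mp mq pq mf f0.
have @P : {measure set S -> \bar R} by refine (pushforward m1 p); exact: mp.
have @Q : {measure set S -> \bar R} by refine (pushforward m2 q); exact: mq.
transitivity (\int[P]_x f x)%E; first by rewrite (ge0_integral_pushforward mp).
transitivity (\int[Q]_x f x)%E; last by rewrite (ge0_integral_pushforward mq).
by apply: eq_measure_integral => A mA _; exact: pq.
Qed.

Section recurrence.
Context {R : realType} d (T : measurableType d).
Variables (nu : {measure set T -> \bar R}) (g : T -> T) (e : T -> R).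
Hypothesis nu_fin : (nu setT < +oo)%E.
Hypothesis gP : measure_preserving setT nu nu g.
Hypothesis me : measurable_fun setT e.
Hypothesis e01 : forall t, 0 <= e t <= 1.

(** If a particle at t dies with probability e t, this is the probability that
    it is still alive after j steps. *)
Definition survival j t : R := \prod_(i < j) (1 - e (iter i g t)).

Lemma survivalS j t : survival j.+1 t = (1 - e t) * survival j (g t).
Proof.
rewrite /survival big_ord_recl; congr (_ * _); apply: eq_bigr => i _.
by rewrite lift0 iterSr.
Qed.

Lemma survival_itv j t : 0 <= survival j t <= 1.
Proof.
have h s : 0 <= 1 - e s <= 1 by have := e01 s; lra.
apply/andP; split; first by apply: prodr_ge0 => i _; case/andP: (h (iter i g t)).
by apply: prodr_ile1 => i _; exact: h.
Qed.

Lemma measurable_survival j : measurable_fun setT (survival j).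
Proof.
apply: measurable_prod => i _; apply: measurable_funB => //.
exact: (measurableT_comp me (measurable_iter i gP.1)).
Qed.

Lemma survival_noninc t : nonincreasing_seq (survival ^~ t).
Proof.
apply/nonincreasing_seqP => j; rewrite {1}/survival big_ord_recr/= -/(survival j t).
have /andP[s0 _] := survival_itv j t.
by rewrite ler_piMr//; have := e01 (iter j g t); lra.
Qed.

Lemma survival_cvg t : cvgn (survival ^~ t).
Proof.
apply: nonincreasing_is_cvgn; first exact: survival_noninc.
by exists 0 => _ [j _ <-]; have /andP[] := survival_itv j t.
Qed.

Let P t : R := limn (survival ^~ t).

Let P_cvg t : survival ^~ t @ \oo --> P t.
Proof. exact: survival_cvg. Qed.

Let mP : measurable_fun setT P.
Proof.
apply: (@measurable_fun_cvg _ _ _ _ survival) => //; first exact: measurable_survival.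
Qed.

Let P_ge0 t : 0 <= P t.
Proof.
apply: limr_ge; first exact: survival_cvg.
by apply: nearW => j; have /andP[] := survival_itv j t.
Qed.

Let P_le1 t : P t <= 1.
Proof.
apply: limr_le; first exact: survival_cvg.
by apply: nearW => j; have /andP[] := survival_itv j t.
Qed.

Let PE t : P t = (1 - e t) * P (g t).
Proof.
have h : survival ^~ t @ \oo --> (1 - e t) * P (g t).
  rewrite -cvg_shiftS (_ : (fun n => _) = (fun j => (1 - e t) * survival j (g t))).
    by apply: cvgM; [exact: cvg_cst|exact: P_cvg].
  by apply/funext => j; rewrite survivalS.
by apply: (cvg_lim _ h).
Qed.

(** The limit P of the survival probabilities satisfies P = (1 - e) P o g. Since
    P and P o g have the same finite integral, the integral of e (P o g) is 0,
    so P o g = 0 almost everywhere; then the integral of P vanishes too. *)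
Lemma survival_vanishes : {ae nu, forall t, 0 < e t} ->
  {ae nu, forall t, survival ^~ t @ \oo --> 0}.
Proof.
move=> e0.
have mPg : measurable_fun setT (P \o g) by exact: measurableT_comp mP gP.1.
have intfin : (\int[nu]_t (P t)%:E < +oo)%E.
  apply: (@le_lt_trans _ _ (\int[nu]_t (cst 1%E t))%E).
    apply: ge0_le_integral => //.
    - by move=> t _; rewrite lee_fin.
    - exact/measurable_EFinP.
    - by move=> t _; rewrite lee_fin.
  by rewrite integral_cst// mul1e.
have inteq : (\int[nu]_t (P (g t))%:E = \int[nu]_t (P t)%:E)%E.
  apply: (@law_integral _ _ _ _ _ _ _ nu nu g id (EFin \o P)).
  - exact: gP.1.
  - exact: measurable_id.
  - by move=> B mB; rewrite (preserving_preimage gP).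
  - exact/measurable_EFinP.
  - by move=> t; rewrite lee_fin.
have split : (\int[nu]_t (P (g t))%:E =
    \int[nu]_t (P t)%:E + \int[nu]_t (e t * P (g t))%:E)%E.
  rewrite -ge0_integralD//.
  - by apply: eq_integral => t _; rewrite -EFinD [P t]PE; congr EFin; ring.
  - by move=> t _; rewrite lee_fin.
  - exact/measurable_EFinP.
  - by move=> t _; rewrite lee_fin mulr_ge0//; have /andP[] := e01 t.
  - by apply/measurable_EFinP; exact: measurable_funM.
have int0 : (\int[nu]_t (e t * P (g t))%:E = 0)%E.
  have fin : (\int[nu]_t (P t)%:E)%E \is a fin_num.
    by rewrite ge0_fin_numE//; apply: integral_ge0 => t _; rewrite lee_fin.
  by rewrite -[RHS](subee fin) -{1}inteq split addeAC subee// add0e.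
have Pg0 : {ae nu, forall t, P (g t) = 0}.
  have : ae_eq nu setT (fun t => (e t * P (g t))%:E) (cst 0%E).
    apply/ae_eq_integral_abs => //.
      by apply/measurable_EFinP; exact: measurable_funM.
    rewrite -[RHS]int0; apply: eq_integral => t _.
    by rewrite gee0_abs// lee_fin mulr_ge0//; have /andP[] := e01 t.
  move=> h; apply: filterS2 e0 h => t et0 /(_ I) [] /eqP.
  by rewrite mulf_eq0 gt_eqF//= => /eqP.
have intP0 : (\int[nu]_t (P t)%:E = 0)%E.
  rewrite -inteq.
  transitivity (\int[nu]_t (cst 0%E t : \bar R))%E; last exact: integral0.
  apply: ae_eq_integral => //; first exact/measurable_EFinP.
  by apply: filterS Pg0 => t -> _.
have P0 : {ae nu, forall t, P t = 0}.
  have : ae_eq nu setT (fun t => (P t)%:E) (cst 0%E).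
    apply/ae_eq_integral_abs => //; first exact/measurable_EFinP.
    rewrite -[RHS]intP0; apply: eq_integral => t _.
    by rewrite gee0_abs// lee_fin.
  by apply: filterS => t /(_ I) [].
by apply: filterS P0 => t <-; exact: P_cvg.
Qed.

End recurrence.

(** * Contraction of the fibres *)

Section contraction.
Context {R : realType} (k : nat) (N : R).
Hypothesis N0 : 0 < N.
Notation m := k.+1.
Notation point := (m.-tuple R * m.-tuple R)%type.
Implicit Types (t : m.-tuple R) (x y : point) (n i j l : nat).
Notation G := (@triangle_map R m).
Notation F := (@extended_map R m N).
Notation full := (@extended_full_space R m N).
Notation X := (@extended_space R m N).
Notation Y := (@triangle_space R m).

Section positivity.
Variables (a : nat -> R) (n_ : nat -> nat) (h : nat -> nat -> R).
Hypothesis a0 : forall j, 0 < a j.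
Hypothesis h0 : forall i, (i <= m)%N -> 0 <= h 0%N i.
Hypothesis hS : forall j i, (i <= m)%N ->
  h j.+1 i = a j * dual_step k (n_ j) (h j) i.

Let h_ge0 j i : (i <= m)%N -> 0 <= h j i.
Proof.
elim: j i => [|j IH] i im; first exact: h0.
by rewrite hS//; apply: mulr_ge0; [exact: ltW|exact: dual_step_ge0].
Qed.

Let down j i : (i < m)%N -> a j * h j i.+1 <= h j.+1 i.
Proof.
move=> im; rewrite hS 1?ltnW// ler_pM2l//; apply: dual_step_ge => // l.
exact: h_ge0.
Qed.

Let stay j : a j * h j 0%N <= h j.+1 0%N.
Proof.
rewrite hS// ler_pM2l// /dual_step/= mulrDl mul1r addrCA lerDl.
by rewrite addr_ge0 ?mulr_ge0 ?h_ge0.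
Qed.

Let top j : a j * h j 0%N <= h j.+1 m.
Proof. by rewrite hS// /dual_step eqxx. Qed.

Let c j := \prod_(i < j) a i.

Let cS j : c j.+1 = a j * c j.
Proof. by rewrite /c big_ord_recr/= mulrC. Qed.

(** In each step the coordinate i + 1 feeds the coordinate i, the coordinate 0
    feeds itself, and the coordinate 0 feeds m. A trip from l to i goes down to
    0, waits there, jumps to m and goes down to i; with a suitable waiting time
    it takes exactly 2 m steps. *)
Lemma dual_orbit_mixing i l : (i <= m)%N -> (l <= m)%N ->
  (\prod_(j < m.*2) a j) * h 0%N l <= h m.*2 i.
Proof.
move=> im lm.
have fall j : (j <= l)%N -> c j * h 0%N l <= h j (l - j)%N.
  elim: j => [|j IH] jl; first by rewrite /c big_ord0 mul1r subn0.
  rewrite cS -mulrA; apply: (@le_trans _ _ (a j * h j (l - j)%N)).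
    by rewrite ler_pM2l// IH// ltnW.
  have -> : (l - j)%N = (l - j.+1).+1 by lia.
  by apply: down; lia.
have zero j : (l <= j)%N -> c j * h 0%N l <= h j 0%N.
  elim: j => [|j IH]; first by rewrite leqn0 => /eqP l0; have := fall 0%N; rewrite l0; exact.
  rewrite leq_eqVlt => /predU1P[lj|lj].
    by have := fall j.+1; rewrite lj subnn; apply.
  rewrite cS -mulrA; apply: le_trans (stay j).
  by rewrite ler_pM2l// IH.
(* From m downwards, s steps after the jump, which is made at time j. *)
have rise s j : (s <= k)%N -> (m <= j)%N ->
    c (j + s).+1 * h 0%N l <= h (j + s).+1 (m - s)%N.
  elim: s => [|s IH] sk mj.
    rewrite addn0 subn0 cS -mulrA; apply: le_trans (top j).
    by rewrite ler_pM2l// zero// (leq_trans lm).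
  rewrite cS addnS -mulrA; apply: (@le_trans _ _ (a (j + s).+1 * h (j + s).+1 (m - s)%N)).
    by rewrite ler_pM2l// IH// ltnW.
  have -> : (m - s)%N = (m - s.+1).+1 by lia.
  by apply: down; lia.
case: i im => [_|i im]; first by apply: zero; lia.
have := rise (m - i.+1)%N (m.*2 - (m - i.+1).+1)%N.
rewrite (_ : (m.*2 - (m - i.+1).+1 + (m - i.+1)).+1 = m.*2)%N; last by lia.
by rewrite subKn//; apply; lia.
Qed.

End positivity.

Lemma dual_step_linear n (h h' : nat -> R) (th : R) i :
  dual_step k n (fun j => h' j - th * h j) i =
  dual_step k n h' i - th * dual_step k n h i.
Proof. by rewrite /dual_step; case: ifP => _; ring. Qed.

(** Each t_i is at least t_m, and the t_i u_i together with u_0 are positive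
    numbers with sum N. *)
Lemma full_hcrd_le x i : full x -> (i <= m)%N -> hcrd N x i * crd x.1 m <= N.
Proof.
move=> fx im; have [sx ux u0x] := fx.
have t0 j : (1 <= j <= m)%N -> 0 < crd x.1 j by exact: simplex_crd_gt0.
have S0 (P : pred nat) : 0 <= \sum_(1 <= j < m.+1 | P j) crd x.1 j * crd x.2 j.
  rewrite big_seq_cond; apply: sumr_ge0 => j /andP[]; rewrite mem_index_iota => jm _.
  by rewrite ltW// mulr_gt0 ?t0 ?ux.
have u0p : 0 < u0 N x by exact: (full_hcrd fx (leq0n _)).
have tm1 : crd x.1 m <= 1.
  by have /andP[_ /ltW] := simplex_crd sx (leqnn m : (1 <= m <= m)%N).
case: i im => [_|i im].
  apply: (@le_trans _ _ (u0 N x)).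
    by rewrite /hcrd/= ler_piMr// ltW.
  by rewrite /u0 gerBl; exact: (S0 predT).
apply: (@le_trans _ _ (crd x.1 i.+1 * crd x.2 i.+1)).
  rewrite /hcrd/= mulrC ler_pM2r ?ux//.
  by have /andP[] := @simplex_crd _ _ _ i.+1 sx im.
have : 0 < u0 N x by [].
rewrite /u0 subr_gt0 => /ltW; apply: le_trans.
rewrite (bigD1_seq i.+1) ?mem_index_iota ?iota_uniq//= lerDl.
exact: S0.
Qed.

(** After 2 m steps each homogeneous coordinate is at least the product of the
    factors t_1 times the largest initial coordinate, hence at least this
    product divided by m + 1 times their sum; on the other hand it is at most N
    divided by the final t_m. The rate compares these two bounds. The value off
    Y keeps it in [0, 1]. *)
Definition contraction_rate t : R :=
  if t \in Y then (\prod_(j < m.*2) crd (iter j G t) 1) *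
    crd (iter m.*2 G t) m / m.+1%:R else 0.

Lemma triangle_space_iter t j : Y t -> Y (iter j G t).
Proof. by move=> tY; elim: j => // j IH; rewrite iterS; exact: triangle_spaceS. Qed.

Lemma extended_space_iter x j : X x ->
  X (iter j F x) /\ (iter j F x).1 = iter j G x.1.
Proof.
move=> xX; elim: j => // j [IH e]; rewrite !iterS -e.
exact: extended_map_space.
Qed.

Let Ycrd t i : Y t -> (1 <= i <= m)%N -> 0 < crd t i < 1.
Proof.
move=> /triangle_space_simplex st im.
by rewrite simplex_crd_gt0//=; have /andP[] := simplex_crd st im.
Qed.

Lemma contraction_rate_gt0 t : Y t -> 0 < contraction_rate t.
Proof.
move=> tY; rewrite /contraction_rate mem_set// divr_gt0// mulr_gt0//.
  apply: prodr_gt0 => j _.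
  by have /andP[] := Ycrd (triangle_space_iter j tY) (isT : (1 <= 1 <= m)%N).
by have /andP[] := Ycrd (triangle_space_iter m.*2 tY) (leqnn m : (1 <= m <= m)%N).
Qed.

Lemma contraction_rate_itv t : 0 <= contraction_rate t <= 1.
Proof.
have [tY|nY] := pselect (Y t); last by rewrite /contraction_rate memNset//= lexx ler01.
rewrite ltW ?contraction_rate_gt0//= /contraction_rate mem_set//.
rewrite ler_pdivrMr// mul1r; apply: (@le_trans _ _ 1); last by rewrite ler1n.
have /andP[/ltW p1 /ltW p2] := Ycrd (triangle_space_iter m.*2 tY) (leqnn m : (1 <= m <= m)%N).
apply: mulr_ile1 => //.
  apply: prodr_ge0 => j _.
  by have /andP[/ltW] := Ycrd (triangle_space_iter j tY) (isT : (1 <= 1 <= m)%N).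
apply: prodr_ile1 => j _.
by have /andP[/ltW -> /ltW ->] := Ycrd (triangle_space_iter j tY) (isT : (1 <= 1 <= m)%N).
Qed.

(** The difference of the coordinates of x' and th times those of x is
    nonnegative and satisfies the same linear recursion. Its coordinates have
    sum at least (1 - th) N, because paired with (1, t_1, ..., t_m) they give (1
    - th) N. By mixing, after 2 m steps each of them is at least a definite
    fraction of that sum, which is turned into a multiple of the coordinate of x
    by its upper bound. *)
Lemma fiber_contraction x x' (th : R) : X x -> X x' -> x.1 = x'.1 ->
  0 <= th <= 1 ->
  (forall i, (i <= m)%N -> th * hcrd N x i <= hcrd N x' i) ->
  forall i, (i <= m)%N ->
  (th + (1 - th) * contraction_rate x.1) * hcrd N (iter m.*2 F x) i <=
  hcrd N (iter m.*2 F x') i.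
Proof.
move=> xX x'X xx' /andP[th0 th1] hh i im.
have fst_eq j : (iter j F x').1 = (iter j F x).1.
  by rewrite (extended_space_iter j xX).2 (extended_space_iter j x'X).2 xx'.
have [n_ nE] := choice
  (xX : forall j, exists n, extended_domain N n (iter j F x)).
have nE' j : extended_domain N (n_ j) (iter j F x').
  apply/extended_domainE; split.
    by have := (extended_space_iter j x'X).1; rewrite extended_spaceE => -[].
  by rewrite fst_eq; have /extended_domainE[] := nE j.
pose r j i := hcrd N (iter j F x') i - th * hcrd N (iter j F x) i.
pose a j := crd (iter j G x.1) 1.
have aE j : crd (iter j F x).1 1 = a j by rewrite (extended_space_iter j xX).2.
have a0 j : 0 < a j by rewrite -aE; exact: dom_crd_gt0 (nE j).
have r0 l : (l <= m)%N -> 0 <= r 0%N l by move=> lm; rewrite subr_ge0; exact: hh.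
have rS j l : (l <= m)%N -> r j.+1 l = a j * dual_step k (n_ j) (r j) l.
  move=> lm; rewrite /r !iterS (extended_mapE (nE j)) (extended_mapE (nE' j)).
  rewrite !hcrd_branch ?fst_eq ?aE ?gt_eqF// dual_step_linear; ring.
have mix l : (l <= m)%N -> (\prod_(j < m.*2) a j) * r 0%N l <= r m.*2 i.
  by move=> lm; exact: (dual_orbit_mixing a0 r0 rS).
have xY : Y x.1 by move: xX; rewrite extended_spaceE => -[].
have sumr : (1 - th) * N <= \sum_(0 <= l < m.+1) r 0%N l.
  have -> : (1 - th) * N = r 0%N 0%N +
      \sum_(1 <= l < m.+1) crd x.1 l * r 0%N l.
    have e (z : point) : u0 N z + \sum_(1 <= l < m.+1) crd z.1 l * crd z.2 l = N.
      by rewrite /u0 subrK.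
    rewrite (eq_big_nat _ _ (F2 := fun l => crd x'.1 l * crd x'.2 l -
      th * (crd x.1 l * crd x.2 l))); last first.
      case=> // l _; rewrite /r /hcrd /= -xx'; ring.
    rewrite sumrB -mulr_sumr /r/= /hcrd/=.
    have := congr1 ( *%R th) (e x); have := e x'; rewrite mulrDr; lra.
  rewrite [leRHS]big_nat_recl// lerD2l big_add1/= big_nat [leRHS]big_nat.
  apply: ler_sum => l /= lm; rewrite ler_piMl ?r0//.
  by have /andP[_ /ltW] := @Ycrd x.1 l.+1 xY lm.
have cK : 0 <= \prod_(j < m.*2) a j by apply: prodr_ge0 => j _; exact: ltW.
have low : (\prod_(j < m.*2) a j) * ((1 - th) * N) <= m.+1%:R * r m.*2 i.
  apply: (@le_trans _ _ (\sum_(0 <= l < m.+1) (\prod_(j < m.*2) a j) * r 0%N l)).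
    by rewrite -big_distrr/= ler_wpM2l.
  have -> : m.+1%:R * r m.*2 i = \sum_(0 <= l < m.+1) r m.*2 i.
    by rewrite big_const_nat subn0 iter_addr_0 mulr_natl.
  rewrite big_nat [leRHS]big_nat; apply: ler_sum => l /andP[_ lm].
  by apply: mix; rewrite -ltnS.
have fK : full (iter m.*2 F x).
  by have := (extended_space_iter m.*2 xX).1; rewrite extended_spaceE => -[].
have up := full_hcrd_le fK im.
rewrite mulrDl -lerBrDl -/(r m.*2 i).
rewrite -(@ler_pM2l _ m.+1%:R)//; apply: le_trans low.
rewrite /contraction_rate mem_set// -(extended_space_iter m.*2 xX).2.
set C := \prod_(j < _) _; set tm := crd _ m; set H := hcrd _ _ _.
have -> : m.+1%:R * ((1 - th) * (C * tm / m.+1%:R) * H) = C * ((1 - th) * (H * tm)).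
  have : m.+1%:R != 0 :> R by rewrite pnatr_eq0.
  by move: (m.+1%:R) => q q0; field.
by rewrite ler_wpM2l// ler_wpM2l// subr_ge0.
Qed.

Definition decay : nat -> m.-tuple R -> R :=
  survival (iter m.*2 G) contraction_rate.

Lemma decaySr j t :
  decay j.+1 t = decay j t * (1 - contraction_rate (iter (j * m.*2) G t)).
Proof. by rewrite /decay /survival big_ord_recr/= iterM. Qed.

Lemma decay_itv j t : 0 <= decay j t <= 1.
Proof. exact: (survival_itv _ contraction_rate_itv). Qed.

(** Start with th = 0 and apply the contraction to each block of 2 m steps. *)
Lemma fiber_decay x x' j : X x -> X x' -> x.1 = x'.1 -> forall i, (i <= m)%N ->
  (1 - decay j x.1) * hcrd N (iter (j * m.*2) F x) i <=
  hcrd N (iter (j * m.*2) F x') i.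
Proof.
move=> xX x'X xx'; elim: j => [|j IH] i im.
  rewrite /decay /survival big_ord0 subrr mul0r ltW// full_hcrd//.
  by move: x'X; rewrite extended_spaceE => -[].
have [h1 h2] := extended_space_iter (j * m.*2) xX.
have [h1' h2'] := extended_space_iter (j * m.*2) x'X.
have th : 0 <= 1 - decay j x.1 <= 1 by have := decay_itv j x.1; lra.
have := fiber_contraction h1 h1' _ th IH im.
rewrite h2 h2' xx' => /(_ erefl); rewrite -!iterD -mulSn decaySr => h.
apply: le_trans h; rewrite le_eqVlt; apply/orP; left; apply/eqP.
by congr (_ * _); ring.
Qed.

(** The comparison holds with x and x' exchanged, and the coordinates are
    bounded by N divided by t_m. *)
Lemma fiber_distance x x' j i : X x -> X x' -> x.1 = x'.1 -> (1 <= i <= m)%N ->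
  `|crd (iter (j * m.*2) F x).2 i - crd (iter (j * m.*2) F x').2 i| *
    crd (iter (j * m.*2) G x.1) m <= decay j x.1 * N.
Proof.
have half z z' : X z -> X z' -> z.1 = z'.1 -> (1 <= i <= m)%N ->
    (crd (iter (j * m.*2) F z).2 i - crd (iter (j * m.*2) F z').2 i) *
    crd (iter (j * m.*2) G z.1) m <= decay j z.1 * N.
  move=> zX z'X zz' /andP[i1 im].
  have [h1 h2] := extended_space_iter (j * m.*2) zX.
  have := fiber_decay j zX z'X zz' im.
  have fz : full (iter (j * m.*2) F z) by move: h1; rewrite extended_spaceE => -[].
  have := full_hcrd_le fz im; rewrite h2 /hcrd (gtn_eqF i1).
  have tm0 : 0 < crd (iter (j * m.*2) G z.1) m.
    by rewrite -h2; apply: simplex_crd_gt0; rewrite ?leqnn//; case: fz.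
  have /andP[d0 _] := decay_itv j z.1.
  move: (crd _ i) (crd (iter _ F z').2 i) tm0 => u u' tm0 hN hd.
  move: (decay _ _) d0 hd => D d0 hd.
  apply: (@le_trans _ _ (D * u * crd (iter (j * m.*2) G z.1) m)).
    by rewrite ler_pM2r//; lra.
  by rewrite -mulrA ler_wpM2l.
move=> xX x'X xx' im; have /orP[h|h] := le_total
  (crd (iter (j * m.*2) F x').2 i) (crd (iter (j * m.*2) F x).2 i).
  by rewrite ger0_norm ?subr_ge0//; exact: half.
by rewrite distrC ger0_norm ?subr_ge0// xx'; exact: half.
Qed.

Lemma measurable_contraction_rate : measurable_fun setT contraction_rate.
Proof.
have mi i j : measurable_fun setT (fun t => crd (iter j G t) i).
  exact: (measurableT_comp (measurable_crd i)
    (measurable_iter j (@measurable_triangle_map R k))).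
rewrite (_ : contraction_rate = fun t => \1_Y t *
  ((\prod_(j < m.*2) crd (iter j G t) 1) * crd (iter m.*2 G t) m / m.+1%:R)).
  apply: measurable_funM.
    by apply: measurable_indic; exact: measurable_triangle_space.
  apply: measurable_funM => //; apply: measurable_funM => //.
  by apply: measurable_prod => j _; exact: mi.
apply/funext => t; rewrite indicE /contraction_rate.
by case: ifP; rewrite ?mul1r ?mul0r.
Qed.

End contraction.

(** * Recurrence along pasts *)

Section chain_survival.
Context {R : realType} d d' (T : measurableType d) (T' : measurableType d').
Variables (nu : {measure set T -> \bar R}) (g : T -> T) (e : T -> R).
Hypothesis nu_fin : (nu setT < +oo)%E.
Hypothesis gP : measure_preserving setT nu nu g.
Hypothesis me : measurable_fun setT e.
Hypothesis e01 : forall t, 0 <= e t <= 1.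
Variables (mu : {measure set T' -> \bar R}) (z : nat -> T' -> T).
Hypothesis mz : forall j, measurable_fun setT (z j).
Hypothesis law_z : forall j B, measurable B -> mu (z j @^-1` B) = nu B.
Hypothesis gz : forall j, {ae mu, forall x, g (z j.+1 x) = z j x}.
Hypothesis vanish : {ae nu, forall t, survival g e ^~ t @ \oo --> 0}.

Let S del j : set T := [set t | del < survival g e j t].

Let mS del j : measurable (S del j).
Proof. by apply: measurable_lt_set => //; exact: measurable_survival gP me j. Qed.

Let nuS del : 0 < del -> (fun j => nu (S del j)) @ \oo --> 0%E.
Proof.
move=> del0.
have mcap : measurable (\bigcap_j S del j) by exact: bigcap_measurableType.
have <- : nu (\bigcap_j S del j) = 0%E.
  apply/negligibleP => //; apply: negligibleS vanish => t tS tv.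
  have : \forall j \near \oo, survival g e j t < del.
    by have := cvgr_lt 0 tv del; apply.
  move=> [j _ /(_ j (leqnn j))] /=; have /= := tS j I.
  by move=> h1 h2; have := lt_trans h1 h2; rewrite ltxx.
apply: nonincreasing_cvg_mu => //.
  by apply: le_lt_trans nu_fin; apply: le_measure; rewrite ?inE.
apply/nonincreasing_seqP => j; apply/subsetPset => t; rewrite /S/=.
by move=> /lt_le_trans; apply; apply: (@survival_noninc _ _ _ g e e01 t).
Qed.

(** Here z is an orbit in negative time whose terms have the law nu. Hence
    survival e j (z j), the product over the last j steps before time 0, has the
    law of survival e j and tends to 0 in probability. It decreases with j,
    because each longer product has one more factor, so it tends to 0 almost
    everywhere. *)
Lemma chain_survival :
  {ae mu, forall x, (fun j => survival g e j (z j x)) @ \oo --> 0}.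
Proof.
pose B n := \bigcap_j (z j @^-1` (S n.+1%:R^-1 j)).
have mB n : measurable (B n).
  by apply: bigcap_measurableType => j _; exact: measurable_preimage.
have B0 n : mu (B n) = 0%E.
  apply/eqP; rewrite -measure_le0.
  have n0 : 0 < n.+1%:R^-1 :> R by rewrite invr_gt0.
  apply: (cvge_to_ge (nuS n0)); apply: nearW => j.
  rewrite -(law_z j (mS _ j)); apply: le_measure; rewrite ?inE//.
    exact: measurable_preimage.
  by move=> x Bx; exact: Bx.
have aeB : {ae mu, forall x n, ~ B n x}.
  apply: ae_foralln => n; exists (B n); split=> //.
  by move=> x /= /contrapT.
have aez : {ae mu, forall x j, g (z j.+1 x) = z j x} by exact: ae_foralln.
apply: filterS2 aeB aez => x nB gzx.
have dec j j' : (j <= j')%N -> survival g e j' (z j' x) <= survival g e j (z j x).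
  move=> /subnK <-; elim: (j' - j)%N => // l IH; rewrite addSn.
  apply: le_trans IH; rewrite survivalS gzx.
  have /andP[s0 _] := @survival_itv _ _ _ g e e01 (l + j) (z (l + j)%N x).
  by rewrite ler_piMl//; have := e01 (z (l + j).+1 x); lra.
apply/cvgrPdist_lt => eps eps0.
have [n _ nE] := near_infty_natSinv_lt (PosNum eps0).
have : exists j, survival g e j (z j x) <= n.+1%:R^-1.
  apply: contrapT => h; apply: (nB n) => j _ /=; rewrite /S/= ltNge.
  by apply/negP => h'; apply: h; exists j.
move=> [j hj]; exists j => // j' /= jj'.
have /andP[s0 _] := @survival_itv _ _ _ g e e01 j' (z j' x).
rewrite sub0r normrN ger0_norm//; apply: (le_lt_trans (dec _ _ jj')).
by apply: (le_lt_trans hj); apply: (nE n); rewrite /=.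
Qed.

End chain_survival.

Section laws.
Context {R : realType} (n : nat).
Notation point := (n.-tuple R * n.-tuple R)%type.

Definition coordwise_cvg (s : nat -> point) (l : point) :=
  forall i, crd (s j).1 i @[j --> \oo] --> crd l.1 i /\
            crd (s j).2 i @[j --> \oo] --> crd l.2 i.

Lemma point_sigma_algebra (C : set (set point)) : sigma_algebra setT C ->
  (forall i (c : R), C [set x | c < crd x.1 i]) ->
  (forall i (c : R), C [set x | c < crd x.2 i]) ->
  measurable `<=` C.
Proof.
move=> sC C1 C2 A mA.
pose Tc := g_sigma_algebraType C.
have CE : measurable `<=` (C : set (set Tc)).
  by move=> B; apply: smallest_sub.
have sub (B : set Tc) : C B -> measurable B by exact: sub_sigma_algebra.
have half (h : Tc -> R) : (forall c, C [set x | c < h x]) -> measurable_fun setT h.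
  move=> hC; apply: (measurability _ (RGenOInfty.measurableE R)) => //= _ [_ [c ->] <-].
  rewrite setTI; apply: sub; rewrite (_ : _ @^-1` _ = [set x | c < h x])//.
  by apply/seteqP; split => x /=; rewrite in_itv/= andbT.
have mid : measurable_fun setT (id : Tc -> point).
  apply/measurable_fun_pairP; split; apply/measurable_fun_tnthP => i.
    apply: half => c; have := C1 i.+1 c; congr C; apply/seteqP.
    by split => x /=; rewrite (tnth_nth 0).
  apply: half => c; have := C2 i.+1 c; congr C; apply/seteqP.
  by split => x /=; rewrite (tnth_nth 0).
by have := mid measurableT A mA; rewrite setTI => /CE.
Qed.

Definition coordwise_continuous (h : point -> R) := measurable_fun setT h /\
  forall s l, coordwise_cvg s l -> h (s j) @[j --> \oo] --> h l.

End laws.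

(** * The law of an almost everywhere limit *)

Section limit_law.
Context {R : realType} (n : nat) d1 d2 (T1 : measurableType d1)
  (T2 : measurableType d2).
Notation point := (n.-tuple R * n.-tuple R)%type.
Variables (m1 : {measure set T1 -> \bar R}) (m2 : {measure set T2 -> \bar R}).
Variables (a_ : nat -> T1 -> point) (a : T1 -> point).
Variables (b_ : nat -> T2 -> point) (b : T2 -> point).
Hypothesis m1_fin : (m1 setT < +oo)%E.
Hypothesis m2_fin : (m2 setT < +oo)%E.
Hypothesis ma_ : forall j, measurable_fun setT (a_ j).
Hypothesis ma : measurable_fun setT a.
Hypothesis mb_ : forall j, measurable_fun setT (b_ j).
Hypothesis mb : measurable_fun setT b.
Hypothesis ab : forall j B, measurable B -> m1 (a_ j @^-1` B) = m2 (b_ j @^-1` B).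
Hypothesis a_a : {ae m1, forall x, coordwise_cvg (a_ ^~ x) (a x)}.
Hypothesis b_b : {ae m2, forall x, coordwise_cvg (b_ ^~ x) (b x)}.

(* For r >= 0 these bounded continuous functions of r increase to the indicator
   of r > 0. *)
Let approx j (r : R) : R := 1 - (1 + r)^-1 ^+ j.

Let approx_itv j (r : R) : 0 <= r -> 0 <= approx j r <= 1.
Proof.
move=> r0; have r1 : 0 < 1 + r by rewrite ltr_pwDl.
have q0 : 0 <= (1 + r)^-1 by rewrite invr_ge0 ltW.
have q1 : (1 + r)^-1 <= 1 by rewrite invf_le1// lerDl.
by rewrite /approx subr_ge0 gerBl exprn_ge0// exprn_ile1.
Qed.

Let approx_cvg (r : R) : 0 <= r -> (fun j => approx j r) @ \oo --> ((0 < r)%R%:R : R).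
Proof.
rewrite le_eqVlt => /predU1P[<-|r0].
  rewrite ltxx/= /approx addr0 invr1.
  under eq_fun do rewrite expr1n subrr; exact: cvg_cst.
rewrite r0/= -[X in _ --> X]subr0; apply: cvgB; first exact: cvg_cst.
apply: cvg_expr; rewrite ger0_norm ?invr_ge0 ?addr_ge0// ?ltW//.
by rewrite invf_lt1 ?ltrDl// ltr_pwDl// ltW.
Qed.

Let approx_continuous j (u : nat -> R) (l : R) : 0 <= l ->
  u @ \oo --> l -> (fun i => approx j (u i)) @ \oo --> approx j l.
Proof.
move=> l0 ul.
have h : (fun i => (1 + u i)^-1) @ \oo --> (1 + l)^-1.
  apply: cvgV; first by rewrite gt_eqF// ltr_pwDl.
  by apply: cvgD => //; exact: cvg_cst.
apply: cvgB; first exact: cvg_cst.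
apply: (cvg_comp (fun i => (1 + u i)^-1) (fun x : R => x ^+ j) h).
exact: exprn_continuous.
Qed.

Let mapprox d (T : measurableType d) j (u : T -> R) : measurable_fun setT u ->
  measurable_fun setT (fun x => (approx j (u x))%:E).
Proof.
move=> mu; apply/measurable_EFinP; apply: measurable_funB => //.
by apply: measurable_funX; apply: measurable_funV; exact: measurable_funD.
Qed.

Let dominated d (T : measurableType d) (m : {measure set T -> \bar R})
    (u : nat -> T -> R) (v : T -> R) : (m setT < +oo)%E ->
  (forall j, measurable_fun setT (u j)) -> measurable_fun setT v ->
  (forall j x, 0 <= u j x <= 1) ->
  {ae m, forall x, u ^~ x @ \oo --> v x} ->
  (fun j => \int[m]_x (u j x)%:E)%E @ \oo --> (\int[m]_x (v x)%:E)%E.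
Proof.
move=> mfin mu mv u01 uv.
have [] := @dominated_convergence _ _ _ m setT measurableT
  (fun j x => (u j x)%:E) (fun x => (v x)%:E) (cst 1%E) => //.
- by move=> j; exact/measurable_EFinP.
- exact/measurable_EFinP.
- by apply: filterS uv => x h _; apply: cvg_EFin => //; exact: nearW.
- apply/integrableP; split; first exact: measurable_cst.
  have -> : (\int[m]_x `|cst 1%E x| = \int[m]_x (cst 1%E x : \bar R))%E.
    by apply: eq_integral => x _ /=; rewrite normr1.
  by rewrite integral_cst// mul1e.
- by apply: aeW => x j _ /=; rewrite lee_fin; have /andP[? ?] := u01 j x;
    rewrite ger0_norm.
Qed.

(* For bounded continuous functions of the limits, the integrals agree by
   dominated convergence; the approximations of the indicator of h > 0 are such
   functions. *)
Let positive_set (h : point -> R) : coordwise_continuous h -> (forall x, 0 <= h x) ->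
  m1 (a @^-1` [set x | 0 < h x]) = m2 (b @^-1` [set x | 0 < h x]).
Proof.
move=> [mh ch] h0.
have I1 j : (\int[m1]_x (approx j (h (a x)))%:E =
             \int[m2]_x (approx j (h (b x)))%:E)%E.
  have appr01 i (x : point) : 0 <= approx i (h x) <= 1 by exact: approx_itv.
  have c1 : (fun i => \int[m1]_x (approx j (h (a_ i x)))%:E)%E @ \oo -->
      (\int[m1]_x (approx j (h (a x)))%:E)%E.
    apply: dominated => //.
    - by move=> i; apply/measurable_EFinP/mapprox; exact: measurableT_comp.
    - by apply/measurable_EFinP/mapprox; exact: measurableT_comp.
    - by apply: filterS a_a => x ax; apply: approx_continuous => //; exact: ch.
  have c2 : (fun i => \int[m2]_x (approx j (h (b_ i x)))%:E)%E @ \oo -->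
      (\int[m2]_x (approx j (h (b x)))%:E)%E.
    apply: dominated => //.
    - by move=> i; apply/measurable_EFinP/mapprox; exact: measurableT_comp.
    - by apply/measurable_EFinP/mapprox; exact: measurableT_comp.
    - by apply: filterS b_b => x ax; apply: approx_continuous => //; exact: ch.
  have e : (fun i => \int[m1]_x (approx j (h (a_ i x)))%:E)%E =
           (fun i => \int[m2]_x (approx j (h (b_ i x)))%:E)%E.
    apply/funext => i.
    apply: (law_integral (f := fun x => (approx j (h x))%:E) (ma_ i) (mb_ i)).
    + exact: ab.
    + exact: mapprox.
    + by move=> x; rewrite lee_fin; have /andP[] := appr01 j x.
  by rewrite -(cvg_lim _ c1)// e (cvg_lim _ c2).
have indic d (T : measurableType d) (m : {measure set T -> \bar R}) (c : T -> point) :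
    measurable_fun setT c -> (m setT < +oo)%E ->
    (fun j => \int[m]_x (approx j (h (c x)))%:E)%E @ \oo -->
    m (c @^-1` [set x | 0 < h x]).
  move=> mc mfin.
  have mhc : measurable (c @^-1` [set x | 0 < h x]).
    apply: measurable_preimage mc _; exact: measurable_lt_set.
  rewrite -[m _]/(m (c @^-1` _)) -[X in _ --> m X]setIT -integral_indic//.
  apply: dominated => //.
  - by move=> j; apply/measurable_EFinP/mapprox; exact: measurableT_comp.
  - by move=> j x; exact: approx_itv.
  - apply: aeW => x; rewrite indicE.
    have -> : (x \in c @^-1` [set x | 0 < h x]) = (0 < h (c x)).
      by apply/idP/idP; rewrite inE.
    exact: approx_cvg.
have h1 := indic _ _ m1 a ma m1_fin; have h2 := indic _ _ m2 b mb m2_fin.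
have e : (fun j => \int[m1]_x (approx j (h (a x)))%:E)%E =
         (fun j => \int[m2]_x (approx j (h (b x)))%:E)%E.
  by apply/funext => j; exact: I1.
by rewrite -(cvg_lim _ h1)// e; apply: (cvg_lim _ h2).
Qed.

(** The sets h > 0, for h >= 0 measurable and continuous along coordinatewise
    convergence, are closed under intersection and generate the measurable sets. *)
Lemma limit_law B : measurable B -> m1 (a @^-1` B) = m2 (b @^-1` B).
Proof.
pose P : set (set point) := [set B | exists h, [/\ coordwise_continuous h,
  forall x, 0 <= h x & B = [set x | 0 < h x]]].
have PT : P setT.
  exists (cst 1); split => //.
    by split => // s l _; exact: cvg_cst.
  by apply/seteqP; split => x //= _; exact: ltr01.
have PI : setI_closed P.
  move=> _ _ [h [[mh ch] h0 ->]] [h' [[mh' ch'] h0' ->]].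
  exists (fun x => h x * h' x); split.
  - split; first exact: measurable_funM.
    by move=> s l sl; apply: cvgM; [exact: ch|exact: ch'].
  - by move=> x; exact: mulr_ge0.
  - apply/seteqP; split => x /=; first by move=> [? ?]; exact: mulr_gt0.
    move=> hh; split; rewrite lt_neqAle ?h0 ?h0' andbT eq_sym;
      by apply/eqP => z; move: hh; rewrite z ?mul0r ?mulr0 ltxx.
have half (crd' : point -> R) (c : R) : measurable_fun setT crd' ->
    (forall s l, coordwise_cvg s l -> crd' (s j) @[j --> \oo] --> crd' l) ->
    P [set x | c < crd' x].
  move=> mc cc; exists (fun x => (crd' x - c) + `|crd' x - c|); split.
  - split.
      apply: measurable_funD; first exact: measurable_funB.
      by apply: measurableT_comp => //; exact: measurable_funB.
    move=> s l sl; have h : crd' (s j) - c @[j --> \oo] --> crd' l - c.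
      by apply: cvgB; [exact: cc|exact: cvg_cst].
    by apply: cvgD => //; exact: cvg_norm.
  - by move=> x; rewrite -lerBlDl sub0r -normrN ler_norm.
  - apply/seteqP; split => x /=.
      by rewrite -subr_gt0 => h; rewrite addr_gt0// gtr0_norm.
    move=> h; rewrite -subr_gt0; move: h.
    move: (crd' x - c) => r; case: (ltP 0 r) => // r0.
    by rewrite ler0_norm// subrr ltxx.
have mE : measurable = <<s P>>.
  apply/seteqP; split.
    apply: point_sigma_algebra.
    - exact: smallest_sigma_algebra.
    - move=> i c; apply: sub_sigma_algebra; apply: half.
        exact: (measurableT_comp (measurable_crd i) measurable_fst).
      by move=> s l /(_ i)[].
    - move=> i c; apply: sub_sigma_algebra; apply: half.
        exact: (measurableT_comp (measurable_crd i) measurable_snd).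
      by move=> s l /(_ i)[].
  apply: smallest_sub; first exact: sigma_algebra_measurable.
  by move=> _ [h [[mh _] _ ->]]; exact: measurable_lt_set.
have @Q1 : {measure set point -> \bar R} by refine (pushforward m1 a); exact: ma.
have @Q2 : {measure set point -> \bar R} by refine (pushforward m2 b); exact: mb.
move=> mB; suff : Q1 B = Q2 B by [].
apply: (measure_unique P (fun=> setT)) => //.
- by rewrite bigcup_const//; exists 0%N.
- by move=> _ [h [ch h0 ->]]; exact: positive_set.
Qed.

End limit_law.

(** * Reconstruction of a point from its past *)

Section reconstruction.
Context {R : realType} (k : nat) (N : R).
Hypothesis N0 : 0 < N.
Notation m := k.+1.
Notation point := (m.-tuple R * m.-tuple R)%type.
Implicit Types (t : m.-tuple R) (n i j l : nat).
Notation G := (@triangle_map R m).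
Notation F := (@extended_map R m N).
Notation mu := (@extended_measure R m N).
Notation nu := (@triangle_measure R m N).
Notation X := (@extended_space R m N).
Notation Y := (@triangle_space R m).
Notation decay := (@decay R k).

(** From the projection t of a point j steps in the past, the present point is
    guessed by taking some point over t and letting it move. *)
Definition reconstruct j t : point := iter j F (fiber_section N t).

(** The orbits in negative time along which the fibres are contracted to a
    point. *)
Definition past (y : nat -> m.-tuple R) :=
  [/\ forall j, Y (y j), forall j, G (y j.+1) = y j &
      decay j (y (j * m.*2)%N) @[j --> \oo] --> 0].

Lemma fiber_section_space t : Y t -> X (fiber_section N t).
Proof.
move=> tY; rewrite extended_spaceE; split => //.
exact/fiber_section_full/triangle_space_simplex.
Qed.

Lemma past_iterE (y : nat -> m.-tuple R) j l :
  (forall j, G (y j.+1) = y j) -> iter l G (y (j + l)%N) = y j.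
Proof.
move=> Gy; elim: l j => [|l IH] j; first by rewrite addn0.
by rewrite iterSr addnS Gy IH.
Qed.

(** The distance is bounded relatively to t_m at the end of the orbit, which is
    y 0. *)
Lemma past_distance (y : nat -> m.-tuple R) (w w' : point) j i :
  (forall j, Y (y j)) -> (forall j, G (y j.+1) = y j) ->
  X w -> X w' -> w.1 = y (j * m.*2)%N -> w'.1 = y (j * m.*2)%N ->
  (1 <= i <= m)%N ->
  `|crd (iter (j * m.*2) F w).2 i - crd (iter (j * m.*2) F w').2 i| <=
    decay j (y (j * m.*2)%N) * (N / crd (y 0%N) m).
Proof.
move=> yY Gy wX w'X e e' im.
have tm : 0 < crd (y 0%N) m.
  by apply: simplex_crd_gt0; [exact: triangle_space_simplex|rewrite leqnn].
rewrite mulrA ler_pdivlMr//.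
have := fiber_distance N0 j wX w'X (etrans e (esym e')) im.
by rewrite e (@past_iterE y 0%N).
Qed.

(** Every guess based on y j is also F^J of some point over the more recent y J;
    so all guesses from j >= J on lie in the image of one fibre under J steps. *)
Lemma reconstructE (y : nat -> m.-tuple R) j J :
  (forall j, Y (y j)) -> (forall j, G (y j.+1) = y j) -> (J <= j)%N ->
  exists w : point, [/\ X w, w.1 = y J & reconstruct j (y j) = iter J F w].
Proof.
move=> yY Gy Jj; exists (iter (j - J) F (fiber_section N (y j))).
have [h1 h2] := extended_space_iter (j - J) (fiber_section_space (yY j)).
split => //; first by rewrite h2 -[in LHS](subnKC Jj) addKn past_iterE.
by rewrite /reconstruct -{1}(subnKC Jj) iterD.
Qed.

Lemma reconstruct_space (y : nat -> m.-tuple R) j :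
  (forall j, Y (y j)) -> (forall j, G (y j.+1) = y j) ->
  X (reconstruct j (y j)) /\ (reconstruct j (y j)).1 = y 0%N.
Proof.
by move=> yY Gy; have [w [wX w1 ->]] := reconstructE yY Gy (leq0n j).
Qed.

Lemma small_decay (y : nat -> m.-tuple R) (eps : R) : past y -> 0 < eps ->
  exists J, decay J (y (J * m.*2)%N) * (N / crd (y 0%N) m) < eps.
Proof.
move=> [yY Gy dy] eps0.
have tm : 0 < crd (y 0%N) m.
  by apply: simplex_crd_gt0; [exact: triangle_space_simplex|rewrite leqnn].
have c0 : 0 < N / crd (y 0%N) m by rewrite divr_gt0.
have e0 : 0 < eps / (N / crd (y 0%N) m) by rewrite divr_gt0.
have [J _ /(_ J (leqnn J)) /= h] := cvgr_lt 0 dy _ e0.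
by exists J; rewrite -ltr_pdivlMr.
Qed.

Lemma reconstruct_cvg (y : nat -> m.-tuple R) i : past y -> (1 <= i <= m)%N ->
  cvgn (fun j => crd (reconstruct j (y j)).2 i).
Proof.
move=> py im; have [yY Gy dy] := py.
apply/cauchy_cvgP/cauchy_exP => eps eps0.
have [J hJ] := small_decay py eps0.
exists (crd (reconstruct (J * m.*2) (y (J * m.*2)%N)).2 i).
exists (J * m.*2)%N => // j /= Jj; rewrite /ball/=.
have [w [wX w1 ->]] := reconstructE yY Gy Jj.
have [w' [w'X w'1 ->]] := reconstructE yY Gy (leqnn (J * m.*2)%N).
by apply: le_lt_trans hJ; apply: past_distance.
Qed.

Lemma crd_out t i : ~~ (1 <= i <= m)%N -> crd t i = if i == 0%N then crd t 1 else 0.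
Proof.
case: i => [|i] //=; rewrite -ltnNge ltnS => im.
by rewrite /crd nth_default// size_tuple.
Qed.

Lemma coordwise_cvgP (s : nat -> point) (l : point) :
  (forall i, (1 <= i <= m)%N -> crd (s j).1 i @[j --> \oo] --> crd l.1 i) ->
  (forall i, (1 <= i <= m)%N -> crd (s j).2 i @[j --> \oo] --> crd l.2 i) ->
  coordwise_cvg s l.
Proof.
move=> h1 h2 i; have [im|nim] := boolP (1 <= i <= m)%N.
  by split; [exact: h1|exact: h2].
split; rewrite crd_out//.
  under eq_fun do rewrite crd_out//.
  by case: (i == 0%N); [exact: h1|exact: cvg_cst].
under eq_fun do rewrite crd_out//.
by case: (i == 0%N); [exact: h2|exact: cvg_cst].
Qed.

Lemma measurable_reconstruct j : measurable_fun setT (reconstruct j).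
Proof.
exact: (measurableT_comp (measurable_iter j (@measurable_extended_map R k N))
  (measurable_fiber_section N)).
Qed.

Section covering.
Context d (T : measurableType d) (mu' : {measure set T -> \bar R}) (X' : set T)
  (f : T -> T) (psi : T -> m.-tuple R).
Hypothesis cov : invertible_covering X' mu' f Y nu G psi.

(** All y j have the law nu, so the pasts stay in Y, and the recurrence of the
    triangle map carries over to them. *)
Lemma covering_past : exists y : nat -> T -> m.-tuple R,
  [/\ forall j, measurable_fun setT (y j),
      forall x, X' x -> y 0%N x = psi x,
      forall j, {ae mu', forall x, y j.+1 (f x) = y j x},
      forall j B, measurable B -> mu' (y j @^-1` B) = nu B &
      {ae mu', forall x, past (y ^~ x)}].
Proof.
have [cX pf one ppsi _ equi] := cov.
have [y [my y0 yS]] := past_chain cX pf one ppsi.1.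
have law := past_law cX pf ppsi my y0 yS.
have step := past_step cX pf (@measurable_triangle_map R k) equi my y0 yS.
exists y; split => //.
have aeY : {ae mu', forall x j, Y (y j x)}.
  apply: ae_foralln => j; exists (y j @^-1` (~` Y)); split => //.
    apply: measurable_preimage => //; apply: measurableC.
    exact: measurable_triangle_space.
  rewrite law; first exact: triangle_space_conull.
  by apply: measurableC; exact: measurable_triangle_space.
have aeG : {ae mu', forall x j, G (y j.+1 x) = y j x} by exact: ae_foralln.
have vanish : {ae nu, forall t,
    survival (iter m.*2 G) (@contraction_rate R k) ^~ t @ \oo --> 0}.
  apply: survival_vanishes.
  - exact: triangle_measure_fin.
  - by apply: preserving_iter; exact: triangle_map_preserving.
  - exact: measurable_contraction_rate.
  - exact: contraction_rate_itv.
  - exists (~` Y); split.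
    + by apply: measurableC; exact: measurable_triangle_space.
    + exact: triangle_space_conull.
    + by move=> t /= h tY; apply: h; exact: contraction_rate_gt0.
have aeD : {ae mu', forall x, decay j (y (j * m.*2)%N x) @[j --> \oo] --> 0}.
  apply: (chain_survival (z := fun j => y (j * m.*2)%N) _ _ _ _ _ _ _ vanish).
  - exact: triangle_measure_fin.
  - by apply: preserving_iter; exact: triangle_map_preserving.
  - exact: measurable_contraction_rate.
  - exact: contraction_rate_itv.
  - by move=> j; exact: my.
  - by move=> j; exact: law.
  - move=> j; apply: filterS aeG => x Gx.
    by rewrite mulSn addnC (@past_iterE (y ^~ x)).
by apply: filterS3 aeY aeG aeD => x h1 h2 h3; split.
Qed.

Lemma reconstruction_limit (y : nat -> T -> m.-tuple R) :
  (forall j, measurable_fun setT (y j)) -> {ae mu', forall x, past (y ^~ x)} ->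
  exists phi : T -> point, [/\ measurable_fun setT phi,
    forall x, (phi x).1 = y 0%N x &
    {ae mu', forall x, coordwise_cvg (fun j => reconstruct j (y j x)) (phi x)}].
Proof.
move=> my [A [mA A0 hA]].
have good x : ~ A x -> past (y ^~ x).
  by move=> nA; apply: contrapT => np; apply: nA; exact: hA.
(* Removing an exceptional null set makes the limit exist at every point, hence
   measurable. *)
pose u j i x := \1_(~` A) x * crd (reconstruct j (y j x)).2 i : R.
have mu_ j i : measurable_fun setT (u j i).
  apply: measurable_funM; first by apply: measurable_indic; exact: measurableC.
  exact: (measurableT_comp (measurable_crd2 i)
    (measurableT_comp (measurable_reconstruct j) (my j))).
have ucvg i x : (1 <= i <= m)%N -> cvgn (fun j => u j i x).
  move=> im; rewrite /u; have [Ax|nA] := pselect (A x).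
    rewrite indicE memNset; last by move=> /=.
    under eq_fun do rewrite mul0r; exact: is_cvg_cst.
  rewrite indicE mem_set//; under eq_fun do rewrite mul1r.
  exact: reconstruct_cvg (good x nA) im.
pose v i x := limn (fun j => u j i x).
exists (fun x => (y 0%N x, [tuple v i.+1 x | i < m])); split => //.
  apply/measurable_fun_pairP; split; first exact: my.
  apply: measurable_mktuple => i.
  apply: (@measurable_fun_cvg _ _ _ _ (u ^~ i.+1)) => // x _.
  exact: (ucvg i.+1 x (ltn_ord i)).
exists A; split => // x; apply: contra_notP => nA; apply: coordwise_cvgP => /= i im.
  have [yY Gy _] := good x nA.
  under eq_fun do rewrite (reconstruct_space _ yY Gy).2; exact: cvg_cst.
rewrite (crd_mktuple (fun i => v i.+1 x))//.
rewrite prednK; last by case/andP: im.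
have := ucvg i x im; rewrite /v /u indicE mem_set//.
by under eq_fun do rewrite mul1r.
Qed.

End covering.

End reconstruction.

(** * Universality *)

Section natural.
Context {R : realType} (k : nat) (N : R).
Hypothesis N0 : 0 < N.
Notation m := k.+1.
Notation point := (m.-tuple R * m.-tuple R)%type.
Implicit Types (t : m.-tuple R) (x : point) (n i j l : nat).
Notation G := (@triangle_map R m).
Notation F := (@extended_map R m N).
Notation mu := (@extended_measure R m N).
Notation nu := (@triangle_measure R m N).
Notation X := (@extended_space R m N).
Notation Y := (@triangle_space R m).
Notation decay := (@decay R k).
Notation reconstruct := (@reconstruct R k N).

Let cX : carried_by mu X :=
  conj (@measurable_extended_space R k N) (extended_space_conull k N0).

Let mpF j : measure_preserving setT mu mu (iter j F) :=
  preserving_iter j (extended_map_preserving k N0).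

Let carriedT : carried_by mu setT.
Proof. by split; [exact: measurableT|rewrite setCT; exact: measure0]. Qed.

Section self.
Variable y : nat -> point -> m.-tuple R.
Hypothesis my : forall j, measurable_fun setT (y j).
Hypothesis y0 : forall x, X x -> y 0%N x = x.1.
Hypothesis yS : forall j, {ae mu, forall x, y j.+1 (F x) = y j x}.
Hypothesis yP : {ae mu, forall x, past (y ^~ x)}.

Let pF : measure_preserving X mu mu F := covering_preserving (extended_covering k N0).

Lemma past_extended_iter j : {ae mu, forall x, y j (iter j F x) = x.1}.
Proof. exact: (past_iter cX pF y0 yS). Qed.

Let near_set J j := [set x | forall i, (1 <= i <= m)%N ->
  `|crd (reconstruct j (y j x)).2 i - crd x.2 i| <=
    decay J (y (J * m.*2)%N x) * (N / crd (y 0%N x) m)].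

Let measurable_near_set J j : measurable (near_set J j).
Proof.
rewrite (_ : near_set J j = \bigcap_(i in [set i | (1 <= i <= m)%N])
  ~` [set x | decay J (y (J * m.*2)%N x) * (N / crd (y 0%N x) m) <
     `|crd (reconstruct j (y j x)).2 i - crd x.2 i|]); last first.
  apply/seteqP; split => x h i im /=; first by apply/negP; rewrite -leNgt h.
  by rewrite leNgt; apply/negP; exact: h.
apply: bigcap_measurableType => i _; apply: measurableC.
apply: measurable_lt_set.
  apply: measurable_funM.
    apply: (measurableT_comp _ (my (J * m.*2)%N)).
    apply: measurable_survival; last exact: measurable_contraction_rate.
    by apply: preserving_iter; exact: (triangle_map_preserving k N0).
  apply: measurable_funM => //; apply: measurable_funV.
  exact: (measurableT_comp (measurable_crd m) (my 0%N)).
apply: measurableT_comp => //; apply: measurable_funB; last exact: measurable_crd2.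
exact: (measurableT_comp (measurable_crd2 i)
    (measurableT_comp (measurable_reconstruct N j) (my j))).
Qed.

Let ae_near_set J j : (J * m.*2 <= j)%N -> {ae mu, forall x, near_set J j x}.
Proof.
move=> Jj; apply: (ae_pull carriedT (mpF j) (measurable_near_set J j)).
have h : {ae mu, forall x, past (y ^~ (iter j F x))}.
  exact: (ae_push_iter cX pF j yP).
apply: filterS3 (ae_carrier cX) (past_extended_iter j) h => z zX yz [yY Gy _] i im.
have [w [wX w1 ->]] := reconstructE N0 yY Gy Jj.
have zj := subnKC Jj.
have ez : iter j F z = iter (J * m.*2) F (iter (j - J * m.*2) F z).
  by rewrite -iterD zj.
have [w'X w'1] := extended_space_iter (j - J * m.*2) zX.
rewrite [in X in _ - X]ez; apply: (past_distance N0 (y := y ^~ (iter j F z))) => //.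
by rewrite w'1 -yz -[in X in y X]zj (past_iterE (y := y ^~ (iter j F z))).
Qed.

(** At time j write x = F^j z. The guess is then F^j of some point in the fibre
    of z, and the fibre has been contracted. Being an almost sure statement
    about F^j z, the estimate holds at almost every x. *)
Lemma reconstruct_self :
  {ae mu, forall x, coordwise_cvg (fun j => reconstruct j (y j x)) x}.
Proof.
have near : {ae mu, forall x J j, (J * m.*2 <= j)%N -> near_set J j x}.
  apply: ae_foralln => J; apply: ae_foralln => j.
  case: (leqP (J * m.*2)%N j) => Jj; last by apply: aeW => x.
  by apply: filterS (ae_near_set Jj) => x h _.
apply: filterS3 (ae_carrier cX) yP near => x xX py h.
have [yY Gy dy] := py.
apply: coordwise_cvgP => i im.
  under eq_fun do rewrite (reconstruct_space N0 _ yY Gy).2 y0//.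
  exact: cvg_cst.
apply/cvgrPdist_lt => eps eps0; have [J hJ] := small_decay N0 py eps0.
exists (J * m.*2)%N => // j /= Jj; rewrite distrC.
by apply: le_lt_trans hJ; exact: h.
Qed.

End self.

Lemma coordwise_cvg_unique (s : nat -> point) (l l' : point) :
  coordwise_cvg s l -> coordwise_cvg s l' -> l = l'.
Proof.
move=> h h'; rewrite (surjective_pairing l) (surjective_pairing l').
have u (r : nat -> R) (a b : R) : r @ \oo --> a -> r @ \oo --> b -> a = b.
  by move=> ra rb; rewrite -(cvg_lim _ ra)//; apply: (cvg_lim _ rb).
congr pair; apply: eq_from_tnth => i; rewrite !(tnth_nth 0).
  exact: u (h i.+1).1 (h' i.+1).1.
exact: u (h i.+1).2 (h' i.+1).2.
Qed.

Lemma extended_map_fiber_continuous (s : nat -> point) (l : point) :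
  (forall j, X (s j)) -> X l -> (forall j, (s j).1 = l.1) ->
  coordwise_cvg s l -> coordwise_cvg (fun j => F (s j)) (F l).
Proof.
move=> sX lX s1 sl; have [n ln] := lX 0%N; rewrite /= in ln.
have sn j : extended_domain N n (s j).
  apply/extended_domainE; split.
    by have := sX j; rewrite extended_spaceE => -[].
  by rewrite s1; have /extended_domainE[] := ln.
rewrite (extended_mapE ln).
rewrite (_ : (fun j => F (s j)) = fun j => extended_branch N n (s j)); last first.
  by apply/funext => j; exact: extended_mapE.
have hs i : hcrd N (s j) i @[j --> \oo] --> hcrd N l i.
  rewrite /hcrd; case: (i == 0%N); last exact: (sl i).2.
  apply: cvgB; first exact: cvg_cst.
  apply: cvg_big => [|i' _]; first exact: add_continuous.
  by apply: cvgM; [exact: (sl i').1|exact: (sl i').2].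
apply: coordwise_cvgP => i im.
  by rewrite /=; under eq_fun do rewrite s1; exact: cvg_cst.
rewrite crd_extended_branch//.
under eq_fun do rewrite crd_extended_branch// s1.
apply: cvgM; first exact: cvg_cst.
rewrite /dual_step; case: (i == m); first exact: hs.
by apply: cvgD; [exact: hs|apply: cvgM; [exact: cvg_cst|exact: hs]].
Qed.

(** Let phi be the limit of the guesses based on the pasts in the covering. The
    law of the j-th guess depends on nu only, so it is the same as in X, where
    the guesses tend to the identity; hence phi has the law mu. It commutes with
    the maps because the guess at f s of index j + 1 is the image of the guess
    at s of index j. *)
Lemma universal d (T : measurableType d) (X' : set T)
    (mu' : {measure set T -> \bar R}) (f : T -> T) (psi : T -> m.-tuple R) :
  invertible_covering X' mu' f Y nu G psi ->
  exists phi : T -> point, [/\ measure_preserving X' mu' mu phi,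
      {ae mu', forall s, phi (f s) = F (phi s)} &
      {ae mu', forall s, (phi s).1 = psi s}].
Proof.
move=> cov; have [cX' pf _ ppsi _ _] := cov.
have [y [my y0 yS law yP]] := covering_past N0 cov.
have [phi [mphi phi1 phi_cvg]] := reconstruction_limit N0 my yP.
have [z [mz z0 zS zlaw zP]] := covering_past N0 (extended_covering k N0).
have z_cvg := reconstruct_self mz z0 zS zP.
have fin' : (mu' setT < +oo)%E.
  have := law 0%N setT measurableT; rewrite preimage_setT => ->.
  exact: triangle_measure_fin.
have philaw B : measurable B -> mu' (phi @^-1` B) = mu B.
  move=> mB.
  have := @limit_law R m _ _ T _ mu' mu (fun j s => reconstruct j (y j s)) phi
    (fun j s => reconstruct j (z j s)) id fin'.
  apply => //.
  - exact: extended_measure_fin.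
  - by move=> j; exact: measurableT_comp (measurable_reconstruct N j) (my j).
  - by move=> j; exact: measurableT_comp (measurable_reconstruct N j) (mz j).
  - move=> j C mC.
    have mC' := measurable_preimage (measurable_reconstruct N j) mC.
    transitivity (nu (reconstruct j @^-1` C)); first exact: law.
    by apply/esym; exact: zlaw.
have aeX : {ae mu', forall s, X (phi s)}.
  exists (phi @^-1` (~` X)); split => //.
    by apply: measurable_preimage => //; apply: measurableC; exact: cX.1.
  by rewrite philaw; [exact: cX.2|apply: measurableC; exact: cX.1].
exists phi; split.
- split; first exact: measurable_funTS.
  move=> B mB; rewrite -philaw//.
  have mphB := measurable_preimage mphi mB.
  apply: (measure_concentrated cX'.1 cX'.2) => //.
    by apply: measurableI => //; exact: cX'.1.
  by move=> s Xx; split => [[]|].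
- have yS' : {ae mu', forall s j, y j.+1 (f s) = y j s} by exact: ae_foralln.
  have cvgf := ae_push cX' pf phi_cvg.
  have all1 : {ae mu', forall s, (forall j, y j.+1 (f s) = y j s) /\
      coordwise_cvg (fun j => reconstruct j (y j (f s))) (phi (f s))}.
    by apply: filterS2 yS' cvgf => s; split.
  have all2 : {ae mu', forall s, past (y ^~ s) /\
      coordwise_cvg (fun j => reconstruct j (y j s)) (phi s)}.
    by apply: filterS2 yP phi_cvg => s; split.
  apply: filterS3 aeX all1 all2 => s phiX [yf cf] [[yY Gy _] cx].
  have recX j := reconstruct_space N0 j yY Gy.
  have step j : reconstruct j.+1 (y j.+1 (f s)) = F (reconstruct j (y j s)).
    by rewrite yf.
  apply: (@coordwise_cvg_unique (fun j => reconstruct j.+1 (y j.+1 (f s)))).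
    by move=> i; have [c1 c2] := cf i; split; [move: c1|move: c2]; rewrite -cvg_shiftS.
  under eq_fun do rewrite step.
  apply: extended_map_fiber_continuous => // j; first exact: (recX j).1.
  by rewrite (recX j).2 phi1.
- by apply: filterS (ae_carrier cX') => s Xx; rewrite phi1 y0.
Qed.

End natural.

(** * Generation *)

Section completion.
Context {R : realType} d (T : measurableType d).
Variables (mu : {measure set T -> \bar R}) (X : set T).
Hypothesis cX : carried_by mu X.
Variable E : set (set T).
Hypothesis sE : sigma_algebra X E.

Lemma null_eqP (A B : set T) :
  null_eq mu A B <-> {ae mu, forall s, A s <-> B s}.
Proof.
rewrite /null_eq; split; apply: negligibleS => s /=.
  move=> nAB; apply: contrapT => h; apply: nAB.
  by split => hs; apply: contrapT => ns; apply: h; [left|right].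
by move=> [[As nBs]|[Bs nAs]] [AB BA]; [exact/nBs/AB|exact/nAs/BA].
Qed.

Definition null_completion : set (set T) :=
  [set B | exists2 A, E A & null_eq mu B A].

Lemma null_completion_eq (B B' : set T) :
  {ae mu, forall s, B s <-> B' s} -> null_completion B' -> null_completion B.
Proof.
move=> BB' [A EA /null_eqP B'A]; exists A => //; apply/null_eqP.
by apply: filterS2 BB' B'A => s h h'; rewrite h.
Qed.

Lemma null_completion_sigma_algebra : sigma_algebra setT null_completion.
Proof.
have [E0 EC EU] := sE; split.
- by exists set0 => //; exact: null_eq_refl.
- move=> B [A EA /null_eqP BA]; exists (X `\` A); first exact: EC.
  apply/null_eqP; apply: filterS2 (ae_carrier cX) BA => s Xs [BA AB].
  by split => -[_ n]; split => // h; apply: n; [exact: AB|exact: BA].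
- move=> B hB; have [A hA] := choice (fun j => let: ex_intro2 A a b := hB j in
    ex_intro (fun A => E A /\ null_eq mu (B j) A) A (conj a b)).
  exists (\bigcup_j A j); first by apply: EU => j; exact: (hA j).1.
  have h : {ae mu, forall s j, B j s <-> A j s}.
    by apply: ae_foralln => j; apply/null_eqP; exact: (hA j).2.
  apply/null_eqP; apply: filterS h => s h.
  by split => -[j _ hj]; exists j => //; exact/h.
Qed.

End completion.

Section generation.
Context {R : realType} (k : nat) (N : R).
Hypothesis N0 : 0 < N.
Notation m := k.+1.
Notation point := (m.-tuple R * m.-tuple R)%type.
Implicit Types (t : m.-tuple R) (x : point) (n i j l : nat).
Notation F := (@extended_map R m N).
Notation mu := (@extended_measure R m N).
Notation X := (@extended_space R m N).
Notation reconstruct := (@reconstruct R k N).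

Let cX : carried_by mu X :=
  conj (@measurable_extended_space R k N) (extended_space_conull k N0).

Let mpF j : measure_preserving setT mu mu (iter j F) :=
  preserving_iter j (extended_map_preserving k N0).

Let pF : measure_preserving X mu mu F := covering_preserving (extended_covering k N0).

Let carriedT : carried_by mu setT.
Proof. by split; [exact: measurableT|rewrite setCT; exact: measure0]. Qed.

Lemma iter_extended_map_inj j : {in X &, injective (iter j F)}.
Proof.
elim: j => [|j IH] x x' //; rewrite !inE => xX xX' /= e.
apply: IH; rewrite ?inE//; apply: (extended_map_inj (N := N)) e; rewrite inE.
  by have [] := extended_space_iter j xX.
by have [] := extended_space_iter j xX'.
Qed.

Lemma measurable_iter_image j (A : set point) : measurable A -> A `<=` X ->
  measurable (iter j F @` A) /\ iter j F @` A `<=` X.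
Proof.
move=> mA AX; split; last first.
  by move=> _ [x Ax <-]; have [] := extended_space_iter j (AX x Ax).
elim: j => [|j IH]; first by rewrite image_id.
rewrite (_ : _ @` _ = F @` (iter j F @` A)); last by rewrite -image_comp.
apply: measurable_image => // _ [x Ax <-].
by have [] := extended_space_iter j (AX x Ax).
Qed.

Let E := <<s X, forward_images X F fst >>.

Let sE : sigma_algebra X E. Proof. exact: smallest_sigma_algebra. Qed.

Lemma generated_measurable : E `<=` measurable.
Proof.
suff h : E `<=` [set A | measurable A /\ A `<=` X] by move=> A /h[].
apply: smallest_sub.
  split.
  - by split; [exact: measurable0|exact: sub0set].
  - by move=> A [mA AX]; split; [exact: measurableD cX.1 mA|move=> x []].
  - move=> A hA; split; first by apply: bigcup_measurable => j _; exact: (hA j).1.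
    by move=> x [j _]; exact: (hA j).2.
move=> _ [j [B [mB ->]]]; apply: measurable_iter_image => //.
by apply: measurableI; [exact: cX.1|exact: measurable_preimage measurable_fst mB].
Qed.

Section self.
Variable y : nat -> point -> m.-tuple R.
Hypothesis my : forall j, measurable_fun setT (y j).
Hypothesis y0 : forall x, X x -> y 0%N x = x.1.
Hypothesis yS : forall j, {ae mu, forall x, y j.+1 (F x) = y j x}.

(** Almost everywhere this preimage is the image under F^j of the points of X
    over B. *)
Lemma past_generated j (B : set (m.-tuple R)) : measurable B ->
  null_completion mu E (y j @^-1` B).
Proof.
move=> mB.
have mXB : measurable (X `&` fst @^-1` B : set point).
  by apply: measurableI; [exact: cX.1|exact: measurable_preimage measurable_fst mB].
have [mI IX] := measurable_iter_image j mXB (@subIsetl _ _ _).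
exists (iter j F @` (X `&` fst @^-1` B)).
  by apply: sub_gen_smallest; exists j, B.
have myB := measurable_preimage (my j) mB.
apply/null_eqP; set I := _ @` _.
suff : {ae mu, forall x, (~` ((y j @^-1` B `\` I) `|` (I `\` (y j @^-1` B)))) x}.
  apply: filterS => x nD; split => h; apply: contrapT => nh; apply: nD.
    by left.
  by right.
apply: (ae_pull carriedT (mpF j)).
  by apply: measurableC; apply: measurableU; apply: measurableD.
apply: filterS2 (ae_carrier cX) (past_extended_iter N0 y0 yS j) => x xX e.
move=> [[]|[]]; rewrite /preimage/= e.
  by move=> Bx; apply; exists x.
move=> [x' [x'X Bx'] xx'] nB; apply: nB.
by rewrite -(iter_extended_map_inj _ _ xx') ?inE.
Qed.

End self.

(** The t-coordinates are y 0, and the u-coordinates are the limits of functions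
    of the y j. *)
Lemma measurable_generated (A : set point) : measurable A ->
  null_completion mu E A.
Proof.
have [y [my y0 yS law yP]] := covering_past N0 (extended_covering k N0).
have rec_cvg := reconstruct_self N0 my y0 yS yP.
have sC := null_completion_sigma_algebra cX sE.
have [_ CC CU] := sC.
have CI (H : nat -> set point) : (forall j, null_completion mu E (H j)) ->
    null_completion mu E (\bigcap_j H j).
  move=> hH; rewrite -[X in null_completion _ _ X]setCK setC_bigcap -setTD.
  by apply: (CC); apply: (CU) => j; rewrite -setTD; exact: CC.
move: A; apply: (point_sigma_algebra sC) => i c.
  apply: (null_completion_eq (B' := y 0%N @^-1` [set t | c < crd t i])).
    by apply: filterS (ae_carrier cX) => x xX; rewrite /preimage/= y0.
  apply: past_generated => //.
  by apply: measurable_lt_set => //; exact: measurable_crd.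
pose H p j := y j @^-1` [set t | c + p.+1%:R^-1 < crd (reconstruct j t).2 i].
have CH p j : null_completion mu E (H p j).
  apply: past_generated => //; apply: measurable_lt_set => //.
  exact: measurableT_comp (measurable_crd2 i) (measurable_reconstruct N j).
apply: (null_completion_eq (B' := \bigcup_p \bigcup_J \bigcap_j H p (J + j)%N)).
  apply: filterS rec_cvg => x /(_ i)[_ cv]; split => /= [cx|].
    have [p hp] : exists p, c + p.+1%:R^-1 < crd x.2 i.
      have e0 : 0 < crd x.2 i - c by rewrite subr_gt0.
      have [p _ /(_ p (leqnn p)) h] := near_infty_natSinv_lt (PosNum e0).
      by exists p; move: h => /=; rewrite ltrBrDl.
    have [J _ hJ] := cvgr_gt _ cv _ hp.
    by exists p => //; exists J => // j _; apply: hJ => /=; exact: leq_addr.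
  move=> [p _ [J _ hJ]].
  have : c + p.+1%:R^-1 <= crd x.2 i.
    rewrite -(cvg_lim _ cv)//; apply: limr_ge; first exact: cvgP cv.
    exists J => // j /= Jj.
    by have := hJ (j - J)%N I; rewrite /H/= subnKC// => /ltW.
  by apply: lt_le_trans; rewrite ltrDl invr_gt0.
by apply: (CU) => p; apply: (CU) => J; exact: CI.
Qed.

Lemma generated (A : set point) :
  measurable_mod_null mu A <->
  exists2 B, <<s X, forward_images X F fst >> B & null_eq mu A B.
Proof.
split => [[B mB /null_eqP AB]|[B EB AB]].
  exact: null_completion_eq AB (measurable_generated mB).
by exists B => //; exact: generated_measurable.
Qed.

End generation.

Theorem theorem10p3 (R : realType) (m : nat) (N : R) (hm : (1 <= m)%N)
    (hN : 0 < N) :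
  natural_extension
    (extended_space m N) (extended_measure m N) (extended_map m N)
    (triangle_space R m) (triangle_measure m N) (triangle_map m)
    fst.
Proof.
case: m hm => [//|k _].
have mY := @measurable_triangle_space R k.
have Y0 := triangle_space_conull k hN.
split.
- exact: (conj mY Y0).
- split; first exact: measurable_funTS (@measurable_triangle_map R k).
  move=> B mB; rewrite -(preserving_preimage (triangle_map_preserving k hN) mB).
  have mGB := measurable_preimage (@measurable_triangle_map R k) mB.
  apply: (measure_concentrated mY Y0); [exact: measurableI|exact: mGB|].
  by move=> t Yt; split => [[]|].
- exact: extended_covering.
- by move=> A _; exact: generated.
- by move=> d T X mu f psi; exact: universal.
Qed.
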